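(* Let $1/2<\alpha\le 1$, let $\theta^0\in\mathcal X^{1-2\alpha}(\mathbb R^2)$, and let $\theta\in\mathcal C([0,T^* ),\mathcal X^{1-2\alpha}(\mathbb R^2))$, $0<T^*\le\infty$, be the maximal solution of the quasi-geostrophic equation $$\partial_t\theta+(-\Delta)^{\alpha}\theta+u_\theta\cdot\nabla\theta=0,\qquad \theta(0)=\theta^0.\qquad (\mathbf S_\alpha)$$ Then $$T^*<\infty\ \Longrightarrow\ \int_0^{T^*}\|\theta(t)\|_{\mathcal X^{1}}\,dt=\infty.$$
   Context: Fourier transform: $\widehat f(\xi)=\mathcal F(f)(\xi)=\int_{\mathbb R^2}e^{-ix\cdot\xi}f(x)\,dx$, with inverse $\frac1{(2\pi)^2}\int e^{ix\cdot\xi}f(x)\,dx$. For $\sigma\in\mathbb R$, $\mathcal X^\sigma(\mathbb R^2)$ is the space of (tempered) distributions $f$ on $\mathbb R^2$ whose Fourier transform is a function with $|\xi|^\sigma\widehat f(\xi)\in L^1(\mathbb R^2)$, with norm $\|f\|_{\mathcal X^\sigma}=\int_{\mathbb R^2}|\xi|^\sigma|\widehat f(\xi)|\,d\xi$. The fractional Laplacian is defined by $\widehat{(-\Delta)^{\alpha}f}(\xi)=|\xi|^{2\alpha}\widehat f(\xi)$, and $e^{-t|D|^{2\alpha}}$ is the Fourier multiplier with symbol $e^{-t|\xi|^{2\alpha}}$. The velocity is $u_\theta=(\partial_2(-\Delta)^{-1/2}\theta,\,-\partial_1(-\Delta)^{-1/2}\theta)$, which is divergence free, so $u_\theta\cdot\nabla\theta=\mathrm{div}(\theta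 u_\theta)$. A solution of $(\mathbf S_\alpha)$ on an interval $I=[0,T]$ (or $I=[0,T)$, $0<T\le\infty$) is understood as a function $\theta\in\mathcal C(I,\mathcal X^{1-2\alpha}(\mathbb R^2))$ which belongs to $L^1([0,t],\mathcal X^1(\mathbb R^2))$ for every $t\in I$ (so that the nonlinear term makes sense) and satisfies the integral equation $$\theta(t)=e^{-t|D|^{2\alpha}}\theta^0-\int_0^t e^{-(t-z)|D|^{2\alpha}}\,\mathrm{div}(\theta u_\theta)(z)\,dz,\qquad t\in I.$$ For every $\theta^0\in\mathcal X^{1-2\alpha}(\mathbb R^2)$ there is a $T>0$ and a unique solution on $[0,T]$. The maximal solution is the solution on $[0,T^* )$ that cannot be extended to a solution on a strictly larger interval. *)

(* Defs.v *)
From HB Require Import structures.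
From mathcomp Require Import all_boot all_order all_algebra.
From mathcomp Require Import complex.
From mathcomp Require Import all_classical all_reals all_analysis.

Set Implicit Arguments.
Unset Strict Implicit.
Unset Printing Implicit Defensive.

Import Order.TTheory GRing.Theory Num.Theory.
Import numFieldNormedType.Exports.

Local Open Scope classical_set_scope.
Local Open Scope ring_scope.
Local Open Scope complex_scope.

(* The library integrates real-valued functions only: complex measurability,
   integrability and integrals are taken on real and imaginary parts. *)
Section complex_integral.
Context {d : measure_display} {T : measurableType d} {R : realType}.
Variable mu : {measure set T -> \bar R}.

Definition cmeasurable (f : T -> R[i]) : Prop :=
  measurable_fun setT (fun x => complex.Re (f x)) /\
  measurable_fun setT (fun x => complex.Im (f x)).

Definition cintegrable (D : set T) (f : T -> R[i]) : Prop :=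
  mu.-integrable D (fun x => (complex.Re (f x))%:E) /\
  mu.-integrable D (fun x => (complex.Im (f x))%:E).

Definition cint (D : set T) (f : T -> R[i]) : R[i] :=
  Rintegral mu D (fun x => complex.Re (f x)) +i*
  Rintegral mu D (fun x => complex.Im (f x)).

End complex_integral.

Notation leb1 := (@lebesgue_measure _).
Notation leb2 := (@lebesgue_measure _ \x @lebesgue_measure _)%E.

Section plane.
Context {R : realType}.
Implicit Types (phi g m : R * R -> R[i]) (x xi : R * R).

Definition cmod (z : R[i]) : R := ComplexField.Normc.normc z.

Definition cis (t : R) : R[i] := cos t +i* sin t.

Definition dotp x xi : R := x.1 * xi.1 + x.2 * xi.2.

(* The Euclidean norm; the library's norm on R * R is the sup norm. *)
Definition enorm x : R := Num.sqrt (x.1 ^+ 2 + x.2 ^+ 2).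

(* Directions are indexed by bool: false is the first, true the second. *)
Definition coord (j : bool) x : R := if j then x.2 else x.1.

Definition basis (j : bool) : R * R := if j then (0, 1) else (1, 0).

Definition cpartial (j : bool) phi : R * R -> R[i] := fun x =>
  'D_(basis j) (fun y => complex.Re (phi y)) x +i*
  'D_(basis j) (fun y => complex.Im (phi y)) x.

Definition cpartials (w : seq bool) phi : R * R -> R[i] :=
  foldr cpartial phi w.

Definition smooth phi : Prop := forall (w : seq bool) x,
  differentiable (fun y => complex.Re (cpartials w phi y)) x /\
  differentiable (fun y => complex.Im (cpartials w phi y)) x.

Definition seminorm_values (N : nat) phi : set R :=
  [set r | exists (w : seq bool) x, (size w <= N)%N /\
     r = (1 + enorm x) ^+ N * cmod (cpartials w phi x)].

Definition schwartz phi : Prop :=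
  smooth phi /\ forall N, has_ubound (seminorm_values N phi).

Definition seminorm (N : nat) phi : R := sup (seminorm_values N phi).

Definition fourier phi : R * R -> R[i] := fun xi =>
  cint leb2 setT (fun x => cis (- dotp x xi) * phi x).

Definition ifourier phi : R * R -> R[i] := fun x =>
  (((2 * pi) ^+ 2)^-1)%:C * cint leb2 setT (fun xi => cis (dotp x xi) * phi xi).

End plane.

(* A distribution is a functional on all complex functions of which only the
   values at Schwartz functions are meaningful; [deq] is the corresponding
   equality. *)
Definition dist (R : realType) : Type := (R * R -> R[i]) -> R[i].

Section distributions.
Context {R : realType}.
Implicit Types (phi psi g m : R * R -> R[i]) (S T : dist R).

Definition deq S T : Prop := forall phi, schwartz phi -> S phi = T phi.

Definition tempered T : Prop :=
  (forall (c : R[i]) phi psi, schwartz phi -> schwartz psi ->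
     T (fun x => c * phi x + psi x) = c * T phi + T psi) /\
  (exists (N : nat) (K : R),
     forall phi, schwartz phi -> cmod (T phi) <= K * seminorm N phi).

Definition dsub S T : dist R := fun phi => S phi - T phi.

Definition dpartial (j : bool) T : dist R := fun phi => - T (cpartial j phi).

Definition dfourier T : dist R := fun phi => T (fourier phi).

Definition difourier T : dist R := fun phi => T (ifourier phi).

Definition dist_of g : dist R :=
  fun phi => cint leb2 setT (fun x => g x * phi x).

Definition represents T g : Prop :=
  cmeasurable g /\
  (forall phi, schwartz phi -> cintegrable leb2 setT (fun x => g x * phi x)) /\
  deq T (dist_of g).

Definition is_function T : Prop := exists g, represents T g.

(* The function representing T (unique up to null sets) when there is one,
   and 0 otherwise. *)
Definition fun_of T : R * R -> R[i] :=
  xget (fun=> 0) [set g | represents T g].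

Definition fhat T : R * R -> R[i] := fun_of (dfourier T).

(* The Fourier multiplier with symbol m, for T whose Fourier transform is a
   function. *)
Definition multiplier m T : dist R :=
  difourier (dist_of (fun xi => m xi * fhat T xi)).

(* The product of two distributions that are functions. *)
Definition dmul S T : dist R := dist_of (fun x => fun_of S x * fun_of T x).

Definition Xnorm (sigma : R) T : \bar R :=
  (\int[leb2]_xi (enorm xi `^ sigma * cmod (fhat T xi))%:E)%E.

Definition Xspace (sigma : R) : set (dist R) :=
  [set T | [/\ tempered T, is_function (dfourier T) & (Xnorm sigma T < +oo)%E]].

End distributions.

Section quasi_geostrophic.
Context {R : realType}.
Implicit Types (alpha : R) (I : set R) (T : dist R) (theta : R -> dist R).

Definition laplacian_symbol (s : R) (xi : R * R) : R := enorm xi `^ (2 * s).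

Definition heat_symbol alpha (t : R) (xi : R * R) : R[i] :=
  (expR (- t * laplacian_symbol alpha xi))%:C.

(* The symbol of d_j (-Delta)^(-1/2) as a single multiplier: for T in
   X^(1 - 2 alpha) with alpha < 1, (-Delta)^(-1/2) T alone need not be a
   tempered distribution, as its transform may fail to be integrable at 0. *)
Definition riesz_symbol (j : bool) (xi : R * R) : R[i] :=
  0 +i* (coord j xi * laplacian_symbol (- 2^-1) xi).

Definition velocity1 T : dist R := multiplier (riesz_symbol true) T.

Definition velocity2 T : dist R :=
  multiplier (fun xi => - riesz_symbol false xi) T.

Definition nonlinearity T : dist R := fun phi =>
  dpartial false (dmul T (velocity1 T)) phi +
  dpartial true (dmul T (velocity2 T)) phi.

Definition continuous_in_X I (sigma : R) theta : Prop :=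
  (forall t, I t -> Xspace sigma (theta t)) /\
  (forall t, I t ->
     Xnorm sigma (dsub (theta s) (theta t)) @[s --> within I (nbhs t)]
       --> 0%E).

(* Strong measurability into X^sigma is not repeated here: it is automatic for
   a curve that is continuous into some X^rho, as in [solution]. *)
Definition integrable_in_X (t sigma : R) theta : Prop :=
  {ae leb1, forall s, `[0, t]%classic s -> Xspace sigma (theta s)} /\
  leb1.-integrable `[0, t] (fun s => Xnorm sigma (theta s)).

(* The integral of distributions is the weak one, against each Schwartz
   function. *)
Definition duhamel alpha (theta0 : dist R) theta (t : R) : Prop :=
  forall phi, schwartz phi ->
    let F z :=
      multiplier (heat_symbol alpha (t - z)) (nonlinearity (theta z)) phi in
    cintegrable leb1 `[0, t] F /\
    theta t phi =
      multiplier (heat_symbol alpha t) theta0 phi - cint leb1 `[0, t] F.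

Definition solution alpha (theta0 : dist R) I theta : Prop :=
  [/\ continuous_in_X I (1 - 2 * alpha) theta,
      forall t, I t -> integrable_in_X t 1 theta &
      forall t, I t -> duhamel alpha theta0 theta t].

Definition half_open (b : \bar R) : set R :=
  [set t | 0 <= t /\ (t%:E < b)%E].

Definition time_interval I : Prop :=
  (exists b : R, 0 < b /\ I = `[0, b]%classic) \/
  (exists b : \bar R, (0 < b)%E /\ I = half_open b).

Definition maximal_solution alpha (theta0 : dist R) (Tstar : \bar R) theta : Prop :=
  [/\ (0 < Tstar)%E,
      solution alpha theta0 (half_open Tstar) theta &
      forall (J : set R) (theta' : R -> dist R),
        time_interval J -> half_open Tstar `<` J ->
        solution alpha theta0 J theta' ->
        ~ (forall t, half_open Tstar t -> deq (theta' t) (theta t))].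

End quasi_geostrophic.

(* Main.v *)
(* Suppose that T = T* is finite and that theta is in L^1(0, T; X^1).  Since
   |xi + eta|^(2 - 2 alpha) is at most a constant times
   |xi|^(1 - 2 alpha) |eta| + |eta|^(1 - 2 alpha) |xi|, the nonlinearity is bounded
   in X^(1 - 2 alpha) by C ||theta||_(X^(1 - 2 alpha)) ||theta||_(X^1).  Duhamel's
   formula then bounds the distance in X^(1 - 2 alpha) from theta(t) to the linear
   evolution of theta(s) by C sup ||theta||_(X^(1 - 2 alpha)) times the integral of
   ||theta||_(X^1) over [s, t].  As the tails of this integral are small, theta is
   bounded in X^(1 - 2 alpha) and has a limit at T; extended by this limit it
   solves the integral equation on [0, T], against maximality.

   The equation is only known against Schwartz functions, whereas a weighted L^1
   norm is attained against bounded multiples of the weight.  The products of a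
   Gaussian with logistic functions of the coordinates are Schwartz functions, and
   a monotone class argument extends linear identities from them to all measurable
   functions dominated by the weight. *)

From HB Require Import structures.
From mathcomp Require Import all_boot all_order all_algebra.
From mathcomp Require Import complex.
From mathcomp Require Import all_classical all_reals all_analysis.
From mathcomp Require Import measurable_realfun ring lra.
Require Import Defs.

Set Implicit Arguments.
Unset Strict Implicit.
Unset Printing Implicit Defensive.

Import Order.TTheory GRing.Theory Num.Theory.
Import numFieldNormedType.Exports.

Local Open Scope classical_set_scope.
Local Open Scope ring_scope.

(** Transforms are chosen separately at each time, so nothing is known about the joint measurability
    of the nonlinearity in time and frequency, and Fubini's theorem cannot be applied to Duhamel's
    integral. The estimates therefore fix one function of frequency, the weight times the sign of
    the quantity to be bounded, pair the equation with it, and integrate only the resulting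
    functions of time. Measurability in time of these pairings is given for Schwartz functions
    alone; the monotone class argument has to carry it to the limit together with the identity. In
    the same way the convolution behind the nonlinearity is never formed as a function: its
    transform is compared with a density on pairs of frequencies, pushed forward by addition.

    The choice of test functions keeps calculus elementary: the logistic function [l] satisfies
    [l' = l (1 - l)], so all derivatives are explicit and no compactly supported smooth function has
    to be constructed. *)

Notation rintegrable mu D f := (integrable mu D (fun x => (f x)%:E)).

(** * Integrals of real functions *)

Section real_integrals.
Context d (T : measurableType d) (R : realType).
Variable mu : {measure set T -> \bar R}.
Implicit Types (D : set T) (f g : T -> R).

Lemma rintegrable_measurable D f : rintegrable mu D f -> measurable_fun D f.
Proof. by move=> /measurable_int/measurable_EFinP. Qed.

Lemma rintegrable_dominated D f g : measurable D -> measurable_fun D f ->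
  (forall x, D x -> `|f x| <= g x) -> rintegrable mu D g -> rintegrable mu D f.
Proof.
move=> mD mf fg; apply: le_integrable => //; first exact/measurable_EFinP.
by move=> x Dx; rewrite /= lee_fin (le_trans (fg x Dx))// ler_norm.
Qed.

Lemma rintegrable_norm D f : measurable D -> rintegrable mu D f ->
  rintegrable mu D (fun x => `|f x|).
Proof.
move=> mD fi; apply: (le_integrable mD _ _ fi).
  by apply/measurable_EFinP/measurableT_comp => //; exact: rintegrable_measurable fi.
by move=> x _; rewrite /= normr_id.
Qed.

Lemma rintegrableD D f g : measurable D -> rintegrable mu D f ->
  rintegrable mu D g -> rintegrable mu D (fun x => f x + g x).
Proof. by move=> mD fi gi; exact: (integrableD mD fi gi). Qed.

Lemma rintegrableB D f g : measurable D -> rintegrable mu D f ->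
  rintegrable mu D g -> rintegrable mu D (fun x => f x - g x).
Proof. by move=> mD fi gi; exact: (integrableB mD fi gi). Qed.

Lemma rintegrableZl D (c : R) f : measurable D -> rintegrable mu D f ->
  rintegrable mu D (fun x => c * f x).
Proof. by move=> mD fi; exact: (integrableZl mD c fi). Qed.

Lemma rintegrableZr D (c : R) f : measurable D -> rintegrable mu D f ->
  rintegrable mu D (fun x => f x * c).
Proof. by move=> mD fi; exact: (integrableZr mD c fi). Qed.

Lemma rintegrable_ae_eq D f g : measurable D -> measurable_fun D g ->
  {ae mu, forall x, D x -> f x = g x} -> rintegrable mu D f ->
  rintegrable mu D g.
Proof.
move=> mD mg fg /[dup] /rintegrable_measurable mf /integrableP[_ fi].
apply/integrableP; split; first exact/measurable_EFinP.
rewrite (_ : (\int[mu]_(x in D) _ = \int[mu]_(x in D) `|(f x)%:E|)%E)//.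
apply: ae_eq_integral => //.
- by apply: measurableT_comp => //; exact/measurable_EFinP.
- by apply: measurableT_comp => //; exact/measurable_EFinP.
- by apply: filterS fg => x /= H Dx; rewrite H.
Qed.

Lemma Rintegral_ae_eq D f g : measurable D -> measurable_fun D f ->
  measurable_fun D g -> {ae mu, forall x, D x -> f x = g x} ->
  Rintegral mu D f = Rintegral mu D g.
Proof.
move=> mD mf mg fg; congr fine; apply: ae_eq_integral => //.
- exact/measurable_EFinP.
- exact/measurable_EFinP.
- by apply: filterS fg => x /= H Dx; rewrite H.
Qed.

Lemma Rintegral_EFin D f : measurable D -> rintegrable mu D f ->
  (Rintegral mu D f)%:E = (\int[mu]_(x in D) (f x)%:E)%E.
Proof. by move=> mD fi; rewrite fineK//; exact: integrable_fin_num. Qed.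

Lemma Rintegral_dominated D (f_ : nat -> T -> R) f g : measurable D ->
  (forall n, measurable_fun D (f_ n)) -> measurable_fun D f ->
  {ae mu, forall x, D x -> f_ ^~ x @ \oo --> f x} ->
  rintegrable mu D g -> {ae mu, forall x, D x -> forall n, `|f_ n x| <= g x} ->
  [/\ rintegrable mu D f,
      Rintegral mu D (fun x => `|f_ n x - f x|) @[n --> \oo] --> (0 : R) &
      Rintegral mu D (f_ n) @[n --> \oo] --> Rintegral mu D f].
Proof.
move=> mD mfn mf cvf gi fg.
have [|||||fi h0 h1] := @dominated_convergence _ _ _ mu D mD
    (fun n x => (f_ n x)%:E) (EFin \o f) (EFin \o g).
- by move=> n; exact/measurable_EFinP.
- exact/measurable_EFinP.
- by apply: filterS cvf => x H Dx; apply: cvg_EFin (H Dx); near=> n.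
- exact: gi.
- by apply: filterS fg => x H n Dx; rewrite /= lee_fin; exact: H.
- split => //.
  + by apply: fine_cvg; exact: h0.
  + by apply: fine_cvg; rewrite Rintegral_EFin//; exact: h1.
Unshelve. all: by end_near. Qed.

Lemma le_norm_Rintegral D f g : measurable D -> measurable_fun D f ->
  rintegrable mu D g -> (forall x, D x -> `|f x| <= g x) ->
  `|Rintegral mu D f| <= Rintegral mu D g.
Proof.
move=> mD mf gi fg; have fi := rintegrable_dominated mD mf fg gi.
apply: (le_trans (le_normr_Rintegral mD fi)).
by apply: le_Rintegral => //; exact: rintegrable_norm.
Qed.

End real_integrals.

Section real_fubini.
Context d1 d2 (T1 : measurableType d1) (T2 : measurableType d2) (R : realType).
Variables (m1 : {sigma_finite_measure set T1 -> \bar R})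
          (m2 : {sigma_finite_measure set T2 -> \bar R}).

Lemma Rintegral_fubini_l (f : T1 * T2 -> R) :
  rintegrable (m1 \x m2)%E setT f ->
  rintegrable m1 setT (fun x => Rintegral m2 setT (fun y => f (x, y))) /\
  Rintegral m1 setT (fun x => Rintegral m2 setT (fun y => f (x, y))) =
  Rintegral (m1 \x m2)%E setT f.
Proof.
move=> fi; have mF := measurable_fubini_F fi.
have iF := integrable_fubini_F fi.
have fin : {ae m1, forall x, setT x ->
    fubini_F m2 (EFin \o f) x =
    (Rintegral m2 setT (fun y => f (x, y)))%:E}.
  apply: filterS (integrable_ae measurableT iF) => x /= H _.
  by rewrite fineK//; exact: H.
have mR : measurable_fun setT
    (fun x => (Rintegral m2 setT (fun y => f (x, y)))%:E).
  by apply/measurable_EFinP/measurableT_comp => //; exact: mF.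
split.
  move/integrableP : iF => [_ iF]; apply/integrableP; split => //.
  rewrite (_ : (\int[m1]_x _ = \int[m1]_x `|fubini_F m2 (EFin \o f) x|)%E)//.
  apply: ae_eq_integral => //.
  - exact: measurableT_comp.
  - exact: measurableT_comp.
  - by apply: filterS fin => x /= H Dx; rewrite H.
rewrite /Rintegral -(integral12_prod_meas1 fi); congr fine.
apply: ae_eq_integral => //; apply: filterS fin => x /= H Dx; rewrite H//.
Qed.

Lemma Rintegral_fubini_r (f : T1 * T2 -> R) :
  rintegrable (m1 \x m2)%E setT f ->
  rintegrable m2 setT (fun y => Rintegral m1 setT (fun x => f (x, y))) /\
  Rintegral m2 setT (fun y => Rintegral m1 setT (fun x => f (x, y))) =
  Rintegral (m1 \x m2)%E setT f.
Proof.
move=> fi; have mF := measurable_fubini_G fi.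
have iF : m2.-integrable setT (fubini_G m1 (EFin \o f)).
  apply/integrableP; split => //.
  have /integrableP[mf _] := fi.
  have H := (integrable21ltyP m1 m2 mf).1 fi.
  apply: le_lt_trans H; apply: ge0_le_integral => //.
  - exact: measurableT_comp.
  - apply: (measurable_fun_fubini_tonelli_G (fun z => `|(f z)%:E|%E)) => //.
    exact: measurableT_comp.
  - move=> y _; apply: le_abse_integral => //.
    exact: measurableT_comp.
have fin : {ae m2, forall x, setT x ->
    fubini_G m1 (EFin \o f) x =
    (Rintegral m1 setT (fun y => f (y, x)))%:E}.
  apply: filterS (integrable_ae measurableT iF) => x /= H _.
  by rewrite fineK//; exact: H.
have mR : measurable_fun setT
    (fun x => (Rintegral m1 setT (fun y => f (y, x)))%:E).
  by apply/measurable_EFinP/measurableT_comp => //; exact: mF.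
split.
  move/integrableP : iF => [_ iF]; apply/integrableP; split => //.
  rewrite (_ : (\int[m2]_x _ = \int[m2]_x `|fubini_G m1 (EFin \o f) x|)%E)//.
  apply: ae_eq_integral => //.
  - exact: measurableT_comp.
  - exact: measurableT_comp.
  - by apply: filterS fin => x /= H Dx; rewrite H.
rewrite /Rintegral -(integral21_prod_meas1 fi); congr fine.
apply: ae_eq_integral => //; apply: filterS fin => x /= H Dx; rewrite H//.
Qed.

Lemma rintegrable_prodM (f : T1 -> R) (g : T2 -> R) :
  rintegrable m1 setT f -> rintegrable m2 setT g ->
  rintegrable (m1 \x m2)%E setT (fun z => f z.1 * g z.2).
Proof.
move=> fi gi.
have mf := rintegrable_measurable fi; have mg := rintegrable_measurable gi.
have m : measurable_fun setT (fun z : T1 * T2 => f z.1 * g z.2).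
  by apply: measurable_funM; exact: measurableT_comp.
apply/(integrable12ltyP m1 m2); first exact/measurable_EFinP.
have /integrableP[_ fi'] := fi; have /integrableP[_ gi'] := gi.
under eq_integral => x _.
  under eq_integral => y _ do rewrite /= normrM EFinM.
  rewrite ge0_integralZl//; last first.
    by apply/measurable_EFinP; exact: measurableT_comp.
  over.
rewrite /= ge0_integralZr//.
- rewrite /abse/= in fi' gi'; apply: lte_mul_pinfty => //.
  + exact: integral_ge0.
  + by rewrite ge0_fin_numE// integral_ge0.
- by apply/measurable_EFinP; exact: measurableT_comp.
- exact: integral_ge0.
Qed.

End real_fubini.

Section product_sigma_finite.
Context d1 d2 (T1 : measurableType d1) (T2 : measurableType d2) (R : realType).
Variables (m1 : {sigma_finite_measure set T1 -> \bar R})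
          (m2 : {sigma_finite_measure set T2 -> \bar R}).

Let product_sigma_finite : sigma_finite setT (m1 \x m2)%E.
Proof.
have [F1 F1T F1m] := sigma_finiteT m1; have [F2 F2T F2m] := sigma_finiteT m2.
pose G k := if @unpickle (nat * nat)%type k is Some p
  then F1 p.1 `*` F2 p.2 else set0.
exists G.
  apply/seteqP; split => // -[x y] _.
  have : (\bigcup_i F1 i) x by rewrite -F1T.
  have : (\bigcup_i F2 i) y by rewrite -F2T.
  move=> [j _ Fj] [i _ Fi]; exists (pickle (i, j)) => //.
  by rewrite /G pickleK.
move=> k; rewrite /G; case: unpickle => [[i j]|] /=; last by split=> //; rewrite measure0.
have [? ?] := F1m i; have [? ?] := F2m j.
split; first exact: measurableX.
rewrite product_measure1E//; apply: lte_mul_pinfty => //.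
by rewrite ge0_fin_numE.
Qed.

(** The plane measure must be sigma-finite in its own right for Fubini's theorem on pairs of
    frequencies, that is on the product of two planes. *)
Definition sigma_finite_prod :
  {sigma_finite_measure set (T1 * T2)%type -> \bar R} :=
  HB.pack (m1 \x m2)%E
    (Measure_isSigmaFinite.Build _ _ _ (m1 \x m2)%E product_sigma_finite).

End product_sigma_finite.

Notation plane_measure R :=
  (@lebesgue_measure R \x @lebesgue_measure R)%E.

Definition plane_sf (R : realType) :=
  sigma_finite_prod (@lebesgue_measure R) (@lebesgue_measure R).

Notation planes_measure R := (plane_sf R \x plane_sf R)%E.

(** * Test functions and duality in the plane *)

Section plane_measurability.
Context {R : realType}.
Implicit Types (f : R * R -> R).

(** The measurable sets of [R * R] form the product sigma-algebra, so the point is second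
    countability: an open set is the union of the countably many squares with rational centre and
    radius [1 / (n + 1)] that it contains. *)
Lemma open_measurable_plane (U : set (R * R)) : open U -> measurable U.
Proof.
move=> oU.
pose B (k : nat) : set (R * R) := if @unpickle (rat * rat * nat)%type k is
  Some (p, q, n) then ball (ratr p : R) n.+1%:R^-1 `*` ball (ratr q : R) n.+1%:R^-1
  else set0.
have mB k : measurable (B k).
  rewrite /B; case: unpickle => [[[p q] n]|] //.
  by apply: measurableX; exact: measurable_ball.
suff -> : U = \bigcup_(k in [set k | B k `<=` U]) B k.
  by apply: bigcup_measurable => k _; exact: mB.
apply/seteqP; split; last by move=> z [k /= kU]; exact: kU.
move=> [x y] Uxy.
have /nbhs_ballP[e /= e0 eU] : nbhs (x, y) U by exact: open_nbhs_nbhs.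
(* A square of radius [1 / (n + 1)] about a rational point this close to [(x, y)] reaches at most
   [2 / (n + 1) < e] away from [(x, y)]. *)
pose n := Num.truncn (2 / e).
have ne : 2 / n.+1%:R < e.
  rewrite ltr_pdivrMr// mulrC -ltr_pdivrMr//.
  exact: truncnS_gt.
have n0 : 0 < n.+1%:R^-1 :> R by rewrite invr_gt0.
have rat_near (z : R) : exists r : rat, `|z - ratr r| < n.+1%:R^-1.
  have [|r] := @rat_in_itvoo R (z - n.+1%:R^-1) (z + n.+1%:R^-1).
    by rewrite ltrD2l gtrN.
  rewrite in_itv/= => /andP[h1 h2]; exists r.
  by rewrite ltr_norml; apply/andP; split; move: (_^-1) h1 h2 => i; lra.
have [p xp] := rat_near x; have [q yq] := rat_near y.
exists (pickle (p, q, n)).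
  rewrite /= /B pickleK => -[u v] [/= ].
  rewrite /ball/= => pu qv; apply: eU; split; rewrite /ball/=.
    rewrite (_ : x - u = (x - ratr p) + (ratr p - u)); last by ring.
    rewrite (le_lt_trans (ler_normD _ _))//.
    by move: (_^-1) ne xp pu => i; lra.
  rewrite (_ : y - v = (y - ratr q) + (ratr q - v)); last by ring.
  rewrite (le_lt_trans (ler_normD _ _))//.
  by move: (_^-1) ne yq qv => i; lra.
by rewrite /B pickleK; split; rewrite /ball/= distrC.
Qed.

Lemma continuous_measurable_plane f : continuous f -> measurable_fun setT f.
Proof.
move=> /continuousP cf; apply: (measurability _ (RGenOpens.measurableE R)).
move=> _ [_ [a [b ->] <-]]; apply: measurableI => //.
by apply: open_measurable_plane; apply: cf; exact: interval_open.
Qed.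

Definition gaussian (c : R) (x : R * R) : R := expR (- (c * (x.1 ^+ 2 + x.2 ^+ 2))).

(** It serves twice: rescaled logistic functions approximate indicators of half-lines, and
    derivatives of a logistic function are polynomials in it, which makes its products with a
    Gaussian Schwartz functions. *)
Definition logistic (t : R) : R := (1 + expR (- t))^-1.

Definition test_function (p q p' q' : R) (x : R * R) : R :=
  gaussian 1 x * (logistic (p * x.1 + q) * logistic (p' * x.2 + q')).

Lemma gaussian_gt0 c x : 0 < gaussian c x. Proof. exact: expR_gt0. Qed.

Lemma logistic_ge0 t : 0 <= logistic t.
Proof. by rewrite invr_ge0 addr_ge0// expR_ge0. Qed.

Lemma logistic_le1 t : logistic t <= 1.
Proof. by rewrite invf_le1 ?ltr_pwDl ?expR_ge0// lerDl expR_ge0. Qed.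

Lemma gaussian_measurable c : measurable_fun setT (gaussian c).
Proof.
apply: measurableT_comp => //; apply: measurableT_comp => //.
apply: measurable_funM => //; apply: measurable_funD.
  by apply: measurable_funX; exact: measurable_fst.
by apply: measurable_funX; exact: measurable_snd.
Qed.

Lemma logistic_measurable : measurable_fun setT logistic.
Proof.
apply: continuous_measurable_fun => t; apply: cvgV.
  by rewrite gt_eqF// ltr_pwDl// expR_ge0.
apply: cvgD; first exact: cvg_cst.
by apply: (cvg_comp (fun x => - x) expR (cvgN cvg_id)); exact: continuous_expR.
Qed.

Lemma test_function_measurable p q p' q' :
  measurable_fun setT (test_function p q p' q').
Proof.
apply: measurable_funM; first exact: gaussian_measurable.
apply: measurable_funM; apply: (measurableT_comp logistic_measurable);
  (apply: measurable_funD => //; apply: measurable_funM => //).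
Qed.

Lemma test_function_ge0 p q p' q' x : 0 <= test_function p q p' q' x.
Proof. by rewrite !mulr_ge0 ?logistic_ge0// ltW// gaussian_gt0. Qed.

Lemma test_function_le p q p' q' x : test_function p q p' q' x <= gaussian 1 x.
Proof.
rewrite ler_piMr ?(ltW (gaussian_gt0 _ _))// mulr_ile1 ?logistic_ge0//;
exact: logistic_le1.
Qed.

(* The logistic functions t |-> logistic (n^2 (t - a) - n) approximate the
   indicator of the open half-line at every point, including at t = a. *)
Lemma cvg_logistic_ray (a t : R) :
  logistic (n%:R ^+ 2 * t + (- (n%:R ^+ 2 * a) - n%:R)) @[n --> \oo] -->
  (\1_(`]a, +oo[%classic : set R) t : R).
Proof.
have logistic_pinfty : logistic x @[x --> +oo] --> (1 : R).
  rewrite -[X in _ --> X]invr1; apply: cvgV; first exact: oner_neq0.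
  rewrite -[X in _ --> X]addr0; apply: cvgD; first exact: cvg_cst.
  exact: cvgr_expR.
have natS (x : R) : x < (Num.truncn x).+1%:R by exact: truncnS_gt.
have [ta|ta] := ltP a t.
  rewrite indicE mem_set/= ?in_itv/= ?ta//.
  apply: (@cvg_comp _ _ _ _ logistic _ +oo) => //.
  apply/cvgryPge => A; near=> n.
  (* Then [n (t - a) - 1 >= 1], and the argument [n (n (t - a) - 1)] is at least [n]. *)
  have n2 : 2 / (t - a) <= n%:R.
    rewrite (le_trans (ltW (natS _)))// ler_nat; near: n.
    exact: nbhs_infty_ge.
  have nA : A <= n%:R.
    rewrite (le_trans (ltW (natS _)))// ler_nat; near: n.
    exact: nbhs_infty_ge.
  have n0 : 0 <= n%:R :> R by [].
  rewrite ler_pdivrMr ?subr_gt0// in n2.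
  rewrite (_ : _ + _ = n%:R * (n%:R * (t - a) - 1)); last by ring.
  rewrite (le_trans nA)// ler_peMr//; lra.
rewrite indicE memNset/= ?in_itv/= ?andbT; last by apply/negP; rewrite -leNgt.
rewrite (_ : (fun n : nat => _) = (fun n : nat =>
  1 - logistic (n%:R ^+ 2 * (a - t) + n%:R))); last first.
  apply/funext => n; rewrite /logistic.
  set u := n%:R ^+ 2 * (a - t) + _; rewrite (_ : _ + (_ - _) = - u); last by rewrite /u; ring.
  rewrite opprK expRN; have := expR_gt0 u => u0; field.
  by rewrite !gt_eqF// ?addr_gt0.
rewrite -[X in _ --> X](subrr 1); apply: cvgB; first exact: cvg_cst.
apply: (@cvg_comp _ _ _ _ logistic _ +oo) => //.
apply/cvgryPge => A; near=> n.
have nA : A <= n%:R.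
  rewrite (le_trans (ltW (natS _)))// ler_nat; near: n.
  exact: nbhs_infty_ge.
by rewrite (le_trans nA)// lerDr mulr_ge0// ?sqr_ge0// subr_ge0.
Unshelve. all: by end_near. Qed.

Lemma cvg_test_function (a b : R) (x : R * R) :
  test_function (n%:R ^+ 2) (- (n%:R ^+ 2 * a) - n%:R)
                (n%:R ^+ 2) (- (n%:R ^+ 2 * b) - n%:R) x @[n --> \oo] -->
  gaussian 1 x * (\1_(`]a, +oo[%classic : set R) x.1 *
                  \1_(`]b, +oo[%classic : set R) x.2).
Proof.
apply: cvgM; first exact: cvg_cst.
by apply: cvgM; exact: cvg_logistic_ray.
Qed.

End plane_measurability.

Lemma indic_setU_disjoint (T : Type) (R : pzRingType) (A B : set T) (x : T) :
  A `&` B = set0 -> \1_(A `|` B) x = \1_A x + \1_B x :> R.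
Proof.
move=> AB0; rewrite !indicE in_setU.
have [xA|xA] := boolP (x \in A); have [xB|xB] := boolP (x \in B) => //=;
  rewrite ?addr0 ?add0r//.
by exfalso; have : (A `&` B) x; [split; exact: set_mem|rewrite AB0].
Qed.

(** * A monotone class theorem on the plane *)

Section monotone_class.
Import HBNNSimple.
Context {R : realType}.
Variables (w : R * R -> R) (H : set (R * R -> R)) (K0 : R).
Hypothesis gaussian_le : forall x, gaussian 1 x <= K0 * w x.
Hypothesis Htest : forall p q p' q', H (test_function p q p' q').
Hypothesis Hlin : forall (c : R) f g, H f -> H g -> H (fun x => c * f x + g x).
Hypothesis Hlim : forall (f_ : nat -> R * R -> R) (f : R * R -> R) (K : R),
  (forall n, H (f_ n)) -> (forall n x, `|f_ n x| <= K * w x) ->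
  (forall x, f_ n x @[n --> \oo] --> f x) -> H f.

Let G := @gaussian R 1.

Let H0 : H (fun=> 0).
Proof.
have h := Htest 0 0 0 0; have := Hlin (-1) h h.
by congr H; apply/funext => x; ring.
Qed.

Let HD f g : H f -> H g -> H (fun x => f x + g x).
Proof.
by move=> hf hg; have := Hlin 1 hf hg; congr H; apply/funext => x; rewrite mul1r.
Qed.

Let HZ (c : R) f : H f -> H (fun x => c * f x).
Proof.
by move=> hf; have := Hlin c hf H0; congr H; apply/funext => x; rewrite addr0.
Qed.

Let HB f g : H f -> H g -> H (fun x => f x - g x).
Proof.
move=> hf hg; have := HD hf (HZ (-1) hg).
by congr H; apply/funext => x; rewrite mulN1r.
Qed.

(** The Dynkin induction is run three times: on the first coordinate with a ray in the second, on
    the second coordinate with a Borel set in the first, and on the plane itself with [pr = id]. The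
    Gaussian factor keeps every indicator below a multiple of [w], as [Hlim] requires. *)
Let indicator_class d (T : measurableType d) (Gen : set (set T))
    (pr : R * R -> T) (h : R * R -> R) (P := fun A : set T =>
      H (fun x => G x * (\1_A (pr x) * h x))) :
  measurable = <<s Gen >> -> setI_closed Gen -> (forall x, 0 <= h x <= 1) ->
  P setT -> (forall A, Gen A -> P A) -> forall A, measurable A -> P A.
Proof.
move=> mE GI h01 PT PG A; rewrite mE; apply: (dynkin_induction mE) => //.
  move=> S mS PS; have := HB PT PS; congr H; apply/funext => x.
  rewrite !indicE in_setC in_setT; case: (_ \in _) => /=; ring.
move=> F mF tF PF.
pose U n := \big[setU/set0]_(k < n) F k.
apply: (Hlim (f_ := fun n x => G x * (\1_(U n) (pr x) * h x)) (K := K0)).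
- elim=> [|n IH].
    have := H0; congr H; apply/funext => x.
    by rewrite /U big_ord0 indic0 /cst/= mul0r mulr0.
  have := HD IH (PF n); congr H; apply/funext => x.
  rewrite /U big_ord_recr/= indic_setU_disjoint ?mulrDl ?mulrDr//.
  apply/seteqP; split => // y [].
  rewrite -bigcup_mkord => -[k /= kn Fk] Fn.
  by move: (tF k n Logic.I Logic.I) kn => ->; [rewrite ltnn|exists y].
- move=> n x; apply: le_trans (gaussian_le x).
  have /andP[hx0 hx1] := h01 x.
  rewrite ger0_norm ?mulr_ge0// ?(ltW (gaussian_gt0 _ _))// ler_piMr//.
    exact: ltW (gaussian_gt0 _ _).
  by rewrite mulr_ile1// indicE lern1 leq_b1.
- move=> x; apply: cvgM; first exact: cvg_cst.
  apply: cvgM; last exact: cvg_cst.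
  rewrite indicE; case: (boolP (pr x \in _)) => [/set_mem[k _ Fk]|/negP xF].
    apply: cvg_near_cst; near=> n; rewrite indicE mem_set//.
    rewrite /U -bigcup_mkord; exists k => //=; near: n; exact: nbhs_infty_gt.
  apply: cvg_near_cst; near=> n; rewrite indicE memNset//.
  rewrite /U -bigcup_mkord => -[k _ Fk].
  by apply: xF; apply/mem_set; exists k.
Unshelve. all: by end_near. Qed.

Let norm_gaussian_indic (u v : R) x : 0 <= u <= 1 -> 0 <= v <= 1 ->
  `|G x * (u * v)| <= K0 * w x.
Proof.
move=> /andP[u0 u1] /andP[v0 v1]; apply: le_trans (gaussian_le x).
have g0 := gaussian_gt0 1 x.
rewrite ger0_norm ?mulr_ge0// ?(ltW g0)// ler_piMr// ?(ltW g0)//.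
by rewrite mulr_ile1.
Qed.

Let indic01 (T : Type) (A : set T) (x : T) : 0 <= (\1_A x : R) <= 1.
Proof. by rewrite indicE; case: (_ \in _) => /=; rewrite !lexx !ler01. Qed.

Let rays_cover (t : R) :
  (\1_(`]- n%:R, +oo[%classic : set R) t : R) @[n --> \oo] --> (1 : R).
Proof.
apply: cvg_near_cst; near=> n; rewrite indicE mem_set//= in_itv/= andbT.
rewrite ltrNl; apply: lt_le_trans (truncnS_gt (- t)) _; rewrite ler_nat.
by near: n; exact: nbhs_infty_ge.
Unshelve. all: by end_near. Qed.

Let rays_setI : setI_closed (@RGenOInfty.G R).
Proof.
move=> _ _ [x ->] [y ->]; exists (Num.max x y).
apply/seteqP; split => t /=; rewrite !in_itv/= !andbT gt_max.
  by case=> -> ->.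
by move=> /andP[].
Qed.

Let H_rectangle (A B : set R) : measurable A -> measurable B ->
  H (fun x => G x * (\1_A x.1 * \1_B x.2)).
Proof.
have rr a b : H (fun x => G x * (\1_(`]a, +oo[%classic : set R) x.1 *
                                \1_(`]b, +oo[%classic : set R) x.2)).
  apply: (Hlim (K := K0) (f_ := fun n => test_function (n%:R ^+ 2)
    (- (n%:R ^+ 2 * a) - n%:R) (n%:R ^+ 2) (- (n%:R ^+ 2 * b) - n%:R))) => //;
    last by move=> x; exact: cvg_test_function.
  move=> n x.
  rewrite ger0_norm ?test_function_ge0//.
  exact: le_trans (test_function_le _ _ _ _ _) (gaussian_le x).
have Ar (A' : set R) b : measurable A' ->
    H (fun x => G x * (\1_A' x.1 * \1_(`]b, +oo[%classic : set R) x.2)).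
  move: A'; apply: (@indicator_class _ _ _ fst) (@RGenOInfty.measurableE R) _ _ _ _.
  - exact: rays_setI.
  - by move=> x; exact: indic01.
  (* The whole line is not a ray; its indicator is the limit of those of []- n, +oo[]. *)
  - apply: (Hlim (K := K0) (f_ := fun n x =>
      G x * (\1_(`]- n%:R, +oo[%classic : set R) x.1 *
             \1_(`]b, +oo[%classic : set R) x.2))) => [n|n x|x].
    + exact: rr.
    + exact: norm_gaussian_indic.
    + apply: cvgM; first exact: cvg_cst.
      by apply: cvgM; [rewrite indicT; exact: rays_cover|exact: cvg_cst].
  - by move=> _ [a ->]; exact: rr.
move=> mA mB.
suff : H (fun x => G x * (\1_B x.2 * \1_A x.1)).
  by congr H; apply/funext => x; rewrite [\1_A _ * _]mulrC.
move: B mB; apply: (@indicator_class _ _ _ snd) (@RGenOInfty.measurableE R) _ _ _ _.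
- exact: rays_setI.
- by move=> x; exact: indic01.
- apply: (Hlim (K := K0) (f_ := fun n x =>
    G x * (\1_A x.1 * \1_(`]- n%:R, +oo[%classic : set R) x.2))).
  + by move=> n; exact: Ar.
  + by move=> n x; exact: norm_gaussian_indic.
  + move=> x; apply: cvgM; first exact: cvg_cst.
    rewrite mulrC; apply: cvgM; first exact: cvg_cst.
    by rewrite indicT; exact: rays_cover.
- move=> _ [a ->]; have := Ar _ a mA.
  by congr H; apply/funext => x; rewrite [\1_A _ * _]mulrC.
Qed.

Let H_indic (A : set (R * R)) : measurable A -> H (fun x => G x * \1_A x).
Proof.
move=> mA.
suff : H (fun x => G x * (\1_A (id x) * 1)).
  by congr H; apply/funext => x; rewrite mulr1.
move: A mA; apply: (@indicator_class _ _ _ id (fun=> 1)).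
- exact: measurable_prod_measurableType.
- move=> _ _ [A mA [B mB <-]] [A' mA' [B' mB' <-]]; rewrite -setXI.
  by exists (A `&` A'); [exact: measurableI|];
    exists (B `&` B') => //; exact: measurableI.
- by move=> x; rewrite ler01 lexx.
- have := H_rectangle measurableT measurableT.
  by congr H; apply/funext => x; rewrite !indicT /cst mulr1.
- move=> _ [A mA [B mB <-]]; have := H_rectangle mA mB.
  congr H; apply/funext => x; rewrite !indicE in_setX mulr1.
  by case: (x.1 \in A); case: (x.2 \in B); rewrite /= ?mulr1 ?mulr0.
Qed.

Let H_simple (s : {nnsfun (R * R) >-> R}) : H (fun x => G x * s x).
Proof.
have Hsum (l : seq R) : H (fun x => G x *
    (\sum_(y <- l) y * \1_(s @^-1` [set y]) x)).
  elim: l => [|y l IH].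
    by have := H0; congr H; apply/funext => x; rewrite big_nil mulr0.
  have := HD (HZ y (H_indic (measurable_sfunP s (measurable_set1 y)))) IH.
  by congr H; apply/funext => x; rewrite big_cons mulrDr; congr (_ + _); ring.
under eq_fun do rewrite fimfunE fsbig_finite//.
exact: Hsum.
Qed.

Let H_nonneg (f : R * R -> R) : measurable_fun setT f -> (forall x, 0 <= f x) ->
  (exists K, forall x, f x <= K * w x) -> H f.
Proof.
move=> mf f0 [K fK].
(* [f] divided by the Gaussian: simple functions increasing to this quotient, multiplied back by the
   Gaussian, increase to [f] and stay below [K * w]. *)
pose F x := (f x * expR (1 * (x.1 ^+ 2 + x.2 ^+ 2)))%:E.
have GF x : G x * (f x * expR (1 * (x.1 ^+ 2 + x.2 ^+ 2))) = f x.
  by rewrite mulrCA /G /gaussian expRN mulVf ?mulr1// gt_eqF// expR_gt0.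
have mF : measurable_fun setT F.
  apply/measurable_EFinP; apply: measurable_funM => //.
  rewrite (_ : (fun x => _) = gaussian (- 1)); first exact: gaussian_measurable.
  by apply/funext => x; rewrite /gaussian; congr expR; ring.
have F0 x : setT x -> (0 <= F x)%E.
  by move=> _; rewrite lee_fin mulr_ge0// expR_ge0.
have cF x := cvg_nnsfun_approx measurableT mF F0 (Logic.I : setT x).
have nF n x : nnsfun_approx measurableT mF n x <=
    f x * expR (1 * (x.1 ^+ 2 + x.2 ^+ 2)).
  by rewrite -lee_fin nnsfun_approxE; exact: le_approx.
apply: (Hlim (f_ := fun n x => G x * nnsfun_approx measurableT mF n x) (K := K)).
- by move=> n; exact: H_simple.
- move=> n x; rewrite ger0_norm; last by rewrite mulr_ge0// ltW// gaussian_gt0.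
  apply: le_trans (fK x); rewrite -[leRHS]GF ler_pM2l//.
  exact: gaussian_gt0.
- move=> x; rewrite -[f x]GF; apply: cvgM; first exact: cvg_cst.
  by have /fine_cvgP[] := cF x.
Qed.

(** The class grows from products of half-lines to rectangles, Borel sets, simple functions and
    nonnegative functions, all but the last multiplied by the Gaussian. Only pointwise limits
    dominated by a multiple of [w] are taken, so [H] may be a class defined by integrals against
    functions whose product with [w] is integrable. *)
Lemma plane_monotone_class (f : R * R -> R) : measurable_fun setT f ->
  (exists K, forall x, `|f x| <= K * w x) -> H f.
Proof.
move=> mf [K fK].
have -> : f = fun x => f^\+ x - f^\- x.
  by apply/funext => x; have := funrposBneg f => /(congr1 (fun g => g x)).
apply: HB; apply: H_nonneg.
- exact: measurable_funrpos.
- by move=> x; exact: funrpos_ge0.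
- exists K => x; apply: le_trans (fK x).
  by rewrite /funrpos ge_max ler_norm normr_ge0.
- exact: measurable_funrneg.
- by move=> x; exact: funrneg_ge0.
- exists K => x; apply: le_trans (fK x).
  by rewrite /funrneg ge_max normr_ge0 -normrN ler_norm.
Qed.

End monotone_class.

Lemma cvg_norm_le (R : realType) (u : nat -> R) (l K : R) :
  u n @[n --> \oo] --> l -> (forall n, `|u n| <= K) -> `|l| <= K.
Proof.
move=> ul uK; have nl : `|u n| @[n --> \oo] --> `|l| by exact: cvg_norm.
rewrite -(cvg_lim (@Rhausdorff R) nl); apply: limr_le; first exact: cvgP nl.
exact: nearW.
Qed.

Section duality.
Context {R : realType}.
Local Notation mu2 := (plane_measure R).

Lemma measurable_sign d (T : measurableType d) (g h : T -> R) :
  measurable_fun setT g -> measurable_fun setT h ->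
  measurable_fun setT (fun x => if 0 <= g x then h x else - h x).
Proof.
move=> mg mh; apply: measurable_fun_ifT => //.
- exact: measurable_fun_ler.
- exact: measurableT_comp.
Qed.

(* With [kappa = 0] this says that a function which annihilates the test
   functions vanishes almost everywhere. *)
Lemma duality_bound d (Z : measurableType d) (nu : {measure set Z -> \bar R})
    (pr : Z -> R * R) (kappa : Z -> R) (g w : R * R -> R) :
  measurable_fun setT pr -> measurable_fun setT kappa ->
  measurable_fun setT g -> measurable_fun setT w -> (forall x, 0 <= w x) ->
  rintegrable mu2 setT (fun x => g x * gaussian 1 x) ->
  rintegrable nu setT (fun z => kappa z * gaussian 1 (pr z)) ->
  (forall p q p' q', Rintegral mu2 setT (fun x => g x * test_function p q p' q' x) =
    Rintegral nu setT (fun z => kappa z * test_function p q p' q' (pr z))) ->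
  (\int[mu2]_x (`|g x| * w x)%:E <= \int[nu]_z (`|kappa z| * w (pr z))%:E)%E.
Proof.
move=> mpr mk mg mw w0 gi ki test.
have dom (f : R * R -> R) K : measurable_fun setT f ->
    (forall x, `|f x| <= K * gaussian 1 x) ->
    rintegrable mu2 setT (fun x => g x * f x) /\
    rintegrable nu setT (fun z => kappa z * f (pr z)).
  move=> mf fK; split.
    apply: (rintegrable_dominated _ _ _ (rintegrableZl K measurableT
      (rintegrable_norm measurableT gi))) => //.
      exact: measurable_funM.
    move=> x _; rewrite !normrM mulrCA ler_wpM2l//.
    by rewrite (ger0_norm (ltW (gaussian_gt0 _ _))).
  apply: (rintegrable_dominated _ _ _ (rintegrableZl K measurableT
    (rintegrable_norm measurableT ki))) => //.
    by apply: measurable_funM => //; exact: measurableT_comp.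
  move=> x _; rewrite !normrM mulrCA ler_wpM2l//.
  by rewrite (ger0_norm (ltW (gaussian_gt0 _ _))).
pose H (f : R * R -> R) := [/\ measurable_fun setT f,
  (exists K, forall x, `|f x| <= K * gaussian 1 x) &
  Rintegral mu2 setT (fun x => g x * f x) =
  Rintegral nu setT (fun z => kappa z * f (pr z))].
have HH (f : R * R -> R) : measurable_fun setT f ->
    (exists K, forall x, `|f x| <= K * gaussian 1 x) -> H f.
  apply: (@plane_monotone_class R (gaussian 1) H 1).
  - by move=> x; rewrite mul1r.
  - move=> p q p' q'; split=> //; first exact: test_function_measurable.
    exists 1 => x; rewrite mul1r ger0_norm ?test_function_ge0//.
    exact: test_function_le.
  - move=> c f1 f2 [m1 [K1 h1] e1] [m2 [K2 h2] e2]; split.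
    + by apply: measurable_funD => //; exact: measurable_funM.
    + exists (`|c| * K1 + K2) => x; rewrite (le_trans (ler_normD _ _))//.
      by rewrite mulrDl lerD// normrM -mulrA ler_wpM2l.
    + have [i1 j1] := dom _ _ m1 h1; have [i2 j2] := dom _ _ m2 h2.
      under eq_Rintegral do rewrite mulrDr mulrCA.
      under [RHS]eq_Rintegral do rewrite mulrDr mulrCA.
      rewrite !RintegralD//; try exact: rintegrableZl.
      by rewrite !RintegralZl// e1 e2.
  - move=> f_ f1 K hf fK cf.
    have mf : measurable_fun setT f1.
      apply: (measurable_fun_cvg (h := f_)) => [n|x _]; last exact: cf.
      by case: (hf n).
    have f1K x : `|f1 x| <= K * gaussian 1 x.
      by apply: cvg_norm_le (cf x) _.
    split=> //; first by exists K.
    have [_ _ c1] := Rintegral_dominated measurableT (mu := mu2)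
      (f_ := fun n x => g x * f_ n x) (f := fun x => g x * f1 x)
      (g := fun x => K * `|g x * gaussian 1 x|)
      ltac:(by move=> n; have [? _ _] := hf n; exact: measurable_funM)
      ltac:(exact: measurable_funM)
      ltac:(by apply: nearW => x _; apply: cvgM; [exact: cvg_cst|exact: cf])
      ltac:(exact/rintegrableZl/rintegrable_norm)
      ltac:(by apply: nearW => x _ n; rewrite !normrM mulrCA ler_wpM2l//
               (ger0_norm (ltW (gaussian_gt0 _ _)))).
    have [_ _ c2] := Rintegral_dominated measurableT (mu := nu)
      (f_ := fun n x => kappa x * f_ n (pr x)) (f := fun x => kappa x * f1 (pr x))
      (g := fun x => K * `|kappa x * gaussian 1 (pr x)|)
      ltac:(by move=> n; have [? _ _] := hf n; apply: measurable_funM => //;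
               exact: measurableT_comp)
      ltac:(by apply: measurable_funM => //; exact: measurableT_comp)
      ltac:(by apply: nearW => x _; apply: cvgM; [exact: cvg_cst|exact: cf])
      ltac:(exact/rintegrableZl/rintegrable_norm)
      ltac:(by apply: nearW => x _ n; rewrite !normrM mulrCA ler_wpM2l//
               (ger0_norm (ltW (gaussian_gt0 _ _)))).
    apply: (cvg_unique (@Rhausdorff R) c1).
    rewrite (_ : (fun n => _) = fun n => Rintegral nu setT
      (fun x => kappa x * f_ n (pr x)))//.
    by apply/funext => n; have [] := hf n.
pose m (n : nat) x := Num.min (w x) (n%:R * gaussian 1 x).
have mm n : measurable_fun setT (m n).
  apply: measurable_minr => //; apply: measurable_funM => //.
  exact: gaussian_measurable.
have m0 n x : 0 <= m n x by rewrite le_min w0 mulr_ge0// ltW// gaussian_gt0.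
pose psi n x := if 0 <= g x then m n x else - m n x.
have mpsi n : measurable_fun setT (psi n) by exact: measurable_sign.
have normpsi n x : `|psi n x| = m n x.
  by rewrite /psi; case: ifPn => _; rewrite ?normrN ger0_norm.
have psiK n x : `|psi n x| <= n%:R * gaussian 1 x.
  by rewrite normpsi ge_min lexx orbT.
have bnd n : (\int[mu2]_x (`|g x| * m n x)%:E <=
    \int[nu]_z (`|kappa z| * w (pr z))%:E)%E.
  have [_ _ e] := HH (psi n) (mpsi n) (ex_intro _ n%:R (psiK n)).
  have [i1 i2] := dom _ _ (mpsi n) (psiK n).
  rewrite (_ : (fun x => _) = (fun x => (g x * psi n x)%:E)); last first.
    apply/funext => x; congr (_%:E); rewrite /psi; case: ifPn => gx.
      by rewrite ger0_norm.
    by rewrite mulrN -mulNr ltr0_norm// ltNge.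
  rewrite -Rintegral_EFin// e Rintegral_EFin//.
  apply: le_trans (lee_abs _) _.
  apply: (le_trans (le_abse_integral _ _ _)) => //.
    exact: measurable_int i2.
  apply: ge0_le_integral => //.
  - by apply: measurableT_comp => //; exact: measurable_int i2.
  - apply/measurable_EFinP/measurable_funM; exact: measurableT_comp.
  - move=> z _; rewrite /= lee_fin normrM ler_wpM2l// normpsi.
    by rewrite ge_min lexx.
rewrite (_ : (fun x => _) =
    (fun x => limn (fun n => (`|g x| * m n x)%:E))); last first.
  apply/funext => x; apply/esym/cvg_lim => //; apply: cvg_near_cst; near=> n.
  congr (_ * _)%:E; apply/min_idPl; rewrite -ler_pdivrMr ?gaussian_gt0//.
  apply: le_trans (ltW (truncnS_gt _)) _; rewrite ler_nat; near: n.
  exact: nbhs_infty_ge.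
have mgm n : measurable_fun setT (fun x => (`|g x| * m n x)%:E).
  by apply/measurable_EFinP/measurable_funM => //; exact: measurableT_comp.
have nd x : setT x -> {homo (fun n => (`|g x| * m n x)%:E) : k l / (k <= l)%N >-> (k <= l)%E}.
  move=> _ k l kl; rewrite lee_fin ler_wpM2l// /m le_min ge_min lexx/= ge_min.
  by rewrite ler_wpM2r ?orbT ?ler_nat// ltW// gaussian_gt0.
rewrite monotone_convergence//; last by move=> n x _; rewrite lee_fin mulr_ge0.
apply: lime_le; last exact: nearW.
apply: ereal_nondecreasing_is_cvgn => k l kl; apply: ge0_le_integral => //.
- by move=> x _; rewrite lee_fin mulr_ge0.
- exact: mgm.
- exact: mgm.
- by move=> x _; exact: nd.
Unshelve. all: by end_near. Qed.

End duality.

Local Open Scope complex_scope.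

(** * Schwartz functions *)

Section complex_modulus.
Context {R : realType}.
Implicit Types z : R[i].

Lemma cmodE z : cmod z = Num.sqrt (complex.Re z ^+ 2 + complex.Im z ^+ 2).
Proof. by case: z. Qed.

Lemma cmod_ge0 z : 0 <= cmod z. Proof. by rewrite cmodE. Qed.

Lemma cmodM z1 z2 : cmod (z1 * z2) = cmod z1 * cmod z2.
Proof. exact: ComplexField.Normc.normcM. Qed.

Lemma cmodD z1 z2 : cmod (z1 + z2) <= cmod z1 + cmod z2.
Proof. exact: le_normcD. Qed.

Lemma cmod_real (x : R) : cmod x%:C = `|x|.
Proof. by rewrite cmodE/= expr0n/= addr0 sqrtr_sqr. Qed.

Lemma cmodN z : cmod (- z) = cmod z.
Proof. exact: normcN. Qed.

Lemma le_Re_cmod z : `|complex.Re z| <= cmod z.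
Proof. by rewrite cmodE -sqrtr_sqr ler_wsqrtr// lerDl sqr_ge0. Qed.

Lemma le_Im_cmod z : `|complex.Im z| <= cmod z.
Proof. by rewrite cmodE -sqrtr_sqr ler_wsqrtr// lerDr sqr_ge0. Qed.

Lemma cmod_le_ReIm z : cmod z <= `|complex.Re z| + `|complex.Im z|.
Proof.
rewrite cmodE -[leRHS]ger0_norm ?addr_ge0// -sqrtr_sqr ler_wsqrtr//.
rewrite sqrrD !real_normK ?num_real// -addrA lerD2l lerDr.
by rewrite mulrn_wge0// mulr_ge0.
Qed.

Lemma cmod_cis (t : R) : cmod (cis t) = 1.
Proof. by rewrite cmodE/= cos2Dsin2 sqrtr1. Qed.

Lemma cis0 : cis 0 = 1 :> R[i]. Proof. by rewrite /cis cos0 sin0. Qed.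

Lemma cisD (s t : R) : cis (s + t) = cis s * cis t.
Proof.
by rewrite /cis cosD sinD; apply/eqP; rewrite eq_complex/= eqxx/= addrC eqxx.
Qed.

Lemma ReD z1 z2 : complex.Re (z1 + z2) = complex.Re z1 + complex.Re z2.
Proof. by case: z1 => ? ?; case: z2. Qed.

Lemma ImD z1 z2 : complex.Im (z1 + z2) = complex.Im z1 + complex.Im z2.
Proof. by case: z1 => ? ?; case: z2. Qed.

Lemma ReM z1 z2 : complex.Re (z1 * z2) =
  complex.Re z1 * complex.Re z2 - complex.Im z1 * complex.Im z2.
Proof. by case: z1 => ? ?; case: z2. Qed.

Lemma ImM z1 z2 : complex.Im (z1 * z2) =
  complex.Re z1 * complex.Im z2 + complex.Im z1 * complex.Re z2.
Proof. by case: z1 => ? ?; case: z2. Qed.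

Lemma complex_ext z1 z2 : complex.Re z1 = complex.Re z2 ->
  complex.Im z1 = complex.Im z2 -> z1 = z2.
Proof. by case: z1 => ? ?; case: z2 => ? ? /= -> ->. Qed.

End complex_modulus.

(** * Differential calculus on the plane *)

Section plane_calculus.
Context {R : realType}.
Implicit Types (f g : R * R -> R) (x v h : R * R).

Lemma partialD f g x v : differentiable f x -> differentiable g x ->
  differentiable (fun y => f y + g y) x /\
  'D_v (fun y => f y + g y) x = 'D_v f x + 'D_v g x.
Proof.
move=> df dg; split; first exact: differentiableD.
by rewrite -deriveD//; exact: diff_derivable.
Qed.

Lemma partialB f g x v : differentiable f x -> differentiable g x ->
  differentiable (fun y => f y - g y) x /\
  'D_v (fun y => f y - g y) x = 'D_v f x - 'D_v g x.
Proof.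
move=> df dg; split; first exact: differentiableB.
by rewrite -deriveB//; exact: diff_derivable.
Qed.

Lemma partialM f g x v : differentiable f x -> differentiable g x ->
  differentiable (fun y => f y * g y) x /\
  'D_v (fun y => f y * g y) x = 'D_v f x * g x + f x * 'D_v g x.
Proof.
move=> df dg; split; first exact: differentiableM.
have -> : (fun y => f y * g y) = f * g by [].
rewrite deriveM; [|exact: diff_derivable|exact: diff_derivable].
by rewrite addrC mulrC.
Qed.

Lemma partial_cst (c : R) x v :
  differentiable (fun=> c) x /\ 'D_v (fun=> c) x = 0.
Proof. by split; [exact: differentiable_cst|exact: derive_cst]. Qed.

Lemma partial_comp (k : R -> R) f x v (dk : R) : differentiable f x ->
  is_derive (f x) 1 k dk ->
  differentiable (fun y => k (f y)) x /\
  'D_v (fun y => k (f y)) x = dk * 'D_v f x.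
Proof.
move=> df [dk1 dkE].
have dk' : differentiable k (f x) by apply/derivable1_diffP.
have dkf : differentiable (k \o f) x by exact: differentiable_comp.
split=> //; rewrite -/(k \o f) deriveE// diff_comp// deriveE//=.
by rewrite diff1E// derive1E dkE mulrC.
Qed.

Lemma partial_coord (j : bool) x v :
  differentiable (coord j) x /\ 'D_v (coord j) x = coord j v.
Proof.
have [d1 d2] : differentiable (fst : R * R -> R) x /\
    differentiable (snd : R * R -> R) x.
  by split; apply: linear_differentiable => y; [exact: cvg_fst|exact: cvg_snd].
by case: j; split => //; rewrite deriveE// diff_lin// => y;
  [exact: cvg_snd|exact: cvg_fst].
Qed.

Lemma partial_linear (a b : R) x v :
  differentiable (fun y => a * y.1 + b * y.2) x /\
  'D_v (fun y => a * y.1 + b * y.2) x = a * v.1 + b * v.2.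
Proof.
have [d1 e1] := partial_coord false x v; have [d2 e2] := partial_coord true x v.
have [da ea] := partial_cst a x v; have [db eb] := partial_cst b x v.
have [d3 e3] := partialM v da d1; have [d4 e4] := partialM v db d2.
have [d5 e5] := partialD v d3 d4.
by split=> //; rewrite e5 e3 e4 ea eb e1 e2 !mul0r !add0r.
Qed.

Lemma differentiable_quadratic_error (V W : normedModType R) (f : V -> W)
    (df : {linear V -> W}) (x : V) (K : R) : continuous df ->
  (forall u, `|f (x + u) - f x - df u| <= K * `|u| ^+ 2) ->
  differentiable f x /\ 'd f x = df :> (V -> W).
Proof.
move=> cdf fK.
have fg : f \o shift x = cst (f x) + df +o_ 0 id.
  apply/eqaddoP => e e0; have [K0|K0] := leP K 0; near=> h;
    rewrite /= !fctE /= [h + x]addrC opprD addrA; apply: le_trans (fK h) _;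
    rewrite expr2 mulrA; apply: ler_wpM2r => //.
    by apply: le_trans (ltW e0); rewrite mulr_le0_ge0.
  rewrite mulrC -ler_pdivlMr//; apply/ltW; near: h; apply: nbhs0_lt.
  exact: divr_gt0.
have fd : 'd f x = df :> (V -> W) by exact: diff_unique.
by split=> //; apply/diff_locallyP; rewrite fd.
Unshelve. all: by end_near. Qed.

(** A quadratic Taylor remainder survives integration, so this criterion differentiates Fourier
    integrals without a theorem on differentiation under the integral sign. *)
Lemma quadratic_differentiable f x (a b K : R) :
  (forall h, `|f (x + h) - f x - (a * h.1 + b * h.2)| <=
     K * (`|h.1| + `|h.2|) ^+ 2) ->
  differentiable f x /\ forall v, 'D_v f x = a * v.1 + b * v.2.
Proof.
move=> fK; pose g := fun y : R * R => a * y.1 + b * y.2.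
have [dg _] := partial_linear a b x 0.
have gE h : 'd g x h = g h.
  by rewrite -deriveE// (partial_linear a b x h).2.
have K0 : 0 <= K.
  have := le_trans (normr_ge0 _) (fK (1, 0)).
  by rewrite /= normr1 normr0 addr0 expr1n mulr1.
(* The norm on [R * R] is the maximum of the coordinates, so [|h.1| + |h.2| <= 2 |h|], whence the
   factor 4. *)
have [||df fE] := @differentiable_quadratic_error _ _ f ('d g x) x (4 * K).
- exact: diff_continuous.
- move=> h; rewrite gE; apply: le_trans (fK h) _.
  have h1 : `|h.1| <= `|h| by rewrite [leRHS]prod_normE le_max lexx.
  have h2 : `|h.2| <= `|h| by rewrite [leRHS]prod_normE le_max lexx orbT.
  apply: (@le_trans _ _ (K * (`|h| + `|h|) ^+ 2)).
    by rewrite ler_wpM2l// ler_pXn2r ?nnegrE ?addr_ge0// lerD.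
  by rewrite le_eqVlt; apply/orP; left; apply/eqP; ring.
by split=> // v; rewrite deriveE// fE gE.
Qed.

End plane_calculus.

Section complex_calculus.
Context {R : realType}.
Implicit Types (phi psi g : R * R -> R[i]) (x : R * R) (j : bool).

Definition cdiff phi x :=
  differentiable (fun y => complex.Re (phi y)) x /\
  differentiable (fun y => complex.Im (phi y)) x.

Lemma cpartialD phi psi x j : cdiff phi x -> cdiff psi x ->
  cdiff (fun y => phi y + psi y) x /\
  cpartial j (fun y => phi y + psi y) x = cpartial j phi x + cpartial j psi x.
Proof.
move=> [d1 d2] [d3 d4].
have [d5 e5] := partialD (basis j) d1 d3; have [d6 e6] := partialD (basis j) d2 d4.
have eR : (fun y => complex.Re (phi y + psi y)) =
  (fun y => complex.Re (phi y) + complex.Re (psi y)) by apply/funext => y; rewrite ReD.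
have eI : (fun y => complex.Im (phi y + psi y)) =
  (fun y => complex.Im (phi y) + complex.Im (psi y)) by apply/funext => y; rewrite ImD.
split; first by rewrite /cdiff eR eI.
by rewrite /cpartial eR eI e5 e6.
Qed.

Lemma cpartialM phi psi x j : cdiff phi x -> cdiff psi x ->
  cdiff (fun y => phi y * psi y) x /\
  cpartial j (fun y => phi y * psi y) x =
    cpartial j phi x * psi x + phi x * cpartial j psi x.
Proof.
move=> [d1 d2] [d3 d4]; pose v := @basis R j.
have [d5 e5] := partialM v d1 d3; have [d6 e6] := partialM v d2 d4.
have [d7 e7] := partialM v d1 d4; have [d8 e8] := partialM v d2 d3.
have [d9 e9] := partialB v d5 d6; have [d10 e10] := partialD v d7 d8.
have eR : (fun y => complex.Re (phi y * psi y)) =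
  (fun y => complex.Re (phi y) * complex.Re (psi y) -
            complex.Im (phi y) * complex.Im (psi y)).
  by apply/funext => y; rewrite ReM.
have eI : (fun y => complex.Im (phi y * psi y)) =
  (fun y => complex.Re (phi y) * complex.Im (psi y) +
            complex.Im (phi y) * complex.Re (psi y)).
  by apply/funext => y; rewrite ImM.
split; first by rewrite /cdiff eR eI.
rewrite /cpartial eR eI -/v e9 e10 e5 e6 e7 e8.
by apply: complex_ext; rewrite /= ?ReD ?ImD ?ReM ?ImM/=; ring.
Qed.

Lemma cpartial_real (f : R * R -> R) x j : differentiable f x ->
  cdiff (fun y => (f y)%:C) x /\
  cpartial j (fun y => (f y)%:C) x = ('D_(basis j) f x)%:C.
Proof.
move=> df; have [d0 e0] := partial_cst 0 x (basis j).
by split=> //; rewrite /cpartial /= e0.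
Qed.

Lemma cpartial_cst (c : R[i]) x j :
  cdiff (fun=> c) x /\ cpartial j (fun=> c) x = 0.
Proof.
have [d1 e1] := partial_cst (complex.Re c) x (basis j).
have [d2 e2] := partial_cst (complex.Im c) x (basis j).
by split=> //; rewrite /cpartial e1 e2.
Qed.

Lemma cpartial_coord (k : bool) x j :
  cdiff (fun y => (coord k y)%:C) x /\
  cpartial j (fun y => (coord k y)%:C) x = (k == j)%:R%:C.
Proof.
have [d e] := partial_coord k x (basis j).
have [d' e'] := cpartial_real j d; split => //; rewrite e' e.
by case: k d e d' e'; case: j.
Qed.

Lemma cpartial_cis (a b : R) x j :
  cdiff (fun y => cis (a * y.1 + b * y.2)) x /\
  cpartial j (fun y => cis (a * y.1 + b * y.2)) x =
    (0 +i* (if j then b else a)) * cis (a * x.1 + b * x.2).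
Proof.
have [d e] := partial_linear a b x (basis j).
have [d1 e1] := partial_comp (basis j) d (is_derive_cos _).
have [d2 e2] := partial_comp (basis j) d (is_derive_sin _).
split; first by split.
rewrite /cpartial /= e1 e2 e.
by apply: complex_ext; rewrite ?ReM ?ImM /=; case: j {d e d1 e1 d2 e2} => /=; ring.
Qed.

Lemma is_derive_logistic (t : R) :
  is_derive t 1 logistic (logistic t * (1 - logistic t)).
Proof.
have e0 : expR (- t) > 0 := expR_gt0 _.
have n0 : 1 + expR (- t) != 0 by rewrite gt_eqF// addr_gt0.
have d1 : is_derive t 1 (fun s : R => 1 + expR (- s)) (- expR (- t)).
  by apply: is_derive_eq; ring.
have h : is_derive t 1 (fun s : R => (1 + expR (- s))^-1)
    (- (1 + expR (- t)) ^- 2 *: - expR (- t)).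
  exact: is_deriveV.
apply: is_derive_eq; rewrite /logistic /GRing.scale/=.
by field.
Qed.

(** The derivative is written with [1 + (- 1) * _], a shape that the constructors of [slow] produce
    literally. *)
Lemma cpartial_logistic (p q : R) (k : bool) x j :
  cdiff (fun y => (logistic (p * coord k y + q))%:C) x /\
  cpartial j (fun y => (logistic (p * coord k y + q))%:C) x =
  ((p * (k == j)%:R)%:C * (logistic (p * coord k x + q))%:C) *
   (1 + (- 1) * (logistic (p * coord k x + q))%:C).
Proof.
have [d1 e1] := partial_coord k x (basis j).
have [d2 e2] := partial_cst p x (basis j).
have [d3 e3] := partialM (basis j) d2 d1.
have [d4 e4] := partial_cst q x (basis j).
have [d5 e5] := partialD (basis j) d3 d4.
have [d6 e6] := partial_comp (basis j) d5 (is_derive_logistic _).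
have [d7 e7] := cpartial_real j d6; split=> //; rewrite e7 e6 e5 e3 e4 e2 e1.
apply: complex_ext; rewrite ?ReM ?ImM ?ReD ?ImD/= ?ReM ?ImM/=.
  by case: k {d1 e1 d2 e2 d3 e3 d4 e4 d5 e5 d6 e6 d7 e7}; case: j => /=; ring.
by ring.
Qed.

Lemma cpartial_gaussian (c : R) x j :
  cdiff (fun y => (gaussian c y)%:C) x /\
  cpartial j (fun y => (gaussian c y)%:C) x =
  (- (2 * c))%:C * (coord j x)%:C * (gaussian c x)%:C.
Proof.
have [d1 e1] := partial_coord false x (basis j).
have [d2 e2] := partial_coord true x (basis j).
have [d3 e3] := partialM (basis j) d1 d1.
have [d4 e4] := partialM (basis j) d2 d2.
have [d5 e5] := partialD (basis j) d3 d4.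
have [d6 e6] := partial_cst (- c) x (basis j).
have [d7 e7] := partialM (basis j) d6 d5.
have [d8 e8] := partial_comp (basis j) d7 (is_derive_expR _).
have -> : (fun y => (gaussian c y)%:C) = (fun y => (expR (- c *
    (coord false y * coord false y + coord true y * coord true y)))%:C).
  by apply/funext => y; rewrite /gaussian mulNr !expr2.
have [d9 e9] := cpartial_real j d8; split=> //; rewrite e9 e8 e7 e6 e5 e3 e4 e1 e2.
have -> : gaussian c x = expR (- c *
    (coord false x * coord false x + coord true x * coord true x)).
  by rewrite /gaussian mulNr !expr2.
apply: complex_ext; rewrite ?ReM ?ImM /= ?ReM ?ImM/=; last by ring.
by case: j {d1 e1 d2 e2 d3 e3 d4 e4 d5 e5 d6 e6 d7 e7 d8 e8 d9 e9} => /=; ring.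
Qed.

End complex_calculus.

(** * The Schwartz class and its multipliers *)

Section schwartz_class.
Context {R : realType}.
Implicit Types (phi psi g : R * R -> R[i]) (x : R * R) (j : bool).

Lemma enorm_ge0 x : 0 <= enorm x. Proof. exact: sqrtr_ge0. Qed.

Lemma coord_le_enorm j x : `|coord j x| <= enorm x.
Proof. by rewrite -sqrtr_sqr ler_wsqrtr//; case: j; rewrite ?lerDl ?lerDr sqr_ge0. Qed.

Lemma enorm_le x : enorm x <= `|x.1| + `|x.2|.
Proof.
rewrite -[leRHS]ger0_norm ?addr_ge0// -sqrtr_sqr ler_wsqrtr//.
rewrite sqrrD !real_normK ?num_real// -addrA lerD2l lerDr.
by rewrite mulrn_wge0// mulr_ge0.
Qed.

Lemma sqr_enorm x : enorm x ^+ 2 = x.1 ^+ 2 + x.2 ^+ 2.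
Proof. by rewrite sqr_sqrtr// addr_ge0 ?sqr_ge0. Qed.

Lemma enorm1_ge1 x : 1 <= 1 + enorm x. Proof. by rewrite lerDl enorm_ge0. Qed.

Lemma enorm1_exp_ge1 x N : 1 <= (1 + enorm x) ^+ N.
Proof. by rewrite exprn_ege1 ?enorm1_ge1. Qed.

Lemma enorm1_exp_gt0 x N : 0 < (1 + enorm x) ^+ N.
Proof. exact: lt_le_trans ltr01 (enorm1_exp_ge1 _ _). Qed.

Definition decay phi := forall N, exists K, forall x,
  (1 + enorm x) ^+ N * cmod (phi x) <= K.

Lemma cpartials_rcons w j phi :
  cpartials (rcons w j) phi = cpartials w (cpartial j phi).
Proof. by rewrite /cpartials foldr_rcons. Qed.

(** Words of derivatives are peeled from the innermost letter: this replaces [phi] by one of its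
    partial derivatives, again a member of [C], so iterated derivatives never have to be computed.
    The bound common to all words of length at most [n + 1] is the maximum of three bounds: for the
    function itself and for the two partial derivatives. *)
Lemma schwartz_coind (C : set (R * R -> R[i])) :
  (forall phi, C phi -> forall x, cdiff phi x) ->
  (forall phi, C phi -> decay phi) ->
  (forall phi j, C phi -> C (cpartial j phi)) ->
  forall phi, C phi -> schwartz phi.
Proof.
move=> Cd Cdec Cp phi Cphi; split.
  move=> w x; elim/last_ind: w phi Cphi x => [|w j IH] phi Cphi x.
    exact: Cd.
  by rewrite cpartials_rcons; apply: IH; exact: Cp.
move=> N; suff [K HK] : exists K, forall w x, (size w <= N)%N ->
    (1 + enorm x) ^+ N * cmod (cpartials w phi x) <= K.
  by exists K => _ [w [x [wN ->]]]; exact: HK.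
suff H n : forall phi, C phi -> exists K, forall w x, (size w <= n)%N ->
    (1 + enorm x) ^+ N * cmod (cpartials w phi x) <= K by exact: H.
elim: n => [|n IH] {Cphi}phi Cphi.
  have [K HK] := Cdec _ Cphi N; exists K => w x.
  by rewrite leqn0 size_eq0 => /eqP ->; exact: HK.
have [K HK] := Cdec _ Cphi N.
have [K1 HK1] := IH _ (Cp _ false Cphi).
have [K2 HK2] := IH _ (Cp _ true Cphi).
exists (Num.max K (Num.max K1 K2)) => w x.
case/lastP: w => [_|w j]; first by rewrite le_max HK.
rewrite size_rcons ltnS cpartials_rcons => wn; rewrite !le_max.
by case: j; [move: (HK2 w x wn)|move: (HK1 w x wn)] => ->; rewrite ?orbT.
Qed.

Lemma schwartz_cdiff phi x : schwartz phi -> cdiff phi x.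
Proof. by move=> [s _]; exact: (s [::] x). Qed.

Lemma le_seminorm phi N w x : schwartz phi -> (size w <= N)%N ->
  (1 + enorm x) ^+ N * cmod (cpartials w phi x) <= seminorm N phi.
Proof.
move=> [_ ub] wN; apply: ub_le_sup; first exact: ub.
by exists w, x.
Qed.

Lemma schwartz_decay phi : schwartz phi -> decay phi.
Proof. by move=> sphi N; exists (seminorm N phi) => x; exact: (le_seminorm (w := [::])). Qed.

Lemma schwartz_cpartial phi j : schwartz phi -> schwartz (cpartial j phi).
Proof.
move=> sphi; have [s ub] := sphi; split.
  by move=> w x; rewrite -cpartials_rcons; exact: s.
move=> N; exists (seminorm N.+1 phi) => _ [w [x [wN ->]]].
rewrite -cpartials_rcons.
apply: le_trans (le_seminorm x sphi (_ : size (rcons w j) <= N.+1)%N); last first.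
  by rewrite size_rcons.
by rewrite ler_wpM2r ?cmod_ge0// ler_weXn2l// enorm1_ge1.
Qed.

(** An algebra of functions of at most polynomial growth that is stable under partial derivatives.
    Its generators are what the Fourier calculus multiplies by: coordinates, characters, and the
    logistic factors of the test functions. *)
Inductive slow : (R * R -> R[i]) -> Prop :=
| slow_cst c : slow (fun=> c)
| slow_coord k : slow (fun x => (coord k x)%:C)
| slow_logistic p q k : slow (fun x => (logistic (p * coord k x + q))%:C)
| slow_cis a b : slow (fun x => cis (a * x.1 + b * x.2))
| slowD f g : slow f -> slow g -> slow (fun x => f x + g x)
| slowM f g : slow f -> slow g -> slow (fun x => f x * g x).

Lemma slow_cpartial g j : slow g ->
  (forall x, cdiff g x) /\ slow (cpartial j g).
Proof.
elim=> {g} [c|k|p q k|a b|f g _ [df sf] _ [dg sg]|f g sf [df sf'] sg [dg sg']].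
- split=> [x|]; first exact: (cpartial_cst c x j).1.
  rewrite (_ : cpartial _ _ = fun=> 0); first exact: slow_cst.
  by apply/funext => x; exact: (cpartial_cst c x j).2.
- split=> [x|]; first exact: (cpartial_coord k x j).1.
  rewrite (_ : cpartial _ _ = fun=> (k == j)%:R%:C); first exact: slow_cst.
  by apply/funext => x; exact: (cpartial_coord k x j).2.
- split=> [x|]; first exact: (cpartial_logistic p q k x j).1.
  rewrite (_ : cpartial _ _ = fun x =>
    ((p * (k == j)%:R)%:C * (logistic (p * coord k x + q))%:C) *
   (1 + (- 1) * (logistic (p * coord k x + q))%:C)).
    apply: slowM; first by apply: slowM; [exact: slow_cst|exact: slow_logistic].
    apply: slowD; first exact: slow_cst.
    by apply: slowM; [exact: slow_cst|exact: slow_logistic].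
  by apply/funext => x; exact: (cpartial_logistic p q k x j).2.
- split=> [x|]; first exact: (cpartial_cis a b x j).1.
  rewrite (_ : cpartial _ _ = fun x =>
    (0 +i* (if j then b else a)) * cis (a * x.1 + b * x.2)).
    by apply: slowM; [exact: slow_cst|exact: slow_cis].
  by apply/funext => x; exact: (cpartial_cis a b x j).2.
- split=> [x|]; first exact: (cpartialD j (df x) (dg x)).1.
  rewrite (_ : cpartial _ _ = fun x => cpartial j f x + cpartial j g x).
    exact: slowD.
  by apply/funext => x; exact: (cpartialD j (df x) (dg x)).2.
- split=> [x|]; first exact: (cpartialM j (df x) (dg x)).1.
  rewrite (_ : cpartial _ _ = fun x => cpartial j f x * g x + f x * cpartial j g x).
    by apply: slowD; exact: slowM.
  by apply/funext => x; exact: (cpartialM j (df x) (dg x)).2.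
Qed.

Lemma slow_bound g : slow g ->
  exists K N, 0 <= K /\ forall x, cmod (g x) <= K * (1 + enorm x) ^+ N.
Proof.
elim=> {g} [c|k|p q k|a b|f g _ [K1 [N1 [k1 h1]]] _ [K2 [N2 [k2 h2]]]|
  f g _ [K1 [N1 [k1 h1]]] _ [K2 [N2 [k2 h2]]]].
- by exists (cmod c), 0%N; split; [exact: cmod_ge0|move=> x; rewrite mulr1].
- exists 1, 1%N; split=> // x; rewrite mul1r expr1 cmod_real.
  by rewrite (le_trans (coord_le_enorm _ _))// lerDr.
- exists 1, 0%N; split=> // x; rewrite mulr1 cmod_real.
  by rewrite ger0_norm ?logistic_le1// logistic_ge0.
- by exists 1, 0%N; split=> // x; rewrite mulr1 cmod_cis.
- exists (K1 + K2), (N1 + N2)%N; split=> [|x]; first exact: addr_ge0.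
  rewrite (le_trans (cmodD _ _))// mulrDl lerD//.
    by rewrite (le_trans (h1 x))// ler_wpM2l// ler_weXn2l ?enorm1_ge1// leq_addr.
  by rewrite (le_trans (h2 x))// ler_wpM2l// ler_weXn2l ?enorm1_ge1// leq_addl.
- exists (K1 * K2), (N1 + N2)%N; split=> [|x]; first exact: mulr_ge0.
  by rewrite cmodM exprD mulrACA ler_pM ?cmod_ge0.
Qed.

Lemma decayD phi psi : decay phi -> decay psi -> decay (fun x => phi x + psi x).
Proof.
move=> d1 d2 N; have [K1 h1] := d1 N; have [K2 h2] := d2 N.
exists (K1 + K2) => x; apply: le_trans (lerD (h1 x) (h2 x)).
by rewrite -mulrDr ler_wpM2l ?cmodD// ltW// enorm1_exp_gt0.
Qed.

Lemma decay_slowM g phi : slow g -> decay phi -> decay (fun x => g x * phi x).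
Proof.
move=> sg dphi N; have [K [M [K0 HK]]] := slow_bound sg.
have [K' HK'] := dphi (N + M)%N; exists (K * K') => x.
rewrite cmodM; apply: le_trans (ler_wpM2l K0 (HK' x)).
have -> : K * ((1 + enorm x) ^+ (N + M) * cmod (phi x)) =
  (1 + enorm x) ^+ N * (K * (1 + enorm x) ^+ M * cmod (phi x)).
  by rewrite exprD; ring.
rewrite ler_wpM2l ?(ltW (enorm1_exp_gt0 _ _))//.
by rewrite ler_wpM2r ?cmod_ge0.
Qed.

Lemma schwartz_slowM g phi : slow g -> schwartz phi ->
  schwartz (fun x => g x * phi x).
Proof.
move=> sg0 sphi.
(* By Leibniz' rule the derivative of a product is a sum of two products, so products alone are not
   a stable class. Level [n] consists of sums of at most [2 ^ n] products, and a derivative raises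
   the level by one. *)
pose C := fix C n := if n is n.+1 then
    [set h : R * R -> R[i] | exists f g, [/\ C n f, C n g & h = fun x => f x + g x]] `|` C n
  else [set h | exists g f, [/\ slow g, schwartz f & h = fun x => g x * f x]].
have CS n : C n `<=` C n.+1 by move=> h hC; right.
have Cdiff n h : C n h -> forall x, cdiff h x.
  elim: n h => [|n IH] h /=.
    move=> [g' [f [sg sf ->]]] x.
    exact: (cpartialM true ((slow_cpartial true sg).1 x) (schwartz_cdiff x sf)).1.
  move=> [[f [g' [cf cg ->]]] x|]; last exact: IH.
  exact: (cpartialD true (IH _ cf x) (IH _ cg x)).1.
apply: (@schwartz_coind [set h | exists n, C n h]); last first.
- by exists 0%N, g, phi.
- move=> h j [n Cn]; exists n.+1; elim: n h Cn => [|n IH] h Cn.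
    have [g' [f [sg sf ->]]] := Cn; left.
    exists (fun x => cpartial j g' x * f x), (fun x => g' x * cpartial j f x); split.
    + by exists (cpartial j g'), f; split=> //; exact: (slow_cpartial j sg).2.
    + by exists g', (cpartial j f); split=> //; exact: schwartz_cpartial.
    + apply/funext => x.
      exact: (cpartialM j ((slow_cpartial j sg).1 x) (schwartz_cdiff x sf)).2.
  have [[f [g' [cf cg hE]]]|Cn'] := Cn; last by apply: CS; exact: IH.
  left; exists (cpartial j f), (cpartial j g'); split; [exact: IH|exact: IH|].
  rewrite hE; apply/funext => x.
  exact: (cpartialD j (Cdiff _ _ cf x) (Cdiff _ _ cg x)).2.
- move=> h [n]; elim: n h => [|n IH] h.
    by move=> [g' [f [sg sf ->]]]; apply: decay_slowM => //; exact: schwartz_decay.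
  move=> [[f [g' [cf cg ->]]]|]; last exact: IH.
  by apply: decayD; exact: IH.
- by move=> h [n Cn]; exact: (Cdiff n).
Qed.

Lemma schwartzZ (c : R[i]) phi : schwartz phi -> schwartz (fun x => c * phi x).
Proof. exact/schwartz_slowM/slow_cst. Qed.

Lemma decay_gaussian (c : R) : 0 < c -> decay (fun x => (gaussian c x)%:C).
Proof.
(* The exponent is shared among [M > 0] equal factors. Each factor only has to absorb one power of
   [1 + enorm x], for which [exp y >= 1 + y] suffices: [A] times [1 + c r^2 / M] is at least
   [2 (1 + r^2)], hence at least [1 + r]. *)
move=> c0 N; pose M := N.+1; pose A := 2 * (1 + M%:R / c).
have A0 : 0 <= A by rewrite mulr_ge0// addr_ge0// divr_ge0// ltW.
exists (A ^+ M) => x; rewrite cmod_real ger0_norm; last exact/ltW/gaussian_gt0.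
rewrite /gaussian expRN -sqr_enorm ler_pdivrMr ?expR_gt0//.
apply: (@le_trans _ _ ((1 + enorm x) ^+ M)).
  by rewrite ler_weXn2l ?enorm1_ge1.
have -> : expR (c * enorm x ^+ 2) = expR (c * enorm x ^+ 2 / M%:R) ^+ M.
  by rewrite -expRM_natl; congr expR; field; rewrite pnatr_eq0.
rewrite -exprMn; apply: lerXn2r; rewrite ?nnegrE ?addr_ge0 ?enorm_ge0//.
  by rewrite mulr_ge0// expR_ge0.
apply: (@le_trans _ _ (A * (1 + c * enorm x ^+ 2 / M%:R))); last first.
  by rewrite ler_wpM2l// expR_ge1Dx.
have M0 : 0 < M%:R :> R by [].
rewrite /A; move: (enorm x) (enorm_ge0 x) => r r0.
have -> : 2 * (1 + M%:R / c) * (1 + c * r ^+ 2 / M%:R) =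
  2 * (1 + r ^+ 2 + M%:R / c + c * r ^+ 2 / M%:R).
  by field; rewrite !gt_eqF.
have h1 : 0 <= M%:R / c by rewrite divr_ge0// ltW.
have h2 : 0 <= c * r ^+ 2 / M%:R by rewrite divr_ge0// mulr_ge0 ?sqr_ge0// ltW.
have : 0 <= (r - 1) ^+ 2 by exact: sqr_ge0.
rewrite sqrrB; move: (M%:R / c) (c * r ^+ 2 / M%:R) h1 h2 => u v h1 h2; nra.
Qed.

Lemma schwartz_gaussian (c : R) : 0 < c -> schwartz (fun x => (gaussian c x)%:C).
Proof.
move=> c0.
apply: (@schwartz_coind [set h | exists g, slow g /\
   h = fun x => g x * (gaussian c x)%:C]).
- move=> _ [g [sg ->]] x.
  exact: (cpartialM true ((slow_cpartial true sg).1 x) (cpartial_gaussian c x true).1).1.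
- by move=> _ [g [sg ->]]; apply: decay_slowM => //; exact: decay_gaussian.
- move=> _ j [g [sg ->]].
  exists (fun x => cpartial j g x + g x * ((- (2 * c))%:C * (coord j x)%:C)); split.
    apply: slowD; first exact: (slow_cpartial j sg).2.
    by apply: slowM => //; apply: slowM; [exact: slow_cst|exact: slow_coord].
  apply/funext => x.
  rewrite (cpartialM j ((slow_cpartial j sg).1 x) (cpartial_gaussian c x j).1).2.
  by rewrite (cpartial_gaussian c x j).2; ring.
- exists (fun=> 1); split; first exact: slow_cst.
  by apply/funext => x; rewrite mul1r.
Qed.

Lemma schwartz_test_function p q p' q' :
  schwartz (fun x => (test_function p q p' q' x)%:C : R[i]).
Proof.
rewrite (_ : (fun x => _) = (fun x =>
  ((logistic (p * coord false x + q))%:C * (logistic (p' * coord true x + q'))%:C) *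
  (gaussian 1 x)%:C)).
  apply: schwartz_slowM; last exact: schwartz_gaussian.
  by apply: slowM; exact: slow_logistic.
by apply/funext => x; rewrite /test_function !rmorphM mulrC.
Qed.

End schwartz_class.

(** * Complex integrals *)

Section complex_integrals.
Context d (T : measurableType d) (R : realType).
Variable mu : {measure set T -> \bar R}.
Implicit Types (D : set T) (f g : T -> R[i]) (h : T -> R).

Definition cmeasurable_on D f :=
  measurable_fun D (fun x => complex.Re (f x)) /\
  measurable_fun D (fun x => complex.Im (f x)).

Lemma cmeasurable_onD D f g : cmeasurable_on D f -> cmeasurable_on D g ->
  cmeasurable_on D (fun x => f x + g x).
Proof.
move=> [m1 m2] [m3 m4]; split.
  by under eq_fun do rewrite ReD; exact: measurable_funD.
by under eq_fun do rewrite ImD; exact: measurable_funD.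
Qed.

Lemma cmeasurable_onM D f g : cmeasurable_on D f -> cmeasurable_on D g ->
  cmeasurable_on D (fun x => f x * g x).
Proof.
move=> [m1 m2] [m3 m4]; split.
  under eq_fun do rewrite ReM.
  by apply: measurable_funB; exact: measurable_funM.
under eq_fun do rewrite ImM.
by apply: measurable_funD; exact: measurable_funM.
Qed.

Lemma cmeasurable_on_real D h : measurable_fun D h ->
  cmeasurable_on D (fun x => (h x)%:C).
Proof. by move=> mh; split => //=; exact: measurable_cst. Qed.

Lemma cmeasurable_on_cst D (c : R[i]) : cmeasurable_on D (fun=> c).
Proof. by split; exact: measurable_cst. Qed.

Lemma cmeasurable_cmod D f : measurable D -> cmeasurable_on D f ->
  measurable_fun D (fun x => cmod (f x)).
Proof.
move=> mD [m1 m2]; under eq_fun do rewrite cmodE.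
apply: (@measurableT_comp _ _ _ _ _ _ (@Num.sqrt R)).
  by apply: continuous_measurable_fun; exact: sqrt_continuous.
by apply: measurable_funD; exact: measurable_funX.
Qed.

Lemma cmeasurable_cis D h : measurable_fun D h ->
  cmeasurable_on D (fun x => cis (h x)).
Proof.
move=> mh; split => /=.
  apply: (measurableT_comp (continuous_measurable_fun _) mh).
  exact: continuous_cos.
apply: (measurableT_comp (continuous_measurable_fun _) mh).
exact: continuous_sin.
Qed.

Lemma cintegrable_cmeasurable D f : cintegrable mu D f -> cmeasurable_on D f.
Proof.
move=> [i1 i2].
by split; [exact: rintegrable_measurable i1|exact: rintegrable_measurable i2].
Qed.

Lemma cintegrable_dominated D f h : measurable D -> cmeasurable_on D f ->
  (forall x, D x -> cmod (f x) <= h x) -> rintegrable mu D h ->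
  cintegrable mu D f.
Proof.
move=> mD [m1 m2] fh ih; split.
  apply: (rintegrable_dominated mD m1 _ ih) => x Dx.
  exact: le_trans (le_Re_cmod _) (fh x Dx).
apply: (rintegrable_dominated mD m2 _ ih) => x Dx.
exact: le_trans (le_Im_cmod _) (fh x Dx).
Qed.

Lemma cintegrable_cmod D f : measurable D -> cintegrable mu D f ->
  rintegrable mu D (fun x => cmod (f x)).
Proof.
move=> mD fi; have mf := cintegrable_cmeasurable fi; case: fi => i1 i2.
apply: (rintegrable_dominated mD (cmeasurable_cmod mD mf) _
  (rintegrableD mD (rintegrable_norm mD i1) (rintegrable_norm mD i2))) => x _.
by rewrite ger0_norm ?cmod_ge0// cmod_le_ReIm.
Qed.

Lemma cintegrableD D f g : measurable D -> cintegrable mu D f ->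
  cintegrable mu D g -> cintegrable mu D (fun x => f x + g x).
Proof.
move=> mD [i1 i2] [i3 i4]; split.
  by under eq_fun do rewrite ReD; exact: rintegrableD.
by under eq_fun do rewrite ImD; exact: rintegrableD.
Qed.

Lemma cintegrableZ D (c : R[i]) f : measurable D -> cintegrable mu D f ->
  cintegrable mu D (fun x => c * f x).
Proof.
move=> mD [i1 i2]; split.
  under eq_fun do rewrite ReM.
  by apply: rintegrableB => //; exact: rintegrableZl.
under eq_fun do rewrite ImM.
by apply: rintegrableD => //; exact: rintegrableZl.
Qed.

Lemma cintD D f g : measurable D -> cintegrable mu D f -> cintegrable mu D g ->
  cint mu D (fun x => f x + g x) = cint mu D f + cint mu D g.
Proof.
move=> mD [i1 i2] [i3 i4]; apply: complex_ext; rewrite ?ReD ?ImD/= -RintegralD//.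
  by apply: eq_Rintegral => x _; rewrite ReD.
by apply: eq_Rintegral => x _; rewrite ImD.
Qed.

Lemma cintZ D (c : R[i]) f : measurable D -> cintegrable mu D f ->
  cint mu D (fun x => c * f x) = c * cint mu D f.
Proof.
move=> mD [i1 i2]; apply: complex_ext; rewrite ?ReM ?ImM/= -!RintegralZl//.
  rewrite -RintegralB//; [|exact: rintegrableZl|exact: rintegrableZl].
  by apply: eq_Rintegral => x _; rewrite ReM.
rewrite -RintegralD//; [|exact: rintegrableZl|exact: rintegrableZl].
by apply: eq_Rintegral => x _; rewrite ImM.
Qed.

Lemma eq_cint D f g : (forall x, D x -> f x = g x) ->
  cint mu D f = cint mu D g.
Proof.
move=> fg; apply: complex_ext; apply: eq_Rintegral => x /set_mem Dx;
by rewrite fg.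
Qed.

(** The factor 2 comes from bounding the real and imaginary parts separately; it is the origin of
    several factors 2 in later constants. *)
Lemma cmod_cint_le D f h : measurable D -> cmeasurable_on D f ->
  (forall x, D x -> cmod (f x) <= h x) -> rintegrable mu D h ->
  cmod (cint mu D f) <= 2 * Rintegral mu D h.
Proof.
move=> mD [m1 m2] fh ih; apply: le_trans (cmod_le_ReIm _) _.
rewrite mulr_natl mulr2n lerD//; apply: le_norm_Rintegral => // x Dx.
  exact: le_trans (le_Re_cmod _) (fh x Dx).
exact: le_trans (le_Im_cmod _) (fh x Dx).
Qed.

Lemma cint_ae_eq D f g : measurable D -> cmeasurable_on D f ->
  cmeasurable_on D g -> {ae mu, forall x, D x -> f x = g x} ->
  cint mu D f = cint mu D g.
Proof.
move=> mD [m1 m2] [m3 m4] fg; apply: complex_ext; apply: Rintegral_ae_eq => //;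
by apply: filterS fg => x H Dx; rewrite H.
Qed.

End complex_integrals.

Section complex_fubini.
Context d1 d2 (T1 : measurableType d1) (T2 : measurableType d2) (R : realType).
Variables (m1 : {sigma_finite_measure set T1 -> \bar R})
          (m2 : {sigma_finite_measure set T2 -> \bar R}).

Lemma cint_fubini_l (f : T1 * T2 -> R[i]) : cintegrable (m1 \x m2)%E setT f ->
  cintegrable m1 setT (fun x => cint m2 setT (fun y => f (x, y))) /\
  cint m1 setT (fun x => cint m2 setT (fun y => f (x, y))) =
  cint (m1 \x m2)%E setT f.
Proof.
move=> [i1 i2]; have [j1 e1] := Rintegral_fubini_l i1.
have [j2 e2] := Rintegral_fubini_l i2.
by split; [split|apply: complex_ext].
Qed.

Lemma cint_fubini_r (f : T1 * T2 -> R[i]) : cintegrable (m1 \x m2)%E setT f ->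
  cintegrable m2 setT (fun y => cint m1 setT (fun x => f (x, y))) /\
  cint m2 setT (fun y => cint m1 setT (fun x => f (x, y))) =
  cint (m1 \x m2)%E setT f.
Proof.
move=> [i1 i2]; have [j1 e1] := Rintegral_fubini_r i1.
have [j2 e2] := Rintegral_fubini_r i2.
by split; [split|apply: complex_ext].
Qed.

End complex_fubini.

(** * Integrals of derivatives *)

Section line_integrals.
Context {R : realType}.
Local Notation mu1 := (@lebesgue_measure R).

Lemma integrable_oneDsqrV : rintegrable mu1 setT (fun x => (oneDsqr x)^-1).
Proof.
have mf : measurable_fun setT (fun x : R => (oneDsqr x)^-1).
  by apply: continuous_measurable_fun; exact: continuous_oneDsqrV.
apply/integrableP; split; first exact/measurable_EFinP.
under eq_integral => x _.
  rewrite /= ger0_norm; last by rewrite invr_ge0 (le_trans ler01)// oneDsqr_ge1.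
  over.
rewrite ge0_symfun_integralT//.
- rewrite -set_itvcy integral0y_oneDsqr -EFinM ltry//.
- exact: continuous_oneDsqrV.
- by move=> x; rewrite /= /oneDsqr sqrrN.
Qed.

Lemma integral_derivative_eq0 (f f' : R -> R) (K : R) :
  (forall x : R, is_derive x 1 f (f' x)) -> continuous f' ->
  (forall x : R, `|f' x| <= K * (oneDsqr x)^-1) ->
  (forall x, `|f x| <= K * (oneDsqr x)^-1) ->
  Rintegral mu1 setT f' = 0.
Proof.
move=> df cf' f'K fK.
have mf' : measurable_fun setT f' by exact: continuous_measurable_fun.
have cf : continuous f.
  move=> x; apply: differentiable_continuous; apply/derivable1_diffP.
  by have [] := df x.
(* The successor keeps every interval nondegenerate, as the fundamental theorem of calculus
   demands. *)
pose I (n : nat) : set R := `[- n.+1%:R, n.+1%:R]%classic.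
have mI n : measurable (I n) by exact: measurable_itv.
pose F (n : nat) := f' \_ (I n).
have eF n : Rintegral mu1 setT (F n) = f n.+1%:R - f (- n.+1%:R).
  rewrite -Rintegral_mkcond /Rintegral (@continuous_FTC2 R f' f)//.
  - by rewrite -subr_gt0 opprK addr_gt0.
  - exact: continuous_subspaceT.
  - split.
    + by move=> x _; have [] := df x.
    + by apply: cvg_at_right_filter; exact: cf.
    + by apply: cvg_at_left_filter; exact: cf.
  - by move=> x _; rewrite derive1E; have [_ ->] := df x.
have mF n : measurable_fun setT (F n).
  by apply/(measurable_restrictT _ (mI n)); exact: measurable_funTS.
have [||_ _] := @Rintegral_dominated _ _ _ mu1 setT F f'
  (fun x => K / oneDsqr x) measurableT mF mf' _
  (rintegrableZl K measurableT integrable_oneDsqrV).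
- apply: nearW => x _; apply: cvg_near_cst; near=> n.
  rewrite /F patchE mem_set// /I/= in_itv/= -ler_norml.
  apply: (le_trans (ltW (truncnS_gt _))); rewrite ler_nat ltnS; near: n.
  exact: nbhs_infty_ge.
- apply: nearW => x _ n; rewrite /F patchE; case: ifPn => _ //.
  by rewrite normr0; exact: le_trans (f'K x).
under eq_fun do rewrite eF.
have f0 (s : R) : s ^+ 2 = 1 -> f (s * n.+1%:R) @[n --> \oo] --> (0 : R).
  move=> s2; apply/cvgr0Pnorm_lt => e e0; near=> n.
  apply: le_lt_trans (fK _) _.
  have n1 : K / e < n.+1%:R.
    apply: (lt_le_trans (truncnS_gt _)); rewrite ler_nat ltnS; near: n.
    exact: nbhs_infty_ge.
  have o0 : 0 < oneDsqr (s * n.+1%:R).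
    by apply: lt_le_trans (oneDsqr_ge1 _).
  rewrite ltr_pdivrMr// mulrC -ltr_pdivrMr//; apply: (lt_le_trans n1).
  rewrite /oneDsqr exprMn s2 mul1r expr2; have : (1 : R) <= n.+1%:R by rewrite ler1n.
  by move: (n.+1%:R : R) => r; nra.
have h1 := f0 1 (expr1n _ _); have h2 := f0 (- 1) (sqrr_sign R 1).
have h3 : f n.+1%:R - f (- n.+1%:R) @[n --> \oo] --> (0 - 0 : R).
  apply: cvgB; first by under eq_fun do rewrite -[_%:R]mul1r.
  by under eq_fun do rewrite -mulN1r.
by rewrite subr0 in h3 => h; exact: (cvg_unique (@Rhausdorff R) h h3).
Unshelve. all: by end_near. Qed.

End line_integrals.

Section schwartz_integrals.
Context {R : realType}.
Implicit Types (phi psi : R * R -> R[i]) (x xi : R * R) (j : bool).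
Local Notation mu1 := (@lebesgue_measure R).
Local Notation mu2 := (plane_measure R).

Lemma plane_dominated (f g : R * R -> R) : measurable_fun setT f ->
  (forall x, `|f x| <= g x) -> rintegrable mu2 setT g -> rintegrable mu2 setT f.
Proof.
move=> mf fg ig.
by apply: (@rintegrable_dominated _ _ _ mu2 setT f g measurableT mf _ ig) => x _.
Qed.

Lemma cplane_dominated phi (g : R * R -> R) : cmeasurable_on setT phi ->
  (forall x, cmod (phi x) <= g x) -> rintegrable mu2 setT g ->
  cintegrable mu2 setT phi.
Proof.
move=> mf fg ig.
by apply: (@cintegrable_dominated _ _ _ mu2 setT phi g measurableT mf _ ig) => x _.
Qed.

(** The common integrable majorant. Four powers of [1 + enorm x] dominate its inverse; being a
    product of functions of one variable, it is integrable by Fubini's theorem and also bounds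
    slices along the axes by integrable functions. *)
Definition plane_weight x : R := (oneDsqr x.1)^-1 * (oneDsqr x.2)^-1.

Lemma oneDsqr_gt0 (t : R) : 0 < oneDsqr t.
Proof. exact: lt_le_trans ltr01 (oneDsqr_ge1 _). Qed.

Lemma plane_weight_gt0 x : 0 < plane_weight x.
Proof. by rewrite mulr_gt0// invr_gt0 oneDsqr_gt0. Qed.

Lemma integrable_plane_weight : rintegrable mu2 setT plane_weight.
Proof.
exact: (rintegrable_prodM (@integrable_oneDsqrV R) (@integrable_oneDsqrV R)).
Qed.

Lemma plane_weight_enorm x : 1 <= (1 + enorm x) ^+ 4 * plane_weight x.
Proof.
rewrite /plane_weight -invfM ler_pdivlMr ?mulr_gt0 ?oneDsqr_gt0// mul1r.
have h t : t ^+ 2 <= enorm x ^+ 2 -> oneDsqr t <= (1 + enorm x) ^+ 2.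
  by move: (enorm_ge0 x) => e0; rewrite /oneDsqr => ?; nra.
rewrite (_ : 4%N = (2 + 2)%N)// exprD ler_pM ?(ltW (oneDsqr_gt0 _))//; apply: h.
  by rewrite sqr_enorm lerDl sqr_ge0.
by rewrite sqr_enorm lerDr sqr_ge0.
Qed.

Lemma le_plane_weight (a K : R) x :
  (1 + enorm x) ^+ 4 * a <= K -> 0 <= a -> a <= K * plane_weight x.
Proof.
move=> aK a0; apply: le_trans (ler_wpM2r (ltW (plane_weight_gt0 x)) aK).
by rewrite mulrAC ler_peMl// plane_weight_enorm.
Qed.

Lemma decay_plane_weight phi : decay phi ->
  exists K, forall x, cmod (phi x) <= K * plane_weight x.
Proof.
by move=> /(_ 4%N)[K HK]; exists K => x; rewrite le_plane_weight ?cmod_ge0.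
Qed.

Lemma decay_integrable phi : cmeasurable_on setT phi -> decay phi ->
  cintegrable mu2 setT phi.
Proof.
move=> mphi /decay_plane_weight[K HK].
apply: (cplane_dominated mphi HK).
exact: rintegrableZl integrable_plane_weight.
Qed.

Lemma schwartz_continuous phi : schwartz phi ->
  continuous (fun x => complex.Re (phi x)) /\
  continuous (fun x => complex.Im (phi x)).
Proof.
by move=> sphi; split=> x; have [d1 d2] := schwartz_cdiff x sphi;
  exact: differentiable_continuous.
Qed.

Lemma schwartz_measurable phi : schwartz phi -> cmeasurable_on setT phi.
Proof.
move=> /schwartz_continuous[c1 c2].
by split; exact: continuous_measurable_plane.
Qed.

Lemma schwartz_integrable phi : schwartz phi -> cintegrable mu2 setT phi.
Proof.
move=> sphi; apply: decay_integrable; first exact: schwartz_measurable.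
exact: schwartz_decay.
Qed.

Lemma partial_slice (F : R * R -> R) x j : differentiable F x ->
  is_derive (coord j x) (1 : R)
    (fun t => F (if j then (x.1, t) else (t, x.2))) ('D_(basis j) F x).
Proof.
move=> dF; have h := @diff_derivable _ _ _ F x (basis j) dF.
have E : (fun h : R => h^-1 *: ((F \o shift x) (h *: basis j) - F x)) =
    (fun h : R => h^-1 *: (((fun t => F (if j then (x.1, t) else (t, x.2))) \o
       shift (coord j x)) (h *: 1) - F (if j then (x.1, coord j x) else (coord j x, x.2)))).
  apply/funext => k; congr (_ *: (_ - _)).
    rewrite /= /shift/=; congr F; case: x {dF h} => a b.
    by case: j; congr pair => /=; rewrite ?scaler0 ?add0r.
  by case: x {dF h} => a b; case: j.
by split; rewrite ?/derivable ?/derive -E.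
Qed.

(** Fubini's theorem is used in the order for which the inner integral runs in the direction [j],
    where the fundamental theorem of calculus makes it vanish. *)
Lemma integral_partial_eq0 (F : R * R -> R) (K : R) j :
  (forall x, differentiable F x) -> continuous (fun x => 'D_(basis j) F x) ->
  (forall x, `|F x| <= K * plane_weight x) ->
  (forall x, `|'D_(basis j) F x| <= K * plane_weight x) ->
  Rintegral mu2 setT (fun x => 'D_(basis j) F x) = 0.
Proof.
move=> dF cF FK dFK.
have iF : rintegrable mu2 setT (fun x => 'D_(basis j) F x).
  apply: (plane_dominated _ dFK).
    exact: continuous_measurable_plane.
  exact: rintegrableZl integrable_plane_weight.
have cpair (a : R) : continuous (fun t : R => (t, a)) /\
    continuous (fun t : R => (a, t)).
  split=> t.
    exact: (@cvg_pair _ _ _ (nbhs t) (nbhs t) (nbhs a) _ _ _ id (fun=> a)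
      cvg_id (cvg_cst a)).
  exact: (@cvg_pair _ _ _ (nbhs t) (nbhs a) (nbhs t) _ _ _ (fun=> a) id
    (cvg_cst a) cvg_id).
have R0 : Rintegral mu1 setT (fun=> 0) = 0 by rewrite Rintegral_cst// mul0r.
case: j cF dFK iF => cF dFK iF.
  rewrite -(Rintegral_fubini_l iF).2 -[RHS]R0.
  apply: eq_Rintegral => a _.
  apply: (@integral_derivative_eq0 _ (fun t => F (a, t)) _ (K * (oneDsqr a)^-1)).
  - by move=> t; exact: (@partial_slice F (a, t) true).
  - by move=> t; exact: (continuous_comp ((cpair a).2 t) (cF (a, t))).
  - by move=> t; rewrite -mulrA; exact: (dFK (a, t)).
  - by move=> t; rewrite -mulrA; exact: (FK (a, t)).
rewrite -(Rintegral_fubini_r iF).2 -[RHS]R0.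
apply: eq_Rintegral => a _.
apply: (@integral_derivative_eq0 _ (fun t => F (t, a)) _ (K * (oneDsqr a)^-1)).
- by move=> t; exact: (@partial_slice F (t, a) false).
- by move=> t; exact: (continuous_comp ((cpair a).1 t) (cF (t, a))).
- by move=> t; rewrite -mulrA [_^-1 * _]mulrC; exact: (dFK (t, a)).
- by move=> t; rewrite -mulrA [_^-1 * _]mulrC; exact: (FK (t, a)).
Qed.

Lemma cint_cpartial phi j : schwartz phi -> cint mu2 setT (cpartial j phi) = 0.
Proof.
move=> sphi; have sd := schwartz_cpartial j sphi.
have [c1 c2] := schwartz_continuous sd.
have [K1 h1] := decay_plane_weight (schwartz_decay sphi).
have [K2 h2] := decay_plane_weight (schwartz_decay sd).
pose K := Num.max K1 K2.
have W0 x := ltW (plane_weight_gt0 x).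
have hK1 x : cmod (phi x) <= K * plane_weight x.
  by rewrite (le_trans (h1 x))// ler_wpM2r// le_max lexx.
have hK2 x : cmod (cpartial j phi x) <= K * plane_weight x.
  by rewrite (le_trans (h2 x))// ler_wpM2r// le_max lexx orbT.
apply: complex_ext; rewrite /=; apply: (@integral_partial_eq0 _ K) => //.
- by move=> x; exact: (schwartz_cdiff x sphi).1.
- by move=> x; apply: le_trans (hK1 x); exact: le_Re_cmod.
- by move=> x; apply: le_trans (hK2 x); exact: le_Re_cmod (cpartial j phi x).
- by move=> x; exact: (schwartz_cdiff x sphi).2.
- by move=> x; apply: le_trans (hK1 x); exact: le_Im_cmod.
- by move=> x; apply: le_trans (hK2 x); exact: le_Im_cmod (cpartial j phi x).
Qed.

End schwartz_integrals.

Section trigonometric_transform.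
Context {R : realType}.
Local Notation mu2 := (plane_measure R).

Lemma MVT_bound (f f' : R -> R) (K : R) (a b : R) :
  (forall x : R, is_derive x (1 : R) f (f' x)) ->
  (forall x, `|x - a| <= `|b| -> `|f' x| <= K) -> `|f (a + b) - f a| <= K * `|b|.
Proof.
move=> df f'K.
have cf (u v : R) : {within `[u, v], continuous f}.
  apply: continuous_subspaceT => x; apply: differentiable_continuous.
  by apply/derivable1_diffP; have [] := df x.
have [b0|b0|->] := ltgtP b 0; last by rewrite addr0 subrr !normr0 mulr0.
  have [|c + e] := @MVT _ f f' (a + b) a _ (fun x _ => df x) (cf _ _).
    by rewrite gtrDl.
  rewrite in_itv/= => /andP[c1 c2].
  rewrite -normrN opprB e opprD addrA subrr sub0r normrM normrN ler_wpM2r//.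
  by apply: f'K; rewrite (ltr0_norm b0) ltr0_norm ?subr_lt0//; lra.
have [|c + e] := @MVT _ f f' a (a + b) _ (fun x _ => df x) (cf _ _).
  by rewrite ltrDl.
rewrite in_itv/= => /andP[c1 c2]; rewrite e.
rewrite [a + b]addrC addrK normrM ler_wpM2r//.
by apply: f'K; rewrite (gtr0_norm b0) gtr0_norm ?subr_gt0//; lra.
Qed.

Lemma cos_lipschitz (a b : R) : `|cos (a + b) - cos a| <= `|b|.
Proof.
rewrite -[leRHS]mul1r; apply: (MVT_bound (fun x => is_derive_cos x)) => x _.
by rewrite normrN sin_max.
Qed.

Lemma sin_lipschitz (a b : R) : `|sin (a + b) - sin a| <= `|b|.
Proof.
rewrite -[leRHS]mul1r; apply: (MVT_bound (fun x => is_derive_sin x)) => x _.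
by rewrite cos_max.
Qed.

Lemma cos_quadratic (a b : R) : `|cos (a + b) - cos a - b * - sin a| <= b ^+ 2.
Proof.
have D x : is_derive x (1 : R) (fun x => cos x - x * - sin a) (- sin x - - sin a).
  by apply: is_derive_eq; rewrite /GRing.scale/=; ring.
have := @MVT_bound _ _ `|b| a b D.
rewrite (_ : _ - _ = cos (a + b) - cos a - b * - sin a); last by ring.
rewrite -expr2 real_normK ?num_real//; apply => x xb.
rewrite (_ : - sin x - - sin a = - (sin (a + (x - a)) - sin a)); last first.
  by rewrite addrCA subrr addr0; ring.
by rewrite normrN; exact: le_trans (sin_lipschitz _ _) xb.
Qed.

Lemma sin_quadratic (a b : R) : `|sin (a + b) - sin a - b * cos a| <= b ^+ 2.
Proof.
have D x : is_derive x (1 : R) (fun x => sin x - x * cos a) (cos x - cos a).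
  by apply: is_derive_eq; rewrite /GRing.scale/=; ring.
have := @MVT_bound _ _ `|b| a b D.
rewrite (_ : _ - _ = sin (a + b) - sin a - b * cos a); last by ring.
rewrite -expr2 real_normK ?num_real//; apply => x xb.
by apply: le_trans xb; have := cos_lipschitz a (x - a); rewrite addrCA subrr addr0.
Qed.

End trigonometric_transform.

Lemma eq_rintegrable d (T : measurableType d) (R : realType)
    (mu : {measure set T -> \bar R}) (D : set T) (f g : T -> R) :
  (forall x, f x = g x) -> rintegrable mu D f -> rintegrable mu D g.
Proof. by move=> /funext ->. Qed.

(** * The Fourier transform on the Schwartz class *)

Section fourier_calculus.
Context {R : realType}.
Implicit Types (phi psi : R * R -> R[i]) (x xi h : R * R) (j : bool) (s : R).
Local Notation mu2 := (plane_measure R).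

Lemma dotpDr x xi h : dotp x (xi + h) = dotp x xi + dotp x h.
Proof. by rewrite /dotp /=; ring. Qed.

Lemma norm_dotp_le x h : `|dotp x h| <= enorm x * (`|h.1| + `|h.2|).
Proof.
rewrite /dotp (le_trans (ler_normD _ _))// !normrM mulrDr lerD// ler_wpM2r//.
  exact: (coord_le_enorm false).
exact: (coord_le_enorm true).
Qed.

Lemma dotp_measurable xi : measurable_fun setT (fun x => dotp x xi).
Proof. by apply: measurable_funD; apply: measurable_funM => //. Qed.

Lemma coord_measurable j : measurable_fun setT (@coord R j).
Proof. by case: j; [exact: measurable_snd|exact: measurable_fst]. Qed.

Lemma enorm_measurable : measurable_fun setT (@enorm R).
Proof.
apply: (@measurableT_comp _ _ _ _ _ _ (@Num.sqrt R)).
  by apply: continuous_measurable_fun; exact: sqrt_continuous.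
by apply: measurable_funD; apply: measurable_funX;
  [exact: measurable_fst|exact: measurable_snd].
Qed.

(** Meant for [k] the cosine or the sine and [k'] its derivative. Integrating the quadratic
    remainder of [k] gives a quadratic remainder for [f]. Of the six powers of [1 + enorm x], two
    absorb the square of [dotp x h] and four make the result integrable. *)
Lemma trig_transform_differentiable (k k' : R -> R) s (a : R * R -> R) (K : R) xi :
  (forall u b, `|k (u + b) - k u - b * k' u| <= b ^+ 2) ->
  (forall u, `|k u| <= 1) -> (forall u, `|k' u| <= 1) ->
  continuous k -> continuous k' -> measurable_fun setT a ->
  (forall x, (1 + enorm x) ^+ 6 * `|a x| <= K) ->
  let f := fun xi => Rintegral mu2 setT (fun x => k (s * dotp x xi) * a x) in
  differentiable f xi /\ forall j, 'D_(basis j) f xi =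
    Rintegral mu2 setT (fun x => s * coord j x * k' (s * dotp x xi) * a x).
Proof.
move=> quad k1 k'1 ck ck' ma aK f.
pose M x := (1 + enorm x) ^+ 2 * `|a x|.
have M0 x : 0 <= M x by rewrite mulr_ge0// ltW// enorm1_exp_gt0.
have mM : measurable_fun setT M.
  apply: measurable_funM; last exact: measurableT_comp.
  by apply: measurable_funX; apply: measurable_funD => //; exact: enorm_measurable.
have iM : rintegrable mu2 setT M.
  apply: (plane_dominated mM (g := fun x => K * plane_weight x)).
    move=> x; rewrite (ger0_norm (M0 x)); apply: le_plane_weight => //.
    by rewrite /M mulrA -exprD.
  exact: rintegrableZl integrable_plane_weight.
have mk xi' : measurable_fun setT (fun x => k (s * dotp x xi')).
  apply: (measurableT_comp (continuous_measurable_fun ck)).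
  by apply: measurable_funM => //; exact: dotp_measurable.
have mk' xi' : measurable_fun setT (fun x => k' (s * dotp x xi')).
  apply: (measurableT_comp (continuous_measurable_fun ck')).
  by apply: measurable_funM => //; exact: dotp_measurable.
have e1 x : 1 <= (1 + enorm x) ^+ 2 by exact: enorm1_exp_ge1.
have ik xi' : rintegrable mu2 setT (fun x => k (s * dotp x xi') * a x).
  apply: (plane_dominated _ _ iM); first exact: measurable_funM.
  move=> x; rewrite normrM /M ler_wpM2r// (le_trans (k1 _))//.
have ik' j : rintegrable mu2 setT
    (fun x => s * coord j x * k' (s * dotp x xi) * a x).
  apply: (plane_dominated _ (g := fun x => `|s| * M x)).
  - apply: measurable_funM => //; apply: measurable_funM => //.
    by apply: measurable_funM => //; exact: coord_measurable.
  - move=> x; rewrite !normrM /M -[leLHS]mulrA -[leLHS]mulrA ler_wpM2l// mulrA ler_wpM2r//.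
    apply: le_trans (_ : enorm x * 1 <= _).
      by rewrite ler_pM// coord_le_enorm.
    by rewrite mulr1; move: (enorm_ge0 x) => ?; nra.
  - exact: rintegrableZl.
pose A j := Rintegral mu2 setT (fun x => s * coord j x * k' (s * dotp x xi) * a x).
have [] := @quadratic_differentiable R f xi (A false) (A true)
    (s ^+ 2 * Rintegral mu2 setT M).
  move=> h.
  pose r x := (k (s * dotp x xi + s * dotp x h) - k (s * dotp x xi) -
    s * dotp x h * k' (s * dotp x xi)) * a x.
  have -> : f (xi + h) - f xi - (A false * h.1 + A true * h.2) =
      Rintegral mu2 setT r.
    have i1 := rintegrableZr h.1 measurableT (ik' false).
    have i2 := rintegrableZr h.2 measurableT (ik' true).
    rewrite -(RintegralZr h.1 measurableT (ik' false)).
    rewrite -(RintegralZr h.2 measurableT (ik' true)).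
    rewrite -(RintegralB measurableT (ik (xi + h)) (ik xi)).
    rewrite -(RintegralD measurableT i1 i2).
    rewrite -(RintegralB measurableT (rintegrableB measurableT (ik (xi + h)) (ik xi))
      (rintegrableD measurableT i1 i2)).
    apply: eq_Rintegral => x _; rewrite /r dotpDr mulrDr.
    by rewrite /dotp /=; ring.
  rewrite (_ : s ^+ 2 * _ * _ = Rintegral mu2 setT
    (fun x => (s ^+ 2 * (`|h.1| + `|h.2|) ^+ 2) * M x)); last first.
    by rewrite RintegralZl//; ring.
  apply: le_norm_Rintegral => //.
  - apply: measurable_funM => //; apply: measurable_funB.
      apply: measurable_funB; last exact: mk.
      by under eq_fun do rewrite -mulrDr -dotpDr; exact: mk.
    apply: measurable_funM; last exact: mk'.
    by apply: measurable_funM => //; exact: dotp_measurable.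
  - exact: rintegrableZl.
  - move=> x _; rewrite normrM /M mulrA ler_wpM2r//.
    apply: le_trans (quad _ _) _; rewrite exprMn -mulrA ler_wpM2l ?sqr_ge0//.
    rewrite -real_normK ?num_real// -exprMn.
    rewrite lerXn2r ?nnegrE ?mulr_ge0 ?addr_ge0 ?enorm_ge0//.
    rewrite (le_trans (norm_dotp_le _ _))// mulrC ler_wpM2l ?addr_ge0//.
    by rewrite lerDr.
move=> df Df; split=> // j; rewrite Df /A.
by case: j => /=; rewrite ?mulr0 ?mulr1 ?addr0 ?add0r.
Qed.

(** One family for both transforms: [s = -1] is the Fourier transform, and [s = 1] is its inverse up
    to the constant [(2 pi)^2]. *)
Definition fs s phi : R * R -> R[i] := fun xi =>
  cint mu2 setT (fun x => cis (s * dotp x xi) * phi x).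

Lemma fourierE phi : fourier phi = fs (- 1) phi.
Proof.
by apply/funext => xi; apply: eq_cint => x _; rewrite mulN1r.
Qed.

Lemma dotpC x xi : dotp x xi = dotp xi x.
Proof. by rewrite /dotp mulrC [x.2 * _]mulrC. Qed.

Lemma ifourierE phi : ifourier phi = fun x => (((2 * pi) ^+ 2)^-1)%:C * fs 1 phi x.
Proof.
apply/funext => xi; congr (_ * _); apply: eq_cint => x _.
by rewrite mul1r dotpC.
Qed.

Lemma cis_dotp_measurable s xi : cmeasurable_on setT (fun x => cis (s * dotp x xi)).
Proof.
by apply: cmeasurable_cis; apply: measurable_funM => //; exact: dotp_measurable.
Qed.

Lemma cmod_cisM t (z : R[i]) : cmod (cis t * z) = cmod z.
Proof. by rewrite cmodM cmod_cis mul1r. Qed.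

Lemma fs_integrand_integrable s phi xi : cintegrable mu2 setT phi ->
  cintegrable mu2 setT (fun x => cis (s * dotp x xi) * phi x).
Proof.
move=> iphi; apply: (cplane_dominated (g := fun x => cmod (phi x))).
- apply: cmeasurable_onM; first exact: cis_dotp_measurable.
  exact: cintegrable_cmeasurable iphi.
- by move=> x; rewrite cmod_cisM.
- exact: cintegrable_cmod.
Qed.

Lemma fs_bound s phi xi : cintegrable mu2 setT phi ->
  cmod (fs s phi xi) <= 2 * Rintegral mu2 setT (fun x => cmod (phi x)).
Proof.
move=> iphi; apply: cmod_cint_le => //.
- exact: cintegrable_cmeasurable (fs_integrand_integrable s xi iphi).
- by move=> x _; rewrite cmod_cisM.
- exact: cintegrable_cmod.
Qed.

Lemma slow_cis_dotp s xi : slow (fun x => cis (s * dotp x xi)).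
Proof.
rewrite (_ : (fun x => _) = fun x => cis ((s * xi.1) * x.1 + (s * xi.2) * x.2)).
  exact: slow_cis.
by apply/funext => x; congr cis; rewrite /dotp; ring.
Qed.

Lemma cpartial_cis_dotp s xi x j : cdiff (fun y => cis (s * dotp y xi)) x /\
  cpartial j (fun y => cis (s * dotp y xi)) x =
  (0 +i* (s * coord j xi)) * cis (s * dotp x xi).
Proof.
have -> : (fun x => cis (s * dotp x xi)) =
    fun x => cis ((s * xi.1) * x.1 + (s * xi.2) * x.2).
  by apply/funext => y; congr cis; rewrite /dotp; ring.
have [h1 ->] := cpartial_cis (s * xi.1) (s * xi.2) x j; split=> //.
rewrite (_ : s * xi.1 * x.1 + _ = s * dotp x xi); last by rewrite /dotp; ring.
by case: j {h1}.
Qed.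

Lemma cpartial_fs s phi j xi : schwartz phi ->
  cdiff (fs s phi) xi /\
  cpartial j (fs s phi) xi = fs s (fun x => (0 +i* (s * coord j x)) * phi x) xi.
Proof.
move=> sphi; have [m1 m2] := schwartz_measurable sphi.
have [K HK] := schwartz_decay sphi 6.
have b1 x : (1 + enorm x) ^+ 6 * `|complex.Re (phi x)| <= K.
  by apply: le_trans (HK x); rewrite ler_wpM2l ?le_Re_cmod// ltW// enorm1_exp_gt0.
have b2 x : (1 + enorm x) ^+ 6 * `|complex.Im (phi x)| <= K.
  by apply: le_trans (HK x); rewrite ler_wpM2l ?le_Im_cmod// ltW// enorm1_exp_gt0.
have ccos : continuous (@cos R) by exact: continuous_cos.
have csin : continuous (@sin R) by exact: continuous_sin.
have cnsin : continuous (fun u : R => - sin u) by move=> u; apply: cvgN; exact: csin.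
have nsin1 (u : R) : `|- sin u| <= 1 by rewrite normrN sin_max.
have tC (a : R * R -> R) := @trig_transform_differentiable cos (fun u => - sin u)
  s a K xi (@cos_quadratic R) (@cos_max R) nsin1 ccos cnsin.
have tS (a : R * R -> R) := @trig_transform_differentiable sin cos
  s a K xi (@sin_quadratic R) (@sin_max R) (@cos_max R) csin ccos.
have [d1 e1] := tC _ m1 b1; have [d2 e2] := tS _ m2 b2.
have [d3 e3] := tC _ m2 b2; have [d4 e4] := tS _ m1 b1.
have [d5 e5] := partialB (basis j) d1 d2; have [d6 e6] := partialD (basis j) d3 d4.
have [i1 i2] := schwartz_integrable sphi.
have mc xi' : measurable_fun setT (fun x => cos (s * dotp x xi')).
  exact: (cis_dotp_measurable s xi').1.
have ms xi' : measurable_fun setT (fun x => sin (s * dotp x xi')).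
  exact: (cis_dotp_measurable s xi').2.
have ic (g : R * R -> R) xi' : rintegrable mu2 setT g ->
    rintegrable mu2 setT (fun x => cos (s * dotp x xi') * g x) /\
    rintegrable mu2 setT (fun x => sin (s * dotp x xi') * g x).
  move=> ig; have mg := rintegrable_measurable ig; split;
    apply: (plane_dominated _ _ (rintegrable_norm measurableT ig)).
  - exact: measurable_funM.
  - by move=> x; rewrite normrM ler_piMl// cos_max.
  - exact: measurable_funM.
  - by move=> x; rewrite normrM ler_piMl// sin_max.
have eR : (fun xi => complex.Re (fs s phi xi)) = fun xi =>
    Rintegral mu2 setT (fun x => cos (s * dotp x xi) * complex.Re (phi x)) -
    Rintegral mu2 setT (fun x => sin (s * dotp x xi) * complex.Im (phi x)).
  apply/funext => xi'; rewrite /= -RintegralB//; last 2 first.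
  - exact: (ic _ _ i1).1.
  - exact: (ic _ _ i2).2.
  by apply: eq_Rintegral => x _; rewrite ReM.
have eI : (fun xi => complex.Im (fs s phi xi)) = fun xi =>
    Rintegral mu2 setT (fun x => cos (s * dotp x xi) * complex.Im (phi x)) +
    Rintegral mu2 setT (fun x => sin (s * dotp x xi) * complex.Re (phi x)).
  apply/funext => xi'; rewrite /= -RintegralD//; last 2 first.
  - exact: (ic _ _ i2).1.
  - exact: (ic _ _ i1).2.
  by apply: eq_Rintegral => x _; rewrite ImM.
split; first by rewrite /cdiff eR eI.
have scoord : schwartz (fun x => (s * coord j x)%:C * phi x).
  apply: schwartz_slowM sphi; rewrite (_ : (fun x => _) = fun x =>
    s%:C * (coord j x)%:C); last by apply/funext => x; rewrite rmorphM.
  by apply: slowM; [exact: slow_cst|exact: slow_coord].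
have i3 : rintegrable mu2 setT (fun x => s * coord j x * complex.Re (phi x)).
  apply: eq_rintegrable (schwartz_integrable scoord).1 => x.
  by rewrite ReM/= mul0r subr0.
have i4 : rintegrable mu2 setT (fun x => s * coord j x * complex.Im (phi x)).
  apply: eq_rintegrable (schwartz_integrable scoord).2 => x.
  by rewrite ImM/= mul0r addr0.
have H (c a k : R * R -> R) : rintegrable mu2 setT (fun x => k x * (c x * a x)) ->
    rintegrable mu2 setT (fun x => c x * k x * a x).
  by apply: eq_rintegrable => x; ring.
have HN (c a k : R * R -> R) : rintegrable mu2 setT (fun x => k x * (c x * a x)) ->
    rintegrable mu2 setT (fun x => c x * - k x * a x).
  move=> /(rintegrableZl (- 1) measurableT).
  by apply: eq_rintegrable => x; ring.
rewrite /cpartial eR eI e5 e6 e1 e2 e3 e4 /fs /cint; congr Complex.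
  rewrite -RintegralB//.
  - by apply: eq_Rintegral => x _; rewrite !ReM !ImM/=; ring.
  - by apply: HN; exact: (ic _ _ i3).2.
  - by apply: H; exact: (ic _ _ i4).1.
rewrite -RintegralD//.
- by apply: eq_Rintegral => x _; rewrite !ImM !ReM/=; ring.
- by apply: HN; exact: (ic _ _ i4).2.
- by apply: H; exact: (ic _ _ i3).1.
Qed.

End fourier_calculus.

(** * Transforms of Schwartz functions and of Gaussians *)

Section schwartz_transform.
Context {R : realType}.
Implicit Types (phi psi f g : R * R -> R[i]) (x xi : R * R) (j : bool) (s : R).
Local Notation mu1 := (@lebesgue_measure R).
Local Notation mu2 := (plane_measure R).

(** Integration by parts: the integral of the partial derivative of [cis (s * dotp x xi) * phi x]
    vanishes. *)
Lemma fs_cpartial s phi j xi : schwartz phi ->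
  fs s (cpartial j phi) xi = - (0 +i* (s * coord j xi)) * fs s phi xi.
Proof.
move=> sphi; have sd := schwartz_cpartial j sphi.
have := cint_cpartial j (schwartz_slowM (slow_cis_dotp s xi) sphi).
have -> : cpartial j (fun x => cis (s * dotp x xi) * phi x) =
    fun x => (0 +i* (s * coord j xi)) * (cis (s * dotp x xi) * phi x) +
             cis (s * dotp x xi) * cpartial j phi x.
  apply/funext => x; have [d1 e1] := cpartial_cis_dotp s xi x j.
  by rewrite (cpartialM j d1 (schwartz_cdiff x sphi)).2 e1 mulrA.
have i1 := fs_integrand_integrable s xi (schwartz_integrable sphi).
have i2 := fs_integrand_integrable s xi (schwartz_integrable sd).
rewrite cintD//; last exact: cintegrableZ.
rewrite cintZ// => /eqP; rewrite addrC addr_eq0 => /eqP.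
by rewrite -mulNr.
Qed.

(** A factor [coord j xi] is traded for a derivative of [phi], so the induction on the number of
    powers must range over all Schwartz functions; [enorm xi] is at most the sum of the two
    coordinates in modulus. *)
Lemma decay_fs s phi : s != 0 -> schwartz phi -> decay (fs s phi).
Proof.
move=> s0 sphi N; elim: N phi sphi => [|N IH] phi sphi.
  exists (2 * Rintegral mu2 setT (fun x => cmod (phi x))) => xi.
  by rewrite mul1r fs_bound//; exact: schwartz_integrable.
have [K HK] := IH _ sphi.
have [K1 HK1] := IH _ (schwartz_cpartial false sphi).
have [K2 HK2] := IH _ (schwartz_cpartial true sphi).
exists (K + `|s|^-1 * (K1 + K2)) => xi.
have bnd j : `|coord j xi| * cmod (fs s phi xi) =
    `|s|^-1 * cmod (fs s (cpartial j phi) xi).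
  rewrite fs_cpartial// cmodM cmodN cmodE/= expr0n/= add0r sqrtr_sqr normrM.
  by rewrite -mulrA mulKf// normr_eq0.
have h3 := HK xi; have h4 := HK1 xi; have h5 := HK2 xi.
suff H (A B1 B2 : R) : `|coord false xi| * A = `|s|^-1 * B1 ->
    `|coord true xi| * A = `|s|^-1 * B2 -> 0 <= A ->
    (1 + enorm xi) ^+ N * A <= K -> (1 + enorm xi) ^+ N * B1 <= K1 ->
    (1 + enorm xi) ^+ N * B2 <= K2 ->
    (1 + enorm xi) ^+ N.+1 * A <= K + `|s|^-1 * (K1 + K2).
  exact: H (bnd false) (bnd true) (cmod_ge0 _) h3 h4 h5.
move=> {bnd h3 h4 h5} h1 h2 A0 h3 h4 h5.
have hA : (1 + enorm xi) * A <= A + `|s|^-1 * (B1 + B2).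
  rewrite [`|s|^-1 * _]mulrDr -h1 -h2 mulrDl mul1r lerD2l -mulrDl.
  by apply: ler_wpM2r => //; exact: enorm_le.
rewrite exprSr -mulrA.
apply: le_trans (ler_wpM2l (ltW (enorm1_exp_gt0 xi N)) hA) _.
rewrite mulrDr; apply: lerD => //; rewrite mulrCA; apply: ler_wpM2l.
  by rewrite invr_ge0.
by rewrite mulrDr; apply: lerD.
Qed.

Lemma schwartz_fs s phi : s != 0 -> schwartz phi -> schwartz (fs s phi).
Proof.
move=> s0 sphi.
apply: (@schwartz_coind _ [set h | exists2 f, schwartz f & h = fs s f]).
- by move=> _ [f sf ->] x; exact: (cpartial_fs s true x sf).1.
- by move=> _ [f sf ->]; exact: decay_fs.
- move=> _ j [f sf ->]; exists (fun x => (0 +i* (s * coord j x)) * f x).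
    apply: schwartz_slowM => //; rewrite (_ : (fun x => _) = fun x =>
      (0 +i* s) * (coord j x)%:C).
      by apply: slowM; [exact: slow_cst|exact: slow_coord].
    by apply/funext => x; apply: complex_ext; rewrite ?ReM ?ImM/=; ring.
  by apply/funext => xi; exact: (cpartial_fs s j xi sf).2.
- by exists phi.
Qed.

(** Fubini's theorem for the kernel [cis (s * dotp x xi)], which is symmetric in [x] and [xi]. It
    serves for inversion, for distributional transforms, for the convolution formula and for the
    measurability of transforms. *)
Lemma fs_swap s f g : cintegrable mu2 setT f -> cintegrable mu2 setT g ->
  [/\ cintegrable mu2 setT (fun xi => f xi * fs s g xi),
      cintegrable mu2 setT (fun x => fs s f x * g x) &
      cint mu2 setT (fun xi => f xi * fs s g xi) =
      cint mu2 setT (fun x => fs s f x * g x)].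
Proof.
move=> fi gi.
pose F (z : (R * R) * (R * R)) := f z.1 * (cis (s * dotp z.2 z.1) * g z.2).
have mf := cintegrable_cmeasurable fi; have mg := cintegrable_cmeasurable gi.
have mF : cmeasurable_on setT F.
  have [mf1 mf2] := mf; have [mg1 mg2] := mg.
  apply: cmeasurable_onM.
    by split; [exact: (measurableT_comp mf1 measurable_fst)|
               exact: (measurableT_comp mf2 measurable_fst)].
  apply: cmeasurable_onM; last first.
    by split; [exact: (measurableT_comp mg1 measurable_snd)|
               exact: (measurableT_comp mg2 measurable_snd)].
  apply: cmeasurable_cis; apply: measurable_funM => //.
  apply: measurable_funD; apply: measurable_funM.
  - exact: (measurableT_comp measurable_fst measurable_snd).
  - exact: (measurableT_comp measurable_fst measurable_fst).
  - exact: (measurableT_comp measurable_snd measurable_snd).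
  - exact: (measurableT_comp measurable_snd measurable_fst).
have iF : cintegrable (planes_measure R) setT F.
  have h := @rintegrable_prodM _ _ _ _ R (plane_sf R) (plane_sf R)
    (fun x => cmod (f x)) (fun x => cmod (g x))
    (cintegrable_cmod measurableT fi) (cintegrable_cmod measurableT gi).
  apply: (@cintegrable_dominated _ _ _ (planes_measure R) setT F _ measurableT mF _ h).
  by move=> z _; rewrite /F cmodM cmod_cisM.
have [i1 e1] := cint_fubini_l iF; have [i2 e2] := cint_fubini_r iF.
have E1 xi : cint mu2 setT (fun x => F (xi, x)) = f xi * fs s g xi.
  by rewrite /fs -cintZ//; exact: fs_integrand_integrable.
have E2 x : cint mu2 setT (fun xi => F (xi, x)) = fs s f x * g x.
  rewrite mulrC -cintZ//; last exact: fs_integrand_integrable.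
  by apply: eq_cint => xi _; rewrite /F/= dotpC; ring.
have F1 : (fun xi => cint mu2 setT (fun x => F (xi, x))) =
  (fun xi => f xi * fs s g xi) by apply/funext => xi; rewrite E1.
have F2 : (fun x => cint mu2 setT (fun xi => F (xi, x))) =
  (fun x => fs s f x * g x) by apply/funext => x; rewrite E2.
split.
- by rewrite -F1; exact: i1.
- by rewrite -F2; exact: i2.
- by rewrite -F1 -F2; exact: (etrans e1 (esym e2)).
Qed.

(** Measurability is read off from Fubini's theorem: the product of the transform with a Gaussian is
    integrable, hence measurable, and the Gaussian is divided out. *)
Lemma fs_measurable s f : cintegrable mu2 setT f -> cmeasurable_on setT (fs s f).
Proof.
move=> fi; have sG := schwartz_gaussian (@ltr01 R).
have [_ h _] := fs_swap s fi (schwartz_integrable sG).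
have m1 := cintegrable_cmeasurable h.
have m2 : cmeasurable_on setT (fun x => (gaussian (- 1) x)%:C : R[i]).
  by apply: cmeasurable_on_real; exact: gaussian_measurable.
have := cmeasurable_onM m1 m2; congr (cmeasurable_on _ _); apply/funext => x.
rewrite -mulrA -rmorphM /gaussian -expRD.
rewrite (_ : _ + _ = 0) ?expR0 ?mulr1//; ring.
Qed.

Lemma zero_partial_cst (F : R * R -> R) :
  (forall x, differentiable F x) -> (forall x j, 'D_(basis j) F x = 0) ->
  forall x, F x = F (0, 0).
Proof.
move=> dF F0 [a b].
have h1 : F (a, b) = F (0, b).
  have D (t : R) : is_derive t (1 : R) (fun t => F (t, b)) ((fun=> 0) t).
    by have := @partial_slice _ F (t, b) false (dF _); rewrite F0.
  have := @MVT_bound _ _ _ 0 0 a D; rewrite normr0 mul0r add0r.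
  by move=> /(_ (fun _ _ => lexx _)); rewrite normr_le0 subr_eq0 => /eqP.
rewrite h1.
have D (t : R) : is_derive t (1 : R) (fun t => F (0, t)) ((fun=> 0) t).
  by have := @partial_slice _ F (0, t) true (dF _); rewrite F0.
have := @MVT_bound _ _ _ 0 0 b D; rewrite normr0 mul0r add0r.
by move=> /(_ (fun _ _ => lexx _)); rewrite normr_le0 subr_eq0 => /eqP.
Qed.

Lemma integral_gaussian_line (c m : R) : 0 < c ->
  rintegrable mu1 setT (fun t => expR (- (c * (t - m) ^+ 2))) /\
  Rintegral mu1 setT (fun t => expR (- (c * (t - m) ^+ 2))) = Num.sqrt (pi / c).
Proof.
(* The standard deviation for which the normal density with mean [m] is proportional to
   [exp (- c (t - m)^2)]. *)
move=> c0; pose sg := Num.sqrt (2 * c)^-1.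
have c2 : 0 < (2 * c)^-1 by rewrite invr_gt0 mulr_gt0.
have sg0 : sg != 0 by rewrite gt_eqF// sqrtr_gt0.
have sg2 : sg ^+ 2 = (2 * c)^-1 by rewrite sqr_sqrtr// ltW.
have E : (fun t : R => expR (- (c * (t - m) ^+ 2))) =
    fun t => Num.sqrt (pi / c) * normal_pdf m sg t.
  apply/funext => t; rewrite normal_pdfE// /normal_fun /normal_peak sg2.
  have -> : (2 * c)^-1 * pi *+ 2 = pi / c :> R.
    by rewrite -mulr_natl; field; rewrite gt_eqF.
  rewrite mulVKf; last by rewrite gt_eqF// sqrtr_gt0 divr_gt0// pi_gt0.
  congr expR; rewrite -mulr_natl; field; rewrite gt_eqF//.
have iN : rintegrable mu1 setT (normal_pdf m sg) := integrable_normal_pdf m sg.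
split.
  apply: eq_rintegrable (@rintegrableZl _ _ _ mu1 setT (Num.sqrt (pi / c)) _
    measurableT iN) => t.
  by have /(congr1 (fun h => h t)) := E.
rewrite E (@RintegralZl _ _ _ mu1 setT _ _ measurableT iN).
by rewrite /Rintegral integral_normal_pdf mulr1.
Qed.

Lemma integral_gaussian (c : R) x : 0 < c ->
  rintegrable mu2 setT (fun y => gaussian c (y - x)) /\
  Rintegral mu2 setT (fun y => gaussian c (y - x)) = pi / c.
Proof.
move=> c0; have [i1 e1] := integral_gaussian_line x.1 c0.
have [i2 e2] := integral_gaussian_line x.2 c0.
have E : (fun y => gaussian c (y - x)) =
    (fun y => expR (- (c * (y.1 - x.1) ^+ 2)) * expR (- (c * (y.2 - x.2) ^+ 2))).
  by apply/funext => y; rewrite /gaussian -expRD -opprD -mulrDr.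
have i := rintegrable_prodM i1 i2.
split.
  by apply: eq_rintegrable i => y; have /(congr1 (fun h => h y)) := E.
rewrite E -(Rintegral_fubini_l i).2/=.
under eq_Rintegral do rewrite RintegralZl// e2.
by rewrite RintegralZr// e1 -expr2 sqr_sqrtr// divr_ge0 ?pi_ge0// ltW.
Qed.

(** Since [coord j x] times a Gaussian is a multiple of its partial derivative, the transform
    satisfies the differential equations of a Gaussian: multiplied by the inverse of the expected
    one, it has zero partial derivatives. The constant is the Gaussian integral, found at the
    origin. No contour is shifted. *)
Lemma fs_gaussian s (c : R) xi : 0 < c ->
  fs s (fun x => (gaussian c x)%:C) xi =
  (pi / c * gaussian (s ^+ 2 / (4 * c)) xi)%:C.
Proof.
move=> c0; pose g x : R[i] := (gaussian c x)%:C.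
have sg : schwartz g by exact: schwartz_gaussian.
pose k := s ^+ 2 / (4 * c); pose e x : R[i] := (gaussian (- k) x)%:C.
have D x j : cdiff (fun y => fs s g y * e y) x /\
    cpartial j (fun y => fs s g y * e y) x = 0.
  have [d1 e1] := cpartial_fs s j x sg; have [d2 e2] := cpartial_gaussian (- k) x j.
  have [d3 e3] := cpartialM j d1 d2; split=> //; rewrite e3 e2 e1.
  have -> : (fun x => (0 +i* (s * coord j x)) * g x) =
      (fun x => (0 +i* (- (s / (2 * c)))) * cpartial j g x).
    apply/funext => y; rewrite (cpartial_gaussian c y j).2.
    apply: complex_ext; rewrite ?ReM ?ImM/= ?ReM ?ImM/=; field; rewrite gt_eqF//.
  have -> : fs s (fun x => (0 +i* (- (s / (2 * c)))) * cpartial j g x) x =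
      (0 +i* (- (s / (2 * c)))) * fs s (cpartial j g) x.
    rewrite /fs -cintZ//.
      by apply: eq_cint => y _; rewrite mulrCA.
    exact/fs_integrand_integrable/schwartz_integrable/schwartz_cpartial.
  rewrite fs_cpartial// -/(e x); move: (fs s g x) (e x) => [a b] [a' b'].
  rewrite /k; apply: complex_ext; rewrite ?ReD ?ImD ?ReM ?ImM/= ?ReM ?ImM/=;
    field; rewrite gt_eqF//.
have cst x : fs s g x * e x = fs s g (0, 0) * e (0, 0).
  apply: complex_ext.
    apply: (@zero_partial_cst (fun y => complex.Re (fs s g y * e y))) => [y|y j].
      exact: (D y true).1.1.
    by have := (D y j).2; rewrite /cpartial => /(congr1 (@complex.Re R)).
  apply: (@zero_partial_cst (fun y => complex.Im (fs s g y * e y))) => [y|y j].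
    exact: (D y true).1.2.
  by have := (D y j).2; rewrite /cpartial => /(congr1 (@complex.Im R)).
have eK x : e x * (gaussian k x)%:C = 1.
  by rewrite -rmorphM /gaussian -expRD mulNr opprK addrN expR0.
have e00 : e (0, 0) = 1.
  by rewrite /e /gaussian /= expr0n/= addr0 mulr0 oppr0 expR0.
have F0 : fs s g (0, 0) = (pi / c)%:C.
  have [_ i0] := integral_gaussian 0 c0.
  have E : (fun x => cis (s * dotp x (0, 0)) * g x) = g.
    apply/funext => x; rewrite (_ : s * _ = 0) ?cis0 ?mul1r//.
    by rewrite /dotp /=; ring.
  rewrite /fs E /cint -i0; congr Complex.
    by apply: eq_Rintegral => x _; rewrite /= subr0.
  by rewrite Rintegral_cst// mul0r.
have -> : (pi / c * gaussian (s ^+ 2 / (4 * c)) xi)%:C =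
  (pi / c)%:C * (gaussian k xi)%:C :> R[i] by exact: rmorphM.
by rewrite -F0 -[LHS]mulr1 -(eK xi) mulrA cst e00 mulr1.
Qed.

End schwartz_transform.

(** * Fourier inversion *)

Section fourier_inversion.
Context {R : realType}.
Implicit Types (phi psi f g : R * R -> R[i]) (x y xi : R * R) (j : bool) (s : R).
Local Notation mu2 := (plane_measure R).

Lemma lipschitz_partial (F : R * R -> R) (L : R) :
  (forall x, differentiable F x) -> (forall x j, `|'D_(basis j) F x| <= L) ->
  forall x y, `|F y - F x| <= L * (`|(y - x).1| + `|(y - x).2|).
Proof.
move=> dF FL [a b] [u v] /=.
have h1 := @MVT_bound R (fun t => F (t, v)) (fun t => 'D_(basis false) F (t, v)) L a (u - a)
  (fun t => @partial_slice _ F (t, v) false (dF _)) (fun _ _ => FL _ _).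
have h2 := @MVT_bound R (fun t => F (a, t)) (fun t => 'D_(basis true) F (a, t)) L b (v - b)
  (fun t => @partial_slice _ F (a, t) true (dF _)) (fun _ _ => FL _ _).
move: h1 h2; rewrite /= ![_ + (_ - _)]addrC !subrK => h1 h2.
rewrite (_ : F (u, v) - _ = (F (u, v) - F (a, v)) + (F (a, v) - F (a, b))); last by ring.
by rewrite (le_trans (ler_normD _ _))// mulrDr lerD.
Qed.

Lemma schwartz_lipschitz phi : schwartz phi -> exists L, forall x y,
  `|complex.Re (phi y) - complex.Re (phi x)| <= L * (`|(y - x).1| + `|(y - x).2|) /\
  `|complex.Im (phi y) - complex.Im (phi x)| <= L * (`|(y - x).1| + `|(y - x).2|).
Proof.
move=> sphi.
have [K1 h1] := schwartz_decay (schwartz_cpartial false sphi) 0.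
have [K2 h2] := schwartz_decay (schwartz_cpartial true sphi) 0.
have hK x j : cmod (cpartial j phi x) <= Num.max K1 K2.
  rewrite le_max; case: j; [have := h2 x|have := h1 x];
  by rewrite mul1r => ->; rewrite ?orbT.
exists (Num.max K1 K2) => x y; split.
  apply: (@lipschitz_partial (fun z => complex.Re (phi z))) => [z|z j].
    exact: (schwartz_cdiff z sphi).1.
  exact: le_trans (le_Re_cmod (cpartial j phi z)) (hK z j).
apply: (@lipschitz_partial (fun z => complex.Im (phi z))) => [z|z j].
  exact: (schwartz_cdiff z sphi).2.
exact: le_trans (le_Im_cmod (cpartial j phi z)) (hK z j).
Qed.

Lemma gaussian_shift_measurable (c : R) x :
  measurable_fun setT (fun y => gaussian c (y - x)).
Proof.
apply: (measurableT_comp (gaussian_measurable c)); apply: measurable_fun_pair.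
  by apply: measurable_funB => //; exact: measurable_fst.
by apply: measurable_funB => //; exact: measurable_snd.
Qed.

(** The kernel [m^2 / pi * gaussian (m^2)] has mass 1, so the error is at most [L] times its first
    absolute moment. By [key] each coordinate costs [1 / m] times the Gaussian of parameter
    [m^2 / 2], whose mass is [2 pi / m^2]; the two coordinates together give [4 L / m]. *)
Lemma gaussian_approximation (F : R * R -> R) (L m K : R) x : 0 < m ->
  measurable_fun setT F -> (forall y, `|F y| <= K) ->
  (forall y, `|F y - F x| <= L * (`|(y - x).1| + `|(y - x).2|)) ->
  rintegrable mu2 setT (fun y => gaussian (m ^+ 2) (y - x) * F y) /\
  `|m ^+ 2 / pi * Rintegral mu2 setT (fun y => gaussian (m ^+ 2) (y - x) * F y)
    - F x| <= 4 * L / m.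
Proof.
move=> m0 mF FK FL.
have m2 : 0 < m ^+ 2 by rewrite exprn_gt0.
have m22 : 0 < m ^+ 2 / 2 by rewrite divr_gt0.
have [i1 e1] := integral_gaussian x m2; have [i2 e2] := integral_gaussian x m22.
pose k y := gaussian (m ^+ 2) (y - x).
have mk : measurable_fun setT k by exact: gaussian_shift_measurable.
have k0 y : 0 <= k y by exact/ltW/gaussian_gt0.
have L0 : 0 <= L.
  have := le_trans (normr_ge0 _) (FL (1 + x.1, x.2)).
  by rewrite /= addrK subrr normr1 normr0 addr0 mulr1.
have kF : rintegrable mu2 setT (fun y => k y * F y).
  apply: (plane_dominated _ (g := fun y => K * k y)).
  - exact: measurable_funM.
  - by move=> y; rewrite normrM (ger0_norm (k0 y)) mulrC ler_wpM2r.
  - exact: rintegrableZl.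
split; first exact: kF.
have E : m ^+ 2 / pi * Rintegral mu2 setT (fun y => k y * F y) - F x =
    m ^+ 2 / pi * Rintegral mu2 setT (fun y => k y * F y - k y * F x).
  rewrite RintegralB//; last exact: rintegrableZr.
  rewrite RintegralZr// e1; move: (Rintegral _ _ _) (F x) => I0 F0.
  have := pi_gt0 R; move: (pi : R) => p p0.
  by field; rewrite !gt_eqF.
(* Half of the exponent pays for the factor [|t|]: [m |t| <= 1 + m^2 t^2 / 2 <= exp (m^2 t^2 /
   2)]. *)
have key t : `|t| * expR (- (m ^+ 2 * t ^+ 2)) <=
    m^-1 * expR (- (m ^+ 2 / 2 * t ^+ 2)).
  rewrite ler_pdivlMl// mulrA.
  have -> : expR (- (m ^+ 2 * t ^+ 2)) =
      (expR (m ^+ 2 / 2 * t ^+ 2))^-1 * expR (- (m ^+ 2 / 2 * t ^+ 2)).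
    by rewrite -expRN -expRD; congr expR; field.
  rewrite mulrA ler_piMl ?expR_ge0// ler_pdivrMr ?expR_gt0// mul1r.
  apply: le_trans (expR_ge1Dx _).
  have : 0 <= (m * `|t| - 1) ^+ 2 by exact: sqr_ge0.
  have : `|t| ^+ 2 = t ^+ 2 by rewrite real_normK ?num_real.
  by move: `|t| => a <-; nra.
have half t : expR (- (m ^+ 2 * t ^+ 2)) <= expR (- (m ^+ 2 / 2 * t ^+ 2)).
  rewrite ler_expR lerN2 ler_wpM2r ?sqr_ge0//; lra.
have bnd y : `|k y * F y - k y * F x| <=
    L * (2 * m^-1) * gaussian (m ^+ 2 / 2) (y - x).
  rewrite -mulrBr normrM (ger0_norm (k0 y)) mulrC.
  apply: le_trans (ler_wpM2r (k0 y) (FL y)) _.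
  rewrite -[leLHS]mulrA -[leRHS]mulrA ler_wpM2l// /k /gaussian.
  move: (y - x) => [a b] /=.
  rewrite !mulrDr !opprD !expRD.
  have h1 := key a; have h2 := key b; have h3 := half a; have h4 := half b.
  have := expR_ge0 (- (m ^+ 2 * a ^+ 2)); have := expR_ge0 (- (m ^+ 2 * b ^+ 2)).
  have : 0 <= m^-1 by rewrite invr_ge0 ltW.
  move: h1 h2 h3 h4.
  move: (expR (- (m ^+ 2 * a ^+ 2))) (expR (- (m ^+ 2 / 2 * a ^+ 2)))
    (expR (- (m ^+ 2 * b ^+ 2))) (expR (- (m ^+ 2 / 2 * b ^+ 2))) => A A' B B'.
  move: (m^-1) (normr_ge0 a) (normr_ge0 b) => i; move: `|a| `|b| => u v.
  move=> u0 v0 h1 h2 h3 h4 i0 b0 a0.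
  have p1 : u * A * B <= i * A' * B' by rewrite ler_pM// mulr_ge0.
  have p2 : v * B * A <= i * B' * A' by rewrite ler_pM// mulr_ge0.
  by have := lerD p1 p2; congr (_ <= _); ring.
rewrite E normrM ger0_norm; last by rewrite divr_ge0 ?pi_ge0// ltW.
have iG := rintegrableZl (L * (2 * m^-1)) measurableT i2.
have mB : measurable_fun setT (fun y => k y * F y - k y * F x).
  by apply: measurable_funB; apply: measurable_funM.
have := @le_norm_Rintegral _ _ _ mu2 setT _ _ measurableT mB iG (fun y _ => bnd y).
rewrite (RintegralZl _ measurableT i2) e2 => /(ler_wpM2l (_ : 0 <= m ^+ 2 / pi)) h.
apply: le_trans (h _) _; first by rewrite divr_ge0 ?pi_ge0// ltW.
rewrite le_eqVlt; apply/orP; left; apply/eqP.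
have := pi_gt0 R; move: (pi : R) => p p0.
by field; rewrite !gt_eqF.
Qed.

(** A Gaussian cutoff lets [fs_swap] move the transform from [phi] to a modulated Gaussian, whose
    transform is a Gaussian concentrating at [x]. As the cutoff tends to 1, one side tends to the
    double transform by dominated convergence and the other to a multiple of [phi x]. *)
Lemma fs_inversion s phi x : s ^+ 2 = 1 -> schwartz phi ->
  fs (- s) (fs s phi) x = ((2 * pi) ^+ 2)%:C * phi x.
Proof.
move=> s2 sphi; have s0 : s != 0.
  by apply/eqP => s0; move: s2; rewrite s0 expr0n/= => /eqP; rewrite eq_sym oner_eq0.
have sF := schwartz_fs s0 sphi.
pose m (n : nat) : R := n.+1%:R; have m0 n : 0 < m n by [].
(* Chosen so that the transform of [gaussian (c n)] is a multiple of [gaussian (m n ^+ 2)]. The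
   factor is [pi / c n = 4 pi m^2] and the mass of the Gaussian is [pi / m^2], whence the constant
   [(2 pi)^2]. *)
pose c n := (4 * m n ^+ 2)^-1.
have c0 n : 0 < c n by rewrite invr_gt0 mulr_gt0// exprn_gt0.
pose h n xi : R[i] := cis (- s * dotp xi x) * (gaussian (c n) xi)%:C.
have sh n : schwartz (h n).
  by apply: schwartz_slowM; [exact: slow_cis_dotp|exact: schwartz_gaussian].
have step n : cint mu2 setT (fun xi => h n xi * fs s phi xi) =
    cint mu2 setT (fun y => (4 * pi * m n ^+ 2 * gaussian (m n ^+ 2) (y - x))%:C * phi y).
  have [_ _ ->] := fs_swap s (schwartz_integrable (sh n)) (schwartz_integrable sphi).
  apply: eq_cint => y _; congr (_ * _).
  have -> : fs s (h n) y = fs s (fun xi => (gaussian (c n) xi)%:C) (y - x).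
    apply: eq_cint => xi _; rewrite mulrA -cisD; congr (cis _ * _).
    by rewrite /dotp/=; ring.
  rewrite fs_gaussian//; congr (_ %:C).
  have -> : s ^+ 2 / (4 * c n) = m n ^+ 2.
    by rewrite s2 /c; field; rewrite gt_eqF.
  by rewrite /c; field; rewrite gt_eqF.
have [L HL] := schwartz_lipschitz sphi.
have [K HK] := schwartz_decay sphi 0.
have [mR mI] := schwartz_measurable sphi.
have KR y : `|complex.Re (phi y)| <= K.
  by have := HK y; rewrite mul1r; apply: le_trans; exact: le_Re_cmod.
have KI y : `|complex.Im (phi y)| <= K.
  by have := HK y; rewrite mul1r; apply: le_trans; exact: le_Im_cmod.
have gR n := gaussian_approximation (m0 n) mR KR (fun y => (HL x y).1).
have gI n := gaussian_approximation (m0 n) mI KI (fun y => (HL x y).2).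
have lim (u : nat -> R) (l : R) : (forall n, `|m n ^+ 2 / pi * u n - l| <= 4 * L / m n) ->
    (4 * pi * m n ^+ 2) * u n @[n --> \oo] --> (2 * pi) ^+ 2 * l.
  move=> H.
  have hv : m n ^+ 2 / pi * u n @[n --> \oo] --> l.
    apply/cvgrPdist_le => e e0; near=> n; rewrite distrC.
    apply: le_trans (H n) _; rewrite ler_pdivrMr// -ler_pdivrMl//.
    apply: (le_trans (ltW (truncnS_gt _))); rewrite /m ler_nat ltnS; near: n.
    exact: nbhs_infty_ge.
  have : (2 * pi) ^+ 2 * (m n ^+ 2 / pi * u n) @[n --> \oo] --> (2 * pi) ^+ 2 * l.
    by apply: cvgM; [exact: cvg_cst|exact: hv].
  rewrite (_ : (fun n => (2 * pi) ^+ 2 * _) = fun n => (4 * pi * m n ^+ 2) * u n)//.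
  apply/funext => n; have := pi_gt0 R; move: (pi : R) => p p0.
  by field; rewrite gt_eqF.
have iF := schwartz_integrable sF.
have i0 := fs_integrand_integrable (- s) x iF.
have mh n : cmeasurable_on setT (fun xi => h n xi * fs s phi xi).
  by apply: cmeasurable_onM; apply: schwartz_measurable.
have gc xi : gaussian (c n) xi @[n --> \oo] --> (1 : R).
  have -> : 1 = expR (- (0 * (xi.1 ^+ 2 + xi.2 ^+ 2))) :> R by rewrite mul0r oppr0 expR0.
  apply: (cvg_comp (fun n => - (c n * (xi.1 ^+ 2 + xi.2 ^+ 2))) expR); last first.
    exact: continuous_expR.
  apply: cvgN; apply: cvgM; last exact: cvg_cst.
  apply/cvgr0Pnorm_le => e e0; near=> n; rewrite gtr0_norm//.
  have me : e^-1 <= m n.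
    apply: (le_trans (ltW (truncnS_gt _))); rewrite /m ler_nat ltnS; near: n.
    exact: nbhs_infty_ge.
  rewrite /c invf_ple ?posrE ?mulr_gt0 ?exprn_gt0//; apply: (le_trans me).
  by have : 1 <= m n by [rewrite ler1n]; move: (m n) => r; nra.
have limG (G : R * R -> R) : rintegrable mu2 setT G ->
    Rintegral mu2 setT (fun xi => gaussian (c n) xi * G xi) @[n --> \oo] -->
    Rintegral mu2 setT G.
  move=> iG; have mG := rintegrable_measurable iG.
  have mfn n : measurable_fun setT (fun xi => gaussian (c n) xi * G xi).
    by apply: measurable_funM => //; exact: gaussian_measurable.
  have [||_ _] := @Rintegral_dominated _ _ _ mu2 setT
    (fun n xi => gaussian (c n) xi * G xi) G (fun xi => `|G xi|) measurableT
    mfn mG _ (rintegrable_norm measurableT iG); last by [].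
  - apply: nearW => xi _; rewrite -[X in _ --> X]mul1r.
    by apply: cvgM; [exact: gc|exact: cvg_cst].
  - apply: nearW => xi _ n; rewrite normrM ler_piMl// gtr0_norm ?gaussian_gt0//.
    rewrite /gaussian -expR0 ler_expR oppr_le0 mulr_ge0 ?(ltW (c0 n))//.
    by rewrite addr_ge0// sqr_ge0.
have [iR iI] := i0.
have hE n xi : h n xi * fs s phi xi =
    (gaussian (c n) xi)%:C * (cis (- s * dotp xi x) * fs s phi xi).
  by rewrite /h; ring.
apply: complex_ext.
  have l1 := limG _ iR.
  have l2 := lim _ _ (fun n => (gR n).2).
  rewrite ReM /= mul0r subr0.
  apply: (cvg_unique (@Rhausdorff R) l1); apply: cvg_trans l2.
  apply: near_eq_cvg; near=> n.
  rewrite -RintegralZl//; last exact: (gR n).1.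
  transitivity (complex.Re (cint mu2 setT (fun xi => h n xi * fs s phi xi))).
    rewrite step; apply: eq_Rintegral => y _.
    by rewrite ReM /= mul0r subr0 mulrA.
  apply: eq_Rintegral => xi _; rewrite hE.
  by rewrite ReM /= mul0r subr0.
have l1 := limG _ iI.
have l2 := lim _ _ (fun n => (gI n).2).
rewrite ImM /= mul0r addr0.
apply: (cvg_unique (@Rhausdorff R) l1); apply: cvg_trans l2.
apply: near_eq_cvg; near=> n.
rewrite -RintegralZl//; last exact: (gI n).1.
transitivity (complex.Im (cint mu2 setT (fun xi => h n xi * fs s phi xi))).
  rewrite step; apply: eq_Rintegral => y _.
  by rewrite ImM /= mul0r addr0 mulrA.
apply: eq_Rintegral => xi _; rewrite hE.
by rewrite ImM /= mul0r addr0.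
Unshelve. all: by end_near. Qed.

Lemma sqr_2pi_neq0 : (2 * pi) ^+ 2 != 0 :> R.
Proof. by rewrite expf_neq0// mulf_neq0// gt_eqF// pi_gt0. Qed.

Lemma ifourierK phi : schwartz phi -> fourier (ifourier phi) = phi.
Proof.
move=> sphi; apply/funext => x; rewrite fourierE ifourierE /fs.
have i := schwartz_integrable (schwartz_fs (oner_neq0 R) sphi).
transitivity ((((2 * pi) ^+ 2)^-1)%:C * fs (- 1) (fs 1 phi) x).
  rewrite {2}/fs -cintZ//; last exact: fs_integrand_integrable.
  by apply: eq_cint => y _; rewrite mulrCA.
rewrite fs_inversion ?expr1n// mulrA -rmorphM mulVf ?mul1r//.
exact: sqr_2pi_neq0.
Qed.

Lemma fourierK phi : schwartz phi -> ifourier (fourier phi) = phi.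
Proof.
move=> sphi; rewrite fourierE ifourierE; apply/funext => x.
have := @fs_inversion (- 1) phi x; rewrite opprK sqrrN expr1n => -> //.
rewrite mulrA -rmorphM mulVf ?mul1r//.
exact: sqr_2pi_neq0.
Qed.

Lemma schwartz_fourier phi : schwartz phi -> schwartz (fourier phi).
Proof. by move=> sphi; rewrite fourierE; apply: schwartz_fs => //; rewrite oppr_eq0 oner_eq0. Qed.

Lemma schwartz_ifourier phi : schwartz phi -> schwartz (ifourier phi).
Proof.
move=> sphi; rewrite ifourierE; apply: schwartzZ.
by apply: schwartz_fs => //; rewrite oner_eq0.
Qed.

End fourier_inversion.

Lemma integral_norm_le0 d (T : measurableType d) (R : realType)
    (mu : {measure set T -> \bar R}) (f : T -> R) : measurable_fun setT f ->
  (\int[mu]_x (`|f x|)%:E <= 0)%E -> {ae mu, forall x, f x = 0}.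
Proof.
move=> mf f0; have mf' : measurable_fun setT (EFin \o f) by exact/measurable_EFinP.
have : (\int[mu]_x `|(EFin \o f) x| = 0)%E.
  by apply/eqP; rewrite eq_le integral_ge0// andbT.
move=> /(ae_eq_integral_abs mu measurableT mf').
by apply: filterS => x /= /(_ Logic.I)[].
Qed.

Section plane_almost_everywhere.
Context {R : realType}.

#[local] Instance plane_ae_filter : Filter (almost_everywhere (plane_measure R)).
Proof. exact: ae_filter_ringOfSetsType. Qed.

Lemma plane_ae_impl (P Q : R * R -> Prop) : (forall x, P x -> Q x) ->
  {ae plane_measure R, forall x, P x} -> {ae plane_measure R, forall x, Q x}.
Proof. by move=> PQ; apply: filterS. Qed.

Lemma plane_ae_impl2 (P Q S : R * R -> Prop) : (forall x, P x -> Q x -> S x) ->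
  {ae plane_measure R, forall x, P x} -> {ae plane_measure R, forall x, Q x} ->
  {ae plane_measure R, forall x, S x}.
Proof. by move=> PQ; apply: filterS2. Qed.

End plane_almost_everywhere.

(** * Distributions represented by functions *)

Section representation.
Context {R : realType}.
Implicit Types (phi psi f g : R * R -> R[i]) (x xi : R * R) (j : bool) (s : R).
Implicit Types (S T : dist R).
Local Notation mu2 := (plane_measure R).

Lemma annihilator_real (g : R * R -> R) : measurable_fun setT g ->
  rintegrable mu2 setT (fun x => g x * gaussian 1 x) ->
  (forall p q p' q', Rintegral mu2 setT (fun x => g x * test_function p q p' q' x) = 0) ->
  {ae mu2, forall x, g x = 0}.
Proof.
move=> mg ig g0.
have m0 : measurable_fun setT (fun _ : R * R => 0 : R) by exact: measurable_cst.
have i0 : rintegrable mu2 setT (fun x : R * R => 0 * gaussian 1 x).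
  by apply: (eq_rintegrable _ (rintegrableZl 0 measurableT ig)) => x; rewrite !mul0r.
have mid : measurable_fun setT (@id (R * R)) by exact: measurable_id.
have m1 : measurable_fun setT (fun _ : R * R => 1 : R) by exact: measurable_cst.
have := @duality_bound R _ _ mu2 id (fun=> 0) g (fun=> 1) mid m0 mg m1
  (fun _ => ler01) ig i0.
have e p q p' q' : Rintegral mu2 setT (fun x => g x * test_function p q p' q' x) =
    Rintegral mu2 setT (fun z : R * R => 0 * test_function p q p' q' (id z)).
  rewrite g0 -[LHS](mul0r (fine (mu2 setT))) -Rintegral_cst//.
  by apply: eq_Rintegral => x _; rewrite mul0r.
move=> /(_ e).
have -> : (\int[mu2]_z (`|0 : R| * 1)%:E = 0)%E.
  by under eq_integral do rewrite normr0 mul0r; rewrite integral0.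
under eq_integral do rewrite mulr1.
exact: integral_norm_le0.
Qed.

Lemma annihilator_ae_eq0 g : cmeasurable_on setT g ->
  (forall phi, schwartz phi -> cintegrable mu2 setT (fun x => g x * phi x) /\
     cint mu2 setT (fun x => g x * phi x) = 0) ->
  {ae mu2, forall x, g x = 0}.
Proof.
move=> [m1 m2] H.
have [[i1 i2] _] := H _ (schwartz_gaussian (@ltr01 R)).
have hR : {ae mu2, forall x, complex.Re (g x) = 0}.
  apply: annihilator_real => //.
    by apply: eq_rintegrable i1 => x; rewrite ReM/= mulr0 subr0.
  move=> p q p' q'; have [_] := H _ (schwartz_test_function p q p' q').
  move=> /(congr1 (@complex.Re R)) /= h; rewrite -[RHS]h.
  by apply: eq_Rintegral => x _; rewrite ReM/= mulr0 subr0.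
have hI : {ae mu2, forall x, complex.Im (g x) = 0}.
  apply: annihilator_real => //.
    by apply: eq_rintegrable i2 => x; rewrite ImM/= mulr0 add0r.
  move=> p q p' q'; have [_] := H _ (schwartz_test_function p q p' q').
  move=> /(congr1 (@complex.Im R)) /= h; rewrite -[RHS]h.
  by apply: eq_Rintegral => x _; rewrite ImM/= mulr0 add0r.
by apply: plane_ae_impl2 hR hI => x h1 h2; exact: complex_ext.
Qed.

Lemma represents_ae_eq T f g : represents T f -> represents T g ->
  {ae mu2, forall x, f x = g x}.
Proof.
move=> [mf [fi fE]] [mg [gi gE]].
have h phi : schwartz phi ->
    cintegrable mu2 setT (fun x => (f x + (- 1) * g x) * phi x) /\
    cint mu2 setT (fun x => (f x + (- 1) * g x) * phi x) = 0.
  move=> sphi.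
  have -> : (fun x => (f x + (- 1) * g x) * phi x) =
      (fun x => f x * phi x + (- 1) * (g x * phi x)).
    by apply/funext => x; ring.
  have i1 := fi _ sphi; have i2 := cintegrableZ (- 1) measurableT (gi _ sphi).
  split; first exact: cintegrableD.
  rewrite cintD// cintZ//; last exact: gi.
  have := fE _ sphi; rewrite (gE _ sphi) /dist_of => ->; ring.
have m : cmeasurable_on setT (fun x => f x + (- 1) * g x).
  apply: cmeasurable_onD; first exact: mf.
  by apply: cmeasurable_onM; [exact: cmeasurable_on_cst|exact: mg].
apply: plane_ae_impl (annihilator_ae_eq0 m h) => x /eqP.
by rewrite mulN1r subr_eq0 => /eqP.
Qed.

Lemma represents_fun_of T f : represents T f -> represents T (fun_of T).
Proof. by move=> h; apply: (@xgetPex _ (fun=> 0) [set g | represents T g]); exists f. Qed.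

Lemma fun_of_ae T f : represents T f -> {ae mu2, forall x, fun_of T x = f x}.
Proof. by move=> h; exact: represents_ae_eq (represents_fun_of h) h. Qed.

Lemma fun_of_not_function T : ~ is_function T -> fun_of T = fun=> 0.
Proof.
by move=> nT; apply: xgetPN => g hg; apply: nT; exists g.
Qed.

Lemma fhat_spec T : is_function (dfourier T) -> represents (dfourier T) (fhat T).
Proof. by move=> [g]; exact: represents_fun_of. Qed.

(** Thanks to the default value 0 of [fun_of], this holds for every functional, in particular for
    the nonlinearity at any time. *)
Lemma fhat_measurable T : cmeasurable_on setT (fhat T).
Proof.
have [/fhat_spec[]//|h] := pselect (is_function (dfourier T)).
by rewrite /fhat fun_of_not_function//; exact: cmeasurable_on_cst.
Qed.

Lemma fhat_schwartz_integrable T phi : schwartz phi ->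
  cintegrable mu2 setT (fun x => fhat T x * phi x).
Proof.
move=> sphi; have [/fhat_spec[_ [h _]]|h] := pselect (is_function (dfourier T)).
  exact: h.
rewrite /fhat fun_of_not_function//.
have := cintegrableZ 0 measurableT (schwartz_integrable sphi).
by congr (cintegrable _ _ _).
Qed.

Lemma cpartials_bounded f (K : R) phi : cmeasurable_on setT f ->
  (forall x, cmod (f x) <= K) -> schwartz phi ->
  cintegrable mu2 setT (fun x => f x * phi x).
Proof.
move=> mf fK sphi; have iphi := schwartz_integrable sphi.
apply: (cplane_dominated (g := fun x => K * cmod (phi x))).
- by apply: cmeasurable_onM => //; exact: schwartz_measurable.
- by move=> x; rewrite cmodM ler_wpM2r// cmod_ge0.
- exact/rintegrableZl/cintegrable_cmod.
Qed.

Lemma ifourier_measurable f : cintegrable mu2 setT f ->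
  cmeasurable_on setT (ifourier f).
Proof.
move=> fi; rewrite ifourierE; apply: cmeasurable_onM.
  exact: cmeasurable_on_cst.
exact: fs_measurable.
Qed.

Lemma ifourier_bounded f : cintegrable mu2 setT f ->
  exists K, forall x, cmod (ifourier f x) <= K.
Proof.
move=> fi; exists (`|((2 * pi) ^+ 2)^-1| *
  (2 * Rintegral mu2 setT (fun x => cmod (f x)))) => x.
by rewrite ifourierE cmodM cmod_real ler_wpM2l// fs_bound.
Qed.

Lemma represents_difourier f : cintegrable mu2 setT f ->
  represents (difourier (dist_of f)) (ifourier f).
Proof.
move=> fi; have mf := ifourier_measurable fi; have [K HK] := ifourier_bounded fi.
split; first exact: mf; split.
  by move=> phi sphi; exact: cpartials_bounded HK sphi.
move=> phi sphi; rewrite /difourier /dist_of !ifourierE.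
set c := (_ %:C).
have [i1 i2 e] := fs_swap 1 fi (schwartz_integrable sphi).
transitivity (c * cint mu2 setT (fun xi => f xi * fs 1 phi xi)).
  by rewrite -cintZ//; apply: eq_cint => x _; rewrite mulrCA.
rewrite e -cintZ//; apply: eq_cint => x _; exact: mulrA.
Qed.

Lemma deq_represents S T f : deq S T -> represents T f -> represents S f.
Proof.
move=> ST [mf [fi fE]]; split=> //; split=> // phi sphi.
by rewrite ST// fE.
Qed.

(** [dmul] multiplies functions, so a distribution with integrable transform has to be identified
    with the function that the inversion formula gives. *)
Lemma represents_of_fhat T : is_function (dfourier T) ->
  cintegrable mu2 setT (fhat T) -> represents T (ifourier (fhat T)).
Proof.
move=> hT fi; apply: deq_represents (represents_difourier fi) => phi sphi.
have [_ [_ h]] := fhat_spec hT.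
have := h _ (schwartz_ifourier sphi); rewrite /dfourier ifourierK// => ->.
Qed.

Lemma fhat_difourier f : cmeasurable_on setT f ->
  (forall phi, schwartz phi -> cintegrable mu2 setT (fun x => f x * phi x)) ->
  represents (dfourier (difourier (dist_of f))) f.
Proof.
move=> mf fi; split; first exact: mf; split=> // phi sphi.
by rewrite /dfourier /difourier fourierK.
Qed.

Lemma fhat_dsub S T : is_function (dfourier S) -> is_function (dfourier T) ->
  {ae mu2, forall x, fhat (dsub S T) x = fhat S x - fhat T x}.
Proof.
move=> /fhat_spec[m1 [i1 e1]] /fhat_spec[m2 [i2 e2]].
apply: fun_of_ae; split.
  apply: (cmeasurable_onD m1 (g := fun x => - fhat T x)).
  under eq_fun do rewrite -mulN1r.
  by apply: cmeasurable_onM => //; exact: cmeasurable_on_cst.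
have E phi : (fun x => (fhat S x - fhat T x) * phi x) =
    (fun x => fhat S x * phi x + (- 1) * (fhat T x * phi x)).
  by apply/funext => x; ring.
split=> phi sphi.
  rewrite E; apply: cintegrableD => //; first exact: i1.
  by apply: cintegrableZ => //; exact: i2.
rewrite /dist_of E cintD//; [|exact: i1|by apply: cintegrableZ => //; exact: i2].
rewrite cintZ//; last exact: i2.
by rewrite mulN1r /dfourier /dsub -/(dfourier S phi) -/(dfourier T phi) e1// e2.
Qed.

End representation.

(** * Weights and the norms of X^sigma *)

Section weights.
Context {R : realType}.
Implicit Types (x xi : R * R) (sg : R) (T : dist R).
Local Notation mu2 := (plane_measure R).

(* The weight |xi|^sg, with a positive value at the origin, where the library's
   power of 0 is 0 for a negative exponent. *)
Definition weight sg xi : R := if xi == 0 then 1 else enorm xi `^ sg.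

Lemma enorm_gt0 xi : xi != 0 -> 0 < enorm xi.
Proof.
move=> xi0; rewrite sqrtr_gt0 lt0r addr_ge0 ?sqr_ge0// andbT.
apply: contra xi0 => /eqP; case: xi => a b /= h.
by apply/eqP; congr pair; apply/eqP; rewrite -sqrf_eq0; apply/eqP;
  have := sqr_ge0 a; have := sqr_ge0 b; lra.
Qed.

Lemma enorm0 : enorm (0 : R * R) = 0.
Proof. by rewrite /enorm /= expr0n addr0 sqrtr0. Qed.

Lemma weight_gt0 sg xi : 0 < weight sg xi.
Proof.
rewrite /weight; case: ifPn => // xi0.
by rewrite powR_gt0// enorm_gt0.
Qed.

Lemma weight_ge0 sg xi : 0 <= weight sg xi.
Proof. exact/ltW/weight_gt0. Qed.

Lemma measurable_origin : measurable ([set 0] : set (R * R)).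
Proof.
rewrite (_ : [set 0] = [set 0] `*` [set 0]); first exact: measurableX.
by apply/seteqP; split=> [[a b] [-> ->]//|[a b] /= [-> ->]].
Qed.

Lemma weight_measurable sg : measurable_fun setT (weight sg).
Proof.
apply: measurable_fun_ifT.
- apply: (measurable_fun_bool true); rewrite setTI.
  rewrite (_ : _ @^-1` _ = [set 0]); first exact: measurable_origin.
  by apply/seteqP; split => x /= /eqP.
- exact: measurable_cst.
- by exact: (measurableT_comp (@measurable_powR R sg) (@enorm_measurable R)).
Qed.

Lemma plane_ae_neq0 : {ae mu2, forall xi, xi != 0}.
Proof.
exists [set 0]; split; first exact: measurable_origin.
  rewrite (_ : [set 0] = [set 0] `*` [set 0]); last first.
    by apply/seteqP; split=> [[a b] [-> ->]//|[a b] /= [-> ->]].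
  rewrite product_measure1E//; apply/eqP; rewrite mule_eq0; apply/orP; left.
  by apply/eqP; exact: lebesgue_measure_set1.
by move=> x /= /negP; rewrite negbK => /eqP.
Qed.

Lemma Xnorm_weight sg T g : cmeasurable_on setT g ->
  {ae mu2, forall xi, fhat T xi = g xi} ->
  Xnorm sg T = (\int[mu2]_xi (weight sg xi * cmod (g xi))%:E)%E.
Proof.
move=> mg Tg.
have m1 : measurable_fun setT (fun xi => (enorm xi `^ sg * cmod (fhat T xi))%:E).
  apply/measurable_EFinP; apply: measurable_funM.
    by exact: (measurableT_comp (@measurable_powR R sg) (@enorm_measurable R)).
  by apply: cmeasurable_cmod => //; exact: fhat_measurable.
have m2 : measurable_fun setT (fun xi => (weight sg xi * cmod (g xi))%:E).
  apply/measurable_EFinP; apply: measurable_funM; first exact: weight_measurable.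
  exact: cmeasurable_cmod.
apply: (@ae_eq_integral _ _ _ mu2 setT _ _ measurableT m1 m2).
by apply: plane_ae_impl2 plane_ae_neq0 Tg => x x0 -> _; rewrite /weight (negbTE x0).
Qed.

Lemma Xnorm_fhat sg T :
  Xnorm sg T = (\int[mu2]_xi (weight sg xi * cmod (fhat T xi))%:E)%E.
Proof.
apply: Xnorm_weight; first exact: fhat_measurable.
by apply: plane_ae_impl plane_ae_neq0.
Qed.

Lemma weight_fhat_integrable sg T : (Xnorm sg T < +oo)%E ->
  rintegrable mu2 setT (fun xi => weight sg xi * cmod (fhat T xi)).
Proof.
rewrite Xnorm_fhat => h; apply/integrableP; split.
  apply/measurable_EFinP; apply: measurable_funM; first exact: weight_measurable.
  by apply: cmeasurable_cmod => //; exact: fhat_measurable.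
under eq_integral do rewrite gee0_abs ?lee_fin ?mulr_ge0 ?weight_ge0 ?cmod_ge0//.
exact: h.
Qed.

(** The nonpositive power controls low frequencies and the first power high ones, so membership in
    both X^sg and X^1 makes the transform integrable. *)
Lemma weight_sum_ge1 sg xi : sg <= 0 -> 1 <= weight sg xi + weight 1 xi.
Proof.
move=> sg0; rewrite /weight; case: ifPn => xi0; first by lra.
have e0 := enorm_gt0 xi0; rewrite powRr1; last exact: ltW.
have p0 := powR_ge0 (enorm xi) sg.
have [e1|e1] := leP 1 (enorm xi); first by lra.
have : 1 <= enorm xi `^ sg.
  by rewrite -(powRr0 (enorm xi)) ger_powR// e0 ltW.
lra.
Qed.

Lemma fhat_integrable sg T : sg <= 0 -> (Xnorm sg T < +oo)%E ->
  (Xnorm 1 T < +oo)%E -> cintegrable mu2 setT (fhat T).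
Proof.
move=> sg0 /weight_fhat_integrable h1 /weight_fhat_integrable h2.
apply: (cplane_dominated _ _ (rintegrableD measurableT h1 h2)).
  exact: fhat_measurable.
move=> xi; rewrite -mulrDl ler_peMl ?cmod_ge0//; exact: weight_sum_ge1.
Qed.

Lemma enormD_le x xi : enorm (x + xi) <= enorm x + enorm xi.
Proof.
rewrite -ler_sqr ?nnegrE ?addr_ge0 ?enorm_ge0// sqrrD !sqr_enorm.
have cs : x.1 * xi.1 + x.2 * xi.2 <= enorm x * enorm xi.
  apply: le_trans (ler_norm _) _; rewrite -ler_sqr ?nnegrE ?mulr_ge0 ?enorm_ge0//.
  rewrite real_normK ?num_real// exprMn !sqr_enorm.
  have : 0 <= (x.1 * xi.2 - x.2 * xi.1) ^+ 2 by exact: sqr_ge0.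
  by rewrite -subr_ge0; congr (0 <= _); ring.
rewrite /=; move: cs; rewrite -mulr_natl; lra.
Qed.

(* Since 0 <= 1 + sg < 1 and sg < 0, the larger of the two frequencies carries
   one derivative and the smaller one the negative power. *)
Lemma weight_product sg x xi : -1 <= sg < 0 ->
  enorm (x + xi) * weight sg (x + xi) <=
  2 * (weight sg x * weight 1 xi + weight sg xi * weight 1 x).
Proof.
move=> /andP[sg1 sg0].
wlog: x xi / enorm x <= enorm xi.
  move=> H; have [|/ltW] := leP (enorm x) (enorm xi); first exact: H.
  by move=> /H; rewrite addrC [weight sg xi * _ + _]addrC.
move=> xxi.
have pos := weight_ge0.
have [xi0|xi0] := eqVneq xi 0.
  have x0 : x = 0.
    apply/eqP; apply: contraT => /enorm_gt0; rewrite ltNge.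
    by rewrite (le_trans xxi)// xi0 enorm0.
  rewrite x0 xi0 addr0 enorm0 mul0r !mulr_ge0 ?addr_ge0 ?mulr_ge0 ?weight_ge0//.
have e0 := enorm_gt0 xi0.
have [xxi0|xxi0] := eqVneq (x + xi) 0.
  rewrite xxi0 enorm0 mul0r mulr_ge0 ?addr_ge0 ?mulr_ge0 ?weight_ge0//.
have f0 := enorm_gt0 xxi0.
have mulpow a : 0 < a -> a * a `^ sg = a `^ (1 + sg).
  move=> a0; rewrite [RHS]powRD; last by rewrite (gt_eqF a0) implybT.
  by rewrite powRr1// ltW.
have sgS : 0 <= 1 + sg by lra.
(* [enorm (x + xi) <= 2 * enorm xi] is raised to the power [1 + sg], which lies between 0 and 1;
   hence [2 ^ (1 + sg)] is at most 2. *)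
have step : enorm (x + xi) * weight sg (x + xi) <= 2 * (enorm xi * enorm xi `^ sg).
  rewrite /weight (negbTE xxi0) !mulpow//.
  apply: (@le_trans _ _ ((2 * enorm xi) `^ (1 + sg))).
    apply: ge0_ler_powR; rewrite ?nnegrE ?mulr_ge0 ?enorm_ge0//.
    by apply: le_trans (enormD_le _ _) _; lra.
  rewrite powRM// ?enorm_ge0// ler_wpM2r ?powR_ge0//.
  by rewrite -[leRHS]powRr1// ler_powR//; lra.
apply: (le_trans step); rewrite ler_wpM2l//.
have wxi : weight 1 xi = enorm xi by rewrite /weight (negbTE xi0) powRr1// ltW.
have wsxi : weight sg xi = enorm xi `^ sg by rewrite /weight (negbTE xi0).
rewrite wxi wsxi; have [x0|x0] := eqVneq x 0.
  (* With both weights equal to 1 at the origin, what remains is [r * r^sg <= r + r^sg] for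
     [r = enorm xi]: one of the two factors is at most 1. *)
  rewrite x0 /weight eqxx !mul1r mulr1.
  have p0 := powR_ge0 (enorm xi) sg.
  have [e1|e1] := leP 1 (enorm xi); last by nra.
  have : enorm xi `^ sg <= 1.
    by rewrite -(powRr0 (enorm xi)) ler_powR// ltW.
  by nra.
rewrite /weight (negbTE x0) -[leLHS]addr0 lerD//; last first.
  by rewrite mulr_ge0// powR_ge0.
rewrite mulrC ler_wpM2r//; first exact: ltW.
have x0' := enorm_gt0 x0.
rewrite -[sg]opprK ![_ `^ - - _]powRN lef_pV2 ?posrE ?powR_gt0//.
by apply: ge0_ler_powR; rewrite ?nnegrE ?enorm_ge0//; lra.
Qed.

End weights.

(** * The nonlinear estimate *)

Section bilinear.
Context {R : realType}.
Implicit Types (f h phi psi chi : R * R -> R[i]) (x xi : R * R) (T : dist R).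
Local Notation mu2 := (plane_measure R).
Local Notation mu4 := (planes_measure R).

Definition fourier_constant : R := ((2 * pi) ^+ 2)^-1.

Lemma fourier_constant_gt0 : 0 < fourier_constant.
Proof. by rewrite invr_gt0 exprn_gt0// mulr_gt0// pi_gt0. Qed.

Lemma cmod0 : cmod (0 : R[i]) = 0.
Proof. by rewrite cmodE/= expr0n addr0 sqrtr0. Qed.

Lemma Xnorm_ge0 (s : R) T : (0 <= Xnorm s T)%E.
Proof.
by apply: integral_ge0 => x _; rewrite lee_fin mulr_ge0 ?powR_ge0 ?cmod_ge0.
Qed.

Lemma fs_translate s g xi eta : cintegrable mu2 setT g ->
  fs s (fun x => cis (s * dotp x xi) * g x) eta = fs s g (xi + eta).
Proof.
move=> ig; apply: eq_cint => x _; rewrite mulrA -cisD; congr (cis _ * _).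
by rewrite dotpDr; ring.
Qed.

Lemma sum_coordinates_measurable :
  measurable_fun setT (fun p : (R * R) * (R * R) => p.1 + p.2).
Proof.
apply: measurable_fun_pair; apply: measurable_funD.
- exact: (measurableT_comp measurable_fst measurable_fst).
- exact: (measurableT_comp measurable_fst measurable_snd).
- exact: (measurableT_comp measurable_snd measurable_fst).
- exact: (measurableT_comp measurable_snd measurable_snd).
Qed.

Lemma cmeasurable_comp d1 d2 (T1 : measurableType d1) (T2 : measurableType d2)
    (g : T2 -> R[i]) (k : T1 -> T2) : cmeasurable_on setT g ->
  measurable_fun setT k -> cmeasurable_on setT (fun t => g (k t)).
Proof.
by move=> [m1 m2] mk; split; [exact: (measurableT_comp m1 mk)|exact: (measurableT_comp m2 mk)].
Qed.

Lemma bilinear_integrable f h (k : (R * R) * (R * R) -> R[i]) (K : R) :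
  cintegrable mu2 setT f -> cintegrable mu2 setT h ->
  cmeasurable_on setT k -> (forall p, cmod (k p) <= K) ->
  cintegrable mu4 setT (fun p => f p.1 * (h p.2 * k p)).
Proof.
move=> fi hi mk kK.
have mf := cintegrable_cmeasurable fi; have mh := cintegrable_cmeasurable hi.
have i := @rintegrable_prodM _ _ _ _ R (plane_sf R) (plane_sf R)
  (fun x => cmod (f x)) (fun x => cmod (h x))
  (cintegrable_cmod measurableT fi) (cintegrable_cmod measurableT hi).
have m : cmeasurable_on setT (fun p : (R * R) * (R * R) => f p.1 * (h p.2 * k p)).
  apply: cmeasurable_onM; first exact: (cmeasurable_comp mf measurable_fst).
  by apply: cmeasurable_onM => //; exact: (cmeasurable_comp mh measurable_snd).
apply: (@cintegrable_dominated _ _ _ mu4 setT _ _ measurableT m _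
  (rintegrableZl K measurableT i)) => p _.
by rewrite !cmodM [leLHS]mulrA [leRHS]mulrC ler_wpM2l ?mulr_ge0 ?cmod_ge0.
Qed.

(** The convolution theorem in weak form. The convolution of [f] and [h] appears only as the density
    [f p.1 * h p.2] pushed forward by addition, and this is the form in which
    [complex_duality_bound] takes it. *)
Lemma cint_product_fourier f h chi : cintegrable mu2 setT f ->
  cintegrable mu2 setT h -> schwartz chi ->
  cint mu2 setT (fun x => (ifourier f x * ifourier h x) * fourier chi x) =
  fourier_constant%:C *
    cint mu4 setT (fun p => f p.1 * (h p.2 * chi (p.1 + p.2))).
Proof.
move=> fi hi schi; set c := fourier_constant.
have c0 : c != 0 by rewrite gt_eqF// fourier_constant_gt0.
have sX := schwartz_fourier schi; have [K HK] := ifourier_bounded hi.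
have mV := ifourier_measurable hi.
pose X := fourier chi; pose V := ifourier h.
have iVX : cintegrable mu2 setT (fun x => V x * X x) by exact: cpartials_bounded HK sX.
have [i1 i2 e1] := fs_swap 1 fi iVX.
have inner xi : fs 1 (fun x => V x * X x) xi = cint mu2 setT (fun eta => h eta * chi (xi + eta)).
  have sg : schwartz (fun x => cis (1 * dotp x xi) * X x).
    by apply: schwartz_slowM => //; exact: slow_cis_dotp.
  have [j1 j2 e2] := fs_swap 1 hi (schwartz_integrable sg).
  transitivity (c%:C * cint mu2 setT (fun x => fs 1 h x * (cis (1 * dotp x xi) * X x))).
    rewrite -(cintZ c%:C measurableT j2); apply: eq_cint => x _.
    rewrite /V ifourierE -/fourier_constant -/c; ring.
  rewrite -e2 -(cintZ c%:C measurableT j1); apply: eq_cint => eta _.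
  rewrite fs_translate; last exact: schwartz_integrable.
  have := fourierK schi => /(congr1 (fun g => g (xi + eta))) <-.
  by rewrite ifourierE -/fourier_constant -/c -/X; ring.
transitivity (c%:C * cint mu2 setT (fun x => fs 1 f x * (V x * X x))).
  rewrite -cintZ//; apply: eq_cint => x _.
  by rewrite -/X -/V ifourierE -/fourier_constant -/c; ring.
rewrite -e1; congr (_ * _).
have [Kc HKc] := schwartz_decay schi 0.
have mk : cmeasurable_on setT (fun p : (R * R) * (R * R) => chi (p.1 + p.2)).
  exact: (cmeasurable_comp (schwartz_measurable schi) sum_coordinates_measurable).
have iP := bilinear_integrable (K := Kc) fi hi mk
  ltac:(by move=> p; have := HKc (p.1 + p.2); rewrite mul1r).
have [_ <-] := cint_fubini_l iP.
apply: eq_cint => xi _; rewrite inner -cintZ//.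
have mk' : cmeasurable_on setT (fun eta => chi (xi + eta)).
  apply: (cmeasurable_comp (schwartz_measurable schi)).
  by apply: measurable_fun_pair; apply: measurable_funD.
apply: (cplane_dominated (g := fun eta => Kc * cmod (h eta))).
- by apply: cmeasurable_onM => //; exact: cintegrable_cmeasurable hi.
- move=> eta; rewrite cmodM mulrC ler_wpM2r ?cmod_ge0//.
  by have := HKc (xi + eta); rewrite mul1r.
- exact/rintegrableZl/cintegrable_cmod.
Qed.


(** Indexed by the component of the velocity, on which the derivative of the same index falls; the
    velocity is a rotated gradient, hence the crossed index of [riesz_symbol]. *)
Definition velocity_symbol (j : bool) xi : R[i] :=
  if j then - riesz_symbol false xi else riesz_symbol true xi.

Lemma cmod_velocity_symbol j xi : cmod (velocity_symbol j xi) <= 1.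
Proof.
have H k : cmod (riesz_symbol k xi) <= 1.
  rewrite cmodE/= expr0n/= add0r sqrtr_sqr normrM.
  rewrite (ger0_norm (powR_ge0 _ _)) /laplacian_symbol.
  rewrite (_ : 2 * - 2^-1 = - 1); last by rewrite mulrN divff.
  have [->|xi0] := eqVneq xi 0.
    by rewrite enorm0 powR0 ?mulr0// oppr_eq0 oner_eq0.
  rewrite powR_inv1 ?enorm_ge0// ler_pdivrMr ?enorm_gt0// mul1r.
  exact: coord_le_enorm.
by rewrite /velocity_symbol; case: j; rewrite ?cmodN.
Qed.

Lemma velocity_symbol_measurable j : cmeasurable_on setT (velocity_symbol j).
Proof.
have m k : measurable_fun setT (fun xi : R * R =>
    coord k xi * laplacian_symbol (- 2^-1) xi).
  apply: measurable_funM; first exact: coord_measurable.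
  exact: (measurableT_comp (@measurable_powR R _) (@enorm_measurable R)).
have H k : cmeasurable_on setT (riesz_symbol k : R * R -> R[i]).
  by split; [exact: measurable_cst|exact: m].
case: j; last exact: H.
rewrite (_ : velocity_symbol true = fun xi => (- 1) * riesz_symbol false xi).
  by apply: cmeasurable_onM => //; exact: cmeasurable_on_cst.
by apply/funext => xi; rewrite mulN1r.
Qed.

(** The push-forward of [kappa] under [pr] is not assumed to be a function: agreement with [g] on
    Schwartz functions is enough. The test functions are real, so they bound the real and imaginary
    parts of [g] separately, whence the factor 2. *)
Lemma complex_duality_bound d (Z : measurableType d)
    (nu : {measure set Z -> \bar R}) (pr : Z -> R * R) (kappa : Z -> R[i])
    (g : R * R -> R[i]) (w : R * R -> R) :
  measurable_fun setT pr -> cmeasurable_on setT kappa ->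
  cmeasurable_on setT g -> measurable_fun setT w -> (forall x, 0 <= w x) ->
  (forall phi, schwartz phi ->
     [/\ cintegrable mu2 setT (fun x => g x * phi x),
         cintegrable nu setT (fun z => kappa z * phi (pr z)) &
         cint mu2 setT (fun x => g x * phi x) =
         cint nu setT (fun z => kappa z * phi (pr z))]) ->
  (\int[mu2]_x (w x * cmod (g x))%:E <=
   2%:E * \int[nu]_z (cmod (kappa z) * w (pr z))%:E)%E.
Proof.
move=> mpr mk mg mw w0 H.
have ReZ (a : R[i]) (r : R) : complex.Re (a * r%:C) = complex.Re a * r.
  by rewrite ReM /= mulr0 subr0.
have ImZ (a : R[i]) (r : R) : complex.Im (a * r%:C) = complex.Im a * r.
  by rewrite ImM /= mulr0 add0r.
have mwp : measurable_fun setT (w \o pr) by exact: measurableT_comp.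
have mkw (u : Z -> R) : measurable_fun setT u ->
    measurable_fun setT (fun z => (`|u z| * w (pr z))%:E).
  by move=> mu; apply/measurable_EFinP/measurable_funM => //; exact: measurableT_comp.
have mgw (u : R * R -> R) : measurable_fun setT u ->
    measurable_fun setT (fun z => (`|u z| * w z)%:E).
  by move=> mu; apply/measurable_EFinP/measurable_funM => //; exact: measurableT_comp.
have mcw : measurable_fun setT (fun z => (cmod (kappa z) * w (pr z))%:E).
  by apply/measurable_EFinP/measurable_funM => //; exact: cmeasurable_cmod.
have [[gr gi] [kr ki]] := (mg, mk).
have test p q p' q' := H _ (schwartz_test_function p q p' q').
have [[i1 i2] [i3 i4] _] := H _ (schwartz_gaussian (@ltr01 R)).
have bnd (u : Z -> R) (a : R * R -> R) : measurable_fun setT u ->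
    measurable_fun setT a -> (forall z, `|u z| <= cmod (kappa z)) ->
    rintegrable mu2 setT (fun x => a x * gaussian 1 x) ->
    rintegrable nu setT (fun z => u z * gaussian 1 (pr z)) ->
    (forall p q p' q', Rintegral mu2 setT (fun x => a x * test_function p q p' q' x) =
      Rintegral nu setT (fun z => u z * test_function p q p' q' (pr z))) ->
    (\int[mu2]_x (`|a x| * w x)%:E <= \int[nu]_z (cmod (kappa z) * w (pr z))%:E)%E.
  move=> mu ma ua j1 j2 e.
  apply: le_trans (duality_bound mpr mu ma mw w0 j1 j2 e) _.
  apply: ge0_le_integral => //.
  - by move=> z _; rewrite lee_fin mulr_ge0.
  - exact: mkw.
  - by move=> z _; rewrite lee_fin ler_wpM2r.
have b1 : (\int[mu2]_x (`|complex.Re (g x)| * w x)%:E <=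
    \int[nu]_z (cmod (kappa z) * w (pr z))%:E)%E.
  apply: (bnd (fun z => complex.Re (kappa z))) => //.
  - by move=> z; exact: le_Re_cmod.
  - by move: i1; under eq_fun do rewrite ReZ.
  - by move: i3; under eq_fun do rewrite ReZ.
  - move=> p q p' q'; have [_ _ /(congr1 (@complex.Re R))/=] := test p q p' q'.
    by congr (_ = _); apply: eq_Rintegral => x _; rewrite ReZ.
have b2 : (\int[mu2]_x (`|complex.Im (g x)| * w x)%:E <=
    \int[nu]_z (cmod (kappa z) * w (pr z))%:E)%E.
  apply: (bnd (fun z => complex.Im (kappa z))) => //.
  - by move=> z; exact: le_Im_cmod.
  - by move: i2; under eq_fun do rewrite ImZ.
  - by move: i4; under eq_fun do rewrite ImZ.
  - move=> p q p' q'; have [_ _ /(congr1 (@complex.Im R))/=] := test p q p' q'.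
    by congr (_ = _); apply: eq_Rintegral => x _; rewrite ImZ.
rewrite [leRHS](_ : _ = \int[nu]_z (cmod (kappa z) * w (pr z))%:E +
   \int[nu]_z (cmod (kappa z) * w (pr z))%:E)%E; last first.
  by rewrite mule_natl mule2n.
apply: le_trans (leeD b1 b2); rewrite -ge0_integralD//.
- apply: ge0_le_integral => //.
  + by move=> x _; rewrite lee_fin mulr_ge0// cmod_ge0.
  + apply/measurable_EFinP/measurable_funM => //; exact: cmeasurable_cmod.
  + by apply: emeasurable_funD; exact: mgw.
  + move=> x _; rewrite -EFinD lee_fin -mulrDl mulrC ler_wpM2r//.
    exact: cmod_le_ReIm.
- by move=> x _; rewrite lee_fin mulr_ge0.
- exact: mgw.
- by move=> x _; rewrite lee_fin mulr_ge0.
- exact: mgw.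
Qed.

Section nonlinear_estimate.
Variables (sg : R) (T : dist R).
Hypothesis sg_range : -1 <= sg < 0.
Hypothesis T1 : Xspace sg T.
Hypothesis T2 : Xspace 1 T.

Let f := fhat T.

Let fi : cintegrable mu2 setT f.
Proof.
have [_ _ n1] := T1; have [_ _ n2] := T2; have /andP[_ /ltW s0] := sg_range.
exact: fhat_integrable s0 n1 n2.
Qed.

Let h j xi : R[i] := velocity_symbol j xi * f xi.

Let hi j : cintegrable mu2 setT (h j).
Proof.
apply: (cplane_dominated (g := fun x => cmod (f x))).
- apply: cmeasurable_onM; first exact: velocity_symbol_measurable.
  exact: cintegrable_cmeasurable fi.
- move=> x; rewrite cmodM ler_piMl ?cmod_ge0//; exact: cmod_velocity_symbol.
- exact: cintegrable_cmod.
Qed.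

(** The density on pairs of frequencies whose push-forward under addition is the transform of the
    nonlinearity. The factors [0 +i* coord j (p.1 + p.2)] are the symbols of the derivatives in the
    divergence, taken at the total frequency. *)
Let kernel (p : (R * R) * (R * R)) : R[i] := fourier_constant%:C *
  (f p.1 * ((0 +i* coord false (p.1 + p.2)) * h false p.2 +
            (0 +i* coord true (p.1 + p.2)) * h true p.2)).

Let velocity j := if j then velocity2 T else velocity1 T.

Let fun_of_velocity j : {ae mu2, forall x, fun_of (velocity j) x = ifourier (h j) x}.
Proof.
have H : represents (difourier (dist_of (h j))) (ifourier (h j)).
  exact: represents_difourier.
by case: j H; exact: fun_of_ae.
Qed.

Let fun_of_T : {ae mu2, forall x, fun_of T x = ifourier f x}.
Proof. by apply: fun_of_ae; apply: represents_of_fhat => //; case: T1. Qed.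

Let fun_of_measurable (S : dist R) : cmeasurable_on setT (fun_of S).
Proof.
have [[g /represents_fun_of[]//]|nS] := pselect (is_function S).
by rewrite fun_of_not_function//; exact: cmeasurable_on_cst.
Qed.

Let product_velocity j phi : schwartz phi ->
  dmul T (velocity j) phi =
  cint mu2 setT (fun x => (ifourier f x * ifourier (h j) x) * phi x).
Proof.
move=> sphi; rewrite /dmul /dist_of.
have mphi := schwartz_measurable sphi.
have m1 : cmeasurable_on setT (fun x => fun_of T x * fun_of (velocity j) x * phi x).
  by apply: cmeasurable_onM => //; apply: cmeasurable_onM; exact: fun_of_measurable.
have m2 : cmeasurable_on setT (fun x => ifourier f x * ifourier (h j) x * phi x).
  by apply: cmeasurable_onM => //; apply: cmeasurable_onM; exact: ifourier_measurable.
apply: (@cint_ae_eq _ _ _ mu2 setT _ _ measurableT m1 m2).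
by apply: plane_ae_impl2 fun_of_T (fun_of_velocity j) => x -> -> _.
Qed.

Let slow_icoord j : slow (fun x => 0 +i* coord j x : R[i]).
Proof.
rewrite (_ : (fun x => _) = fun x => (0 +i* 1) * (coord j x)%:C).
  by apply: slowM; [exact: slow_cst|exact: slow_coord].
by apply/funext => x; apply: complex_ext; rewrite ?ReM ?ImM/=; ring.
Qed.

Let term_integrable j psi : schwartz psi -> cintegrable mu4 setT
  (fun p => f p.1 * (h j p.2 * ((0 +i* coord j (p.1 + p.2)) * psi (p.1 + p.2)))).
Proof.
move=> spsi; have sc := schwartz_slowM (slow_icoord j) spsi.
have [K HK] := schwartz_decay sc 0.
apply: (@bilinear_integrable f (h j)
  (fun p => (0 +i* coord j (p.1 + p.2)) * psi (p.1 + p.2)) K) => //.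
  exact: (cmeasurable_comp (schwartz_measurable sc) sum_coordinates_measurable).
by move=> p; have := HK (p.1 + p.2); rewrite mul1r.
Qed.

Let kernelE psi p : kernel p * psi (p.1 + p.2) = fourier_constant%:C *
  (f p.1 * (h false p.2 * ((0 +i* coord false (p.1 + p.2)) * psi (p.1 + p.2))) +
   f p.1 * (h true p.2 * ((0 +i* coord true (p.1 + p.2)) * psi (p.1 + p.2)))).
Proof. by rewrite /kernel; ring. Qed.

Let kernel_integrable psi : schwartz psi ->
  cintegrable mu4 setT (fun p => kernel p * psi (p.1 + p.2)).
Proof.
move=> spsi; under eq_fun do rewrite kernelE.
apply: cintegrableZ => //.
exact: (cintegrableD measurableT (term_integrable false spsi) (term_integrable true spsi)).
Qed.

Lemma dfourier_nonlinearity psi : schwartz psi ->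
  dfourier (nonlinearity T) psi =
  cint mu4 setT (fun p => kernel p * psi (p.1 + p.2)).
Proof.
move=> spsi.
have part j : dpartial j (dmul T (velocity j)) (fourier psi) =
    fourier_constant%:C * cint mu4 setT (fun p => f p.1 *
      (h j p.2 * ((0 +i* coord j (p.1 + p.2)) * psi (p.1 + p.2)))).
  have sF := schwartz_fourier spsi.
  rewrite /dpartial product_velocity; last exact: schwartz_cpartial.
  have sc : schwartz (fun x => (0 +i* (- 1 * coord j x)) * psi x).
    have := schwartzZ (- 1) (schwartz_slowM (slow_icoord j) spsi).
    congr schwartz; apply/funext => x; rewrite mulrA; congr (_ * _).
    by apply: complex_ext; rewrite ?ReM ?ImM/=; ring.
  have -> : cpartial j (fourier psi) =
      fourier (fun x => (0 +i* (- 1 * coord j x)) * psi x).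
    by apply/funext => xi; rewrite !fourierE; exact: (cpartial_fs (- 1) j xi spsi).2.
  rewrite (cint_product_fourier fi (hi j) sc) -mulrN; congr (_ * _).
  rewrite -mulN1r -cintZ//; last first.
    have := cintegrableZ (- 1) measurableT (term_integrable j spsi).
    congr (cintegrable _ _ _); apply/funext => p.
    rewrite (_ : 0 +i* (- 1 * coord j (p.1 + p.2)) =
      (- 1) * (0 +i* coord j (p.1 + p.2))); first by ring.
    by apply: complex_ext; rewrite ?ReM ?ImM/=; ring.
  apply: eq_cint => p _.
  rewrite (_ : 0 +i* (- 1 * coord j (p.1 + p.2)) =
    (- 1) * (0 +i* coord j (p.1 + p.2))); first by ring.
  by apply: complex_ext; rewrite ?ReM ?ImM/=; ring.
rewrite /dfourier /nonlinearity.
rewrite -[dmul T (velocity1 T)]/(dmul T (velocity false)).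
rewrite -[dmul T (velocity2 T)]/(dmul T (velocity true)) !part -mulrDr.
rewrite -(cintD measurableT (term_integrable false spsi) (term_integrable true spsi)).
rewrite -cintZ//; last first.
  exact: (cintegrableD measurableT (term_integrable false spsi) (term_integrable true spsi)).
by apply: eq_cint => p _; rewrite kernelE.
Qed.

Let kernel_measurable : cmeasurable_on setT kernel.
Proof.
have mf := cintegrable_cmeasurable fi.
have mc j : cmeasurable_on setT (fun p : (R * R) * (R * R) =>
    (0 +i* coord j (p.1 + p.2)) * h j p.2).
  apply: cmeasurable_onM.
    split; first exact: measurable_cst.
    exact: (measurableT_comp (@coord_measurable R j) sum_coordinates_measurable).
  exact: (cmeasurable_comp (cintegrable_cmeasurable (hi j)) measurable_snd).
apply: cmeasurable_onM; first exact: cmeasurable_on_cst.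
apply: cmeasurable_onM; first exact: (cmeasurable_comp mf measurable_fst).
exact: (cmeasurable_onD (mc false) (mc true)).
Qed.

Let f_ (s : R) x := weight s x * cmod (f x).

(** One factor 2 counts the components of the velocity, the other is the one in [weight_product]. *)
Let kernel_bound p : cmod (kernel p) * weight sg (p.1 + p.2) <=
  4 * fourier_constant * (f_ sg p.1 * f_ 1 p.2 + f_ 1 p.1 * f_ sg p.2).
Proof.
have c0 := ltW fourier_constant_gt0.
have b j : cmod ((0 +i* coord j (p.1 + p.2)) * h j p.2) <=
    enorm (p.1 + p.2) * cmod (f p.2).
  rewrite cmodM ler_pM ?cmod_ge0//; last first.
    rewrite cmodM ler_piMl ?cmod_ge0//; exact: cmod_velocity_symbol.
  rewrite cmodE/= expr0n/= add0r sqrtr_sqr; exact: coord_le_enorm.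
have k1 : cmod (kernel p) <= fourier_constant * (cmod (f p.1) *
    (2 * (enorm (p.1 + p.2) * cmod (f p.2)))).
  rewrite /kernel !cmodM cmod_real (ger0_norm c0) ler_wpM2l// ler_wpM2l ?cmod_ge0//.
  apply: le_trans (cmodD _ _) _; rewrite mulr_natl mulr2n lerD//; exact: b.
apply: le_trans (ler_wpM2r (weight_ge0 _ _) k1) _.
have wp := weight_product p.1 p.2 sg_range.
have q0 : 0 <= 2 * fourier_constant * (cmod (f p.1) * cmod (f p.2)).
  by rewrite !mulr_ge0 ?cmod_ge0.
have := ler_wpM2l q0 wp; rewrite /f_.
move: (enorm _) (weight sg _) (weight sg _) (weight sg _) (weight 1 _) (weight 1 _)
  (cmod _) (cmod _) fourier_constant => a b1 b2 b3 b4 b5 b6 b7 c.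
by congr (_ <= _); ring.
Qed.

(** The 16 is the 4 of [kernel_bound], doubled because its two terms have the same integral, and
    doubled again by [complex_duality_bound]. *)
Lemma nonlinearity_bound : (Xnorm sg (nonlinearity T) <=
  (16 * fourier_constant * (fine (Xnorm sg T) * fine (Xnorm 1 T)))%:E)%E.
Proof.
have [_ _ n1] := T1; have [_ _ n2] := T2.
have i1 := weight_fhat_integrable n1; have i2 := weight_fhat_integrable n2.
have fE s : (Xnorm s T < +oo)%E -> fine (Xnorm s T) = Rintegral mu2 setT (f_ s).
  by move=> _; rewrite Xnorm_fhat.
have prod s s' : (Xnorm s T < +oo)%E -> (Xnorm s' T < +oo)%E ->
    rintegrable mu4 setT (fun p => f_ s p.1 * f_ s' p.2) /\
    Rintegral mu4 setT (fun p => f_ s p.1 * f_ s' p.2) =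
    fine (Xnorm s T) * fine (Xnorm s' T).
  move=> h1 h2; have j1 := weight_fhat_integrable h1; have j2 := weight_fhat_integrable h2.
  have j := @rintegrable_prodM _ _ _ _ R (plane_sf R) (plane_sf R) _ _ j1 j2.
  split=> //; have [_ <-] := Rintegral_fubini_l j; rewrite /= !fE//.
  transitivity (Rintegral mu2 setT (fun x => f_ s x * Rintegral mu2 setT (f_ s'))).
    by apply: eq_Rintegral => x _; apply: (@RintegralZl _ _ _ mu2).
  exact: (@RintegralZr _ _ _ mu2).
have [j1 e1] := prod _ _ n1 n2; have [j2 e2] := prod _ _ n2 n1.
have j := rintegrableZl (4 * fourier_constant) measurableT (rintegrableD measurableT j1 j2).
have kb : (\int[mu4]_p (cmod (kernel p) * weight sg (p.1 + p.2))%:E <=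
    (8 * fourier_constant * (fine (Xnorm sg T) * fine (Xnorm 1 T)))%:E)%E.
  have eq : 8 * fourier_constant * (fine (Xnorm sg T) * fine (Xnorm 1 T)) =
      Rintegral mu4 setT (fun p => 4 * fourier_constant *
        (f_ sg p.1 * f_ 1 p.2 + f_ 1 p.1 * f_ sg p.2)).
    rewrite RintegralZl//; last exact: rintegrableD.
    rewrite (RintegralD measurableT j1 j2) e1 e2; move: (fine _) (fine _) fourier_constant => a b c.
    by ring.
  rewrite eq Rintegral_EFin//; apply: ge0_le_integral => //.
  - by move=> p _; rewrite lee_fin mulr_ge0 ?cmod_ge0 ?weight_ge0.
  - apply/measurable_EFinP/measurable_funM; first exact: cmeasurable_cmod.
    exact: (measurableT_comp (@weight_measurable R sg) sum_coordinates_measurable).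
  - exact: measurable_int j.
  - by move=> p _; rewrite lee_fin; exact: kernel_bound.
(* If the transform of the nonlinearity were not a function, [fhat] would be 0 by default and so
   would the norm. *)
have [hN|hN] := pselect (is_function (dfourier (nonlinearity T))); last first.
  rewrite Xnorm_fhat /fhat fun_of_not_function//.
  under eq_integral do rewrite cmod0 mulr0.
  by rewrite integral0 lee_fin !mulr_ge0// ?fine_ge0 ?Xnorm_ge0// ltW// fourier_constant_gt0.
have [mN [iN eN]] := fhat_spec hN.
rewrite Xnorm_fhat.
have := @complex_duality_bound _ _ mu4 (fun p => p.1 + p.2) kernel
  (fhat (nonlinearity T)) (weight sg) sum_coordinates_measurable kernel_measurable
  mN (@weight_measurable R sg) (weight_ge0 sg).
move=> /(_ _)/le_trans; apply.
  move=> psi spsi; split; [exact: iN|exact: kernel_integrable|].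
  by rewrite -dfourier_nonlinearity// eN.
apply: le_trans (lee_wpmul2l _ kb) _ => //.
by rewrite -EFinM lee_fin !mulrA -natrM.
Qed.

End nonlinear_estimate.

End bilinear.

(** * Duhamel's formula in a weighted space *)

Section plane_integral.
Context {R : realType}.
Local Notation mu2 := (plane_measure R).
Implicit Types (f g : R * R -> R).

Lemma plane_integralZl (a : R) f : rintegrable mu2 setT f ->
  Rintegral mu2 setT (fun x => a * f x) = a * Rintegral mu2 setT f.
Proof. by move=> i; apply: RintegralZl. Qed.

Lemma plane_integralD f g : rintegrable mu2 setT f -> rintegrable mu2 setT g ->
  Rintegral mu2 setT (fun x => f x + g x) = Rintegral mu2 setT f + Rintegral mu2 setT g.
Proof. by move=> i j; apply: RintegralD. Qed.

Lemma plane_integralB f g : rintegrable mu2 setT f -> rintegrable mu2 setT g ->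
  Rintegral mu2 setT (fun x => f x - g x) = Rintegral mu2 setT f - Rintegral mu2 setT g.
Proof. by move=> i j; apply: RintegralB. Qed.

Lemma plane_integrableZ (a : R) f : rintegrable mu2 setT f ->
  rintegrable mu2 setT (fun x => a * f x).
Proof. exact: rintegrableZl. Qed.

End plane_integral.

Section weighted_pairing.
Context {R : realType}.
Local Notation mu2 := (plane_measure R).
Variable w : R * R -> R.
Implicit Types (g psi : R * R -> R).

Lemma weighted_pairing g psi (K : R) : measurable_fun setT g ->
  measurable_fun setT psi -> rintegrable mu2 setT (fun x => w x * `|g x|) ->
  (forall x, `|psi x| <= K * w x) ->
  rintegrable mu2 setT (fun x => g x * psi x) /\
  `|Rintegral mu2 setT (fun x => g x * psi x)| <=
  K * Rintegral mu2 setT (fun x => w x * `|g x|).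
Proof.
move=> mg mpsi ig psiK.
have m : measurable_fun setT (fun x => g x * psi x) by exact: measurable_funM.
have b x : `|g x * psi x| <= K * (w x * `|g x|).
  by rewrite normrM mulrC mulrA ler_wpM2r.
have ig' := rintegrableZl K measurableT ig; split.
  exact: plane_dominated m b ig'.
rewrite -(plane_integralZl _ ig).
exact: (@le_norm_Rintegral _ _ _ mu2 setT _ _ measurableT m ig' (fun x _ => b x)).
Qed.

Lemma weighted_pairing_cvg g (psi_ : nat -> R * R -> R) psi (K : R) :
  measurable_fun setT g -> rintegrable mu2 setT (fun x => w x * `|g x|) ->
  (forall n, measurable_fun setT (psi_ n)) ->
  (forall n x, `|psi_ n x| <= K * w x) ->
  (forall x, psi_ n x @[n --> \oo] --> psi x) ->
  Rintegral mu2 setT (fun x => g x * psi_ n x) @[n --> \oo] -->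
  Rintegral mu2 setT (fun x => g x * psi x).
Proof.
move=> mg ig mpsi psiK psic.
have mp : measurable_fun setT psi.
  by apply: (measurable_fun_cvg (h := psi_)) => // x _; exact: psic.
have mn n : measurable_fun setT (fun x => g x * psi_ n x) by exact: measurable_funM.
have ml : measurable_fun setT (fun x => g x * psi x) by exact: measurable_funM.
have lim : {ae mu2, forall x, setT x -> (g x * psi_ n x) @[n --> \oo] --> g x * psi x}.
  by apply: nearW => x _; apply: cvgM; [exact: cvg_cst|exact: psic].
have dom : {ae mu2, forall x, setT x -> forall n,
    `|g x * psi_ n x| <= K * (w x * `|g x|)}.
  by apply: nearW => x _ n; rewrite normrM mulrC mulrA ler_wpM2r.
have [_ _ c] := @Rintegral_dominated _ _ _ mu2 setT
  (fun n x => g x * psi_ n x) (fun x => g x * psi x) (fun x => K * (w x * `|g x|))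
  measurableT mn ml lim (plane_integrableZ K ig) dom.
exact: c.
Qed.

End weighted_pairing.

Section weak_duhamel.
Context {R : realType}.
Local Notation mu1 := (@lebesgue_measure R).
Local Notation mu2 := (plane_measure R).
Variables (w lam : R * R -> R) (K0 : R).
Hypothesis mw : measurable_fun setT w.
Hypothesis w0 : forall x, 0 < w x.
Hypothesis gaussian_le : forall x, gaussian 1 x <= K0 * w x.
Hypothesis mlam : measurable_fun setT lam.
Hypothesis lam0 : forall x, 0 <= lam x.
Implicit Types (c psi : R * R -> R) (n : R -> R * R -> R).

Definition heat (t : R) (x : R * R) : R := expR (- t * lam x).

Lemma heat_gt0 t x : 0 < heat t x. Proof. exact: expR_gt0. Qed.

Lemma heat_le1 t x : 0 <= t -> heat t x <= 1.
Proof. by move=> t0; rewrite -expR0 ler_expR mulNr oppr_le0 mulr_ge0. Qed.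

Lemma heatD s t x : heat (s + t) x = heat s x * heat t x.
Proof. by rewrite /heat opprD mulrDl expRD. Qed.

Lemma heat_measurable t : measurable_fun setT (heat t).
Proof. by apply: measurableT_comp => //; exact: measurable_funM. Qed.

Lemma heat_bound t psi (K : R) x : 0 <= t -> `|psi x| <= K * w x ->
  `|heat t x * psi x| <= K * w x.
Proof.
move=> t0; apply: le_trans; rewrite normrM (ger0_norm (ltW (heat_gt0 _ _))).
by rewrite ler_piMl// heat_le1.
Qed.

Definition forcing n (t z : R) psi : R :=
  Rintegral mu2 setT (fun x => n z x * (heat (t - z) x * psi x)).

(** Measurability in [z] is part of the property: [n z] is chosen at each time separately, so for a
    general [psi] it can only be inherited as a limit of measurable pairings. *)
Definition weak_duhamel (c0 ct : R * R -> R) n (t : R) psi : Prop :=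
  measurable_fun `[0, t] (fun z => forcing n t z psi) /\
  Rintegral mu2 setT (fun x => ct x * psi x) =
  Rintegral mu2 setT (fun x => c0 x * (heat t x * psi x)) -
  Rintegral mu1 `[0, t] (fun z => forcing n t z psi).

Definition weighted c := measurable_fun setT c /\
  rintegrable mu2 setT (fun x => w x * `|c x|).

Definition forcing_bounded n (N : R -> R) (t : R) : Prop :=
  (forall z, `[0, t]%classic z -> weighted (n z) /\
     Rintegral mu2 setT (fun x => w x * `|n z x|) <= N z) /\
  rintegrable mu1 `[0, t] N.

Lemma norm_forcing_le n N (t : R) psi (K : R) (z : R) : forcing_bounded n N t ->
  measurable_fun setT psi -> 0 <= K -> (forall x, `|psi x| <= K * w x) ->
  `[0, t]%classic z -> `|forcing n t z psi| <= K * N z.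
Proof.
move=> [nN _] mpsi K0' psiK zt; have [[mn iN] nz] := nN z zt.
have tz : 0 <= t - z by move: zt; rewrite /= in_itv/= subr_ge0 => /andP[].
have m : measurable_fun setT (fun x => heat (t - z) x * psi x).
  by apply: measurable_funM => //; exact: heat_measurable.
have b x : `|heat (t - z) x * psi x| <= K * w x by exact: heat_bound.
have [_ h] := weighted_pairing mn m iN b.
by apply: le_trans h _; rewrite ler_wpM2l.
Qed.

(** An instance of [plane_monotone_class]: every term is linear in [psi] and passes to dominated
    limits. The forcing term uses dominated convergence twice, in frequency at each fixed time with
    majorant a multiple of [w * |n z|], then in time with majorant a multiple of [N]. *)
Lemma weak_duhamel_extend c0 ct n N (t : R) psi (K : R) : 0 <= t ->
  weighted c0 -> weighted ct -> forcing_bounded n N t ->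
  (forall p q p' q', weak_duhamel c0 ct n t (test_function p q p' q')) ->
  measurable_fun setT psi -> 0 <= K -> (forall x, `|psi x| <= K * w x) ->
  weak_duhamel c0 ct n t psi.
Proof.
move=> t0 [m0 i0] [m1 i1] nN Htest mpsi Kge0 psiK.
pose H (f : R * R -> R) := [/\ measurable_fun setT f,
  exists K, 0 <= K /\ forall x, `|f x| <= K * w x & weak_duhamel c0 ct n t f].
suff [] : H psi by [].
have mheat (f : R * R -> R) (s : R) : measurable_fun setT f -> measurable_fun setT (fun x => heat s x * f x).
  by move=> mf; apply: measurable_funM => //; exact: heat_measurable.
have iforce (f : R * R -> R) (K' : R) : measurable_fun setT f -> 0 <= K' -> (forall x, `|f x| <= K' * w x) ->
    measurable_fun `[0, t] (fun z => forcing n t z f) ->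
    rintegrable mu1 `[0, t] (fun z => forcing n t z f).
  move=> mf K'0 fK mF; have [_ iN] := nN.
  apply: (@rintegrable_dominated _ _ _ mu1 `[0, t] _ (fun z => K' * N z)) => //.
    by move=> z zt; exact: norm_forcing_le fK zt.
  exact: rintegrableZl.
have K00 : 0 <= K0.
  have := lt_le_trans (gaussian_gt0 1 0) (gaussian_le 0).
  by rewrite pmulr_lgt0// => /ltW.
apply: (@plane_monotone_class R w H K0 gaussian_le); [ | | |exact: mpsi|by exists K].
- move=> p q p' q'; split; [exact: test_function_measurable| |exact: Htest].
  exists K0; split=> // x; rewrite ger0_norm ?test_function_ge0//.
  exact: le_trans (test_function_le _ _ _ _ _) (gaussian_le x).
- move=> a f1 f2 [mf1 [K1 [K10 h1]] [mF1 e1]] [mf2 [K2 [K20 h2]] [mF2 e2]].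
  have forceE z : `[0, t]%classic z -> forcing n t z (fun x => a * f1 x + f2 x) =
      a * forcing n t z f1 + forcing n t z f2.
    move=> zt; have [nNz _] := nN; have [[mn iN] _] := nNz z zt.
    have tz : 0 <= t - z by move: zt; rewrite /= in_itv/= subr_ge0 => /andP[].
    have [j1 _] := weighted_pairing mn (mheat _ (t - z) mf1) iN
      (fun x => heat_bound tz (h1 x)).
    have [j2 _] := weighted_pairing mn (mheat _ (t - z) mf2) iN
      (fun x => heat_bound tz (h2 x)).
    rewrite /forcing -(plane_integralZl a j1) -(plane_integralD (plane_integrableZ a j1) j2).
    by apply: eq_Rintegral => x _; ring.
  split.
  + by apply: measurable_funD => //; exact: measurable_funM.
  + exists (`|a| * K1 + K2); split; first by rewrite addr_ge0// mulr_ge0.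
    move=> x; rewrite (le_trans (ler_normD _ _))//.
    by rewrite mulrDl lerD// normrM -mulrA ler_wpM2l.
  + split.
      apply: (eq_measurable_fun (fun z => a * forcing n t z f1 + forcing n t z f2)).
        by move=> z /set_mem zt; rewrite forceE.
      by apply: measurable_funD => //; exact: measurable_funM.
    have I1 := iforce _ _ mf1 K10 h1 mF1; have I2 := iforce _ _ mf2 K20 h2 mF2.
    have -> : Rintegral mu1 `[0, t] (fun z => forcing n t z (fun x => a * f1 x + f2 x)) =
        a * Rintegral mu1 `[0, t] (fun z => forcing n t z f1) +
        Rintegral mu1 `[0, t] (fun z => forcing n t z f2).
      rewrite -(@RintegralZl _ _ _ mu1)// -(@RintegralD _ _ _ mu1)//; last exact: rintegrableZl.
      by apply: eq_Rintegral => z /set_mem zt; rewrite forceE.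
    have [j1 _] := weighted_pairing m1 mf1 i1 h1.
    have [j2 _] := weighted_pairing m1 mf2 i1 h2.
    have [k1 _] := weighted_pairing m0 (mheat _ t mf1) i0 (fun x => heat_bound t0 (h1 x)).
    have [k2 _] := weighted_pairing m0 (mheat _ t mf2) i0 (fun x => heat_bound t0 (h2 x)).
    have -> : Rintegral mu2 setT (fun x => ct x * (a * f1 x + f2 x)) =
       a * Rintegral mu2 setT (fun x => ct x * f1 x) + Rintegral mu2 setT (fun x => ct x * f2 x).
      rewrite -(plane_integralZl a j1) -(plane_integralD (plane_integrableZ a j1) j2).
      by apply: eq_Rintegral => x _; ring.
    have -> : Rintegral mu2 setT (fun x => c0 x * (heat t x * (a * f1 x + f2 x))) =
       a * Rintegral mu2 setT (fun x => c0 x * (heat t x * f1 x)) +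
       Rintegral mu2 setT (fun x => c0 x * (heat t x * f2 x)).
      rewrite -(plane_integralZl a k1) -(plane_integralD (plane_integrableZ a k1) k2).
      by apply: eq_Rintegral => x _; ring.
    rewrite e1 e2; move: (Rintegral _ _ _) (Rintegral _ _ _) (Rintegral _ _ _) (Rintegral _ _ _) => *; ring.
- move=> f_ f K' Hf fK fc.
  have mf_ k : measurable_fun setT (f_ k) by case: (Hf k).
  have mf : measurable_fun setT f.
    by apply: (measurable_fun_cvg (h := f_)) => // x _; exact: fc.
  have K'0 : 0 <= K'.
    have := le_trans (normr_ge0 _) (fK 0%N 0); rewrite pmulr_lge0//.
  have fK' x : `|f x| <= K' * w x.
    by apply: cvg_norm_le (fc x) _ => k; exact: fK.
  have Fc z : `[0, t]%classic z -> forcing n t z (f_ k) @[k --> \oo] --> forcing n t z f.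
    move=> zt; have [nNz _] := nN; have [[mn iN] _] := nNz z zt.
    have tz : 0 <= t - z by move: zt; rewrite /= in_itv/= subr_ge0 => /andP[].
    apply: (weighted_pairing_cvg mn iN (K := K')) => [k|k x|x].
    + exact: mheat.
    + exact: heat_bound.
    + by apply: cvgM; [exact: cvg_cst|exact: fc].
  have mF : measurable_fun `[0, t] (fun z => forcing n t z f).
    apply: (measurable_fun_cvg (h := fun k z => forcing n t z (f_ k))) => //.
    by move=> k; have [_ _ []] := Hf k.
  split=> //; first by exists K'.
  split=> //.
  have c1 := weighted_pairing_cvg m1 i1 mf_ fK fc.
  have c2 : Rintegral mu2 setT (fun x => c0 x * (heat t x * f_ k x)) @[k --> \oo] -->
      Rintegral mu2 setT (fun x => c0 x * (heat t x * f x)).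
    apply: (weighted_pairing_cvg m0 i0 (K := K')) => [k|k x|x].
    + exact: mheat.
    + exact: heat_bound.
    + by apply: cvgM; [exact: cvg_cst|exact: fc].
  have [_ iN] := nN.
  have iKN : rintegrable mu1 `[0, t] (fun z => K' * N z) by exact: rintegrableZl.
  have mF_ k : measurable_fun `[0, t] (fun z => forcing n t z (f_ k)).
    by have [_ _ []] := Hf k.
  have lim : {ae mu1, forall z, `[0, t]%classic z ->
      forcing n t z (f_ k) @[k --> \oo] --> forcing n t z f}.
    by apply: nearW => z; exact: Fc.
  have dom : {ae mu1, forall z, `[0, t]%classic z -> forall k,
      `|forcing n t z (f_ k)| <= K' * N z}.
    by apply: nearW => z zt k; apply: norm_forcing_le zt; [|exact: mf_|exact: K'0|exact: fK].
  have [_ _ c3] := @Rintegral_dominated _ _ _ mu1 `[0, t]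
    (fun k z => forcing n t z (f_ k)) (fun z => forcing n t z f) (fun z => K' * N z)
    (measurable_itv _) mF_ mF lim iKN dom.
  apply: (cvg_unique (@Rhausdorff R) c1).
  rewrite (_ : (fun k => _) = fun k =>
    Rintegral mu2 setT (fun x => c0 x * (heat t x * f_ k x)) -
    Rintegral mu1 `[0, t] (fun z => forcing n t z (f_ k))); last first.
    by apply/funext => k; have [_ _ []] := Hf k.
  exact: cvgB c2 c3.
Qed.

(* Duhamel's formula from 0 to t tested against [psi], a function of modulus [w],
   minus the formula from 0 to s tested against [heat (t - s) * psi]. *)
Lemma restart_bound c0 cs ct n N (s t : R) : 0 <= s <= t ->
  weighted c0 -> weighted cs -> weighted ct -> forcing_bounded n N t ->
  (forall p q p' q', weak_duhamel c0 cs n s (test_function p q p' q')) ->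
  (forall p q p' q', weak_duhamel c0 ct n t (test_function p q p' q')) ->
  Rintegral mu2 setT (fun x => w x * `|ct x - heat (t - s) x * cs x|) <=
  Rintegral mu1 `]s, t] N.
Proof.
move=> /andP[s0 st] wc0 wcs wct nN Hs Ht.
have t0 := le_trans s0 st.
have sub : `[0, s]%classic `<=` `[0, t]%classic.
  by apply: subset_itv; rewrite bnd_simp.
have nN' : forcing_bounded n N s.
  have [h1 h2] := nN; split; first by move=> z /sub; exact: h1.
  exact: (@integrableS _ _ _ mu1 `[0, t] `[0, s] _ _ _ sub h2).
have [mcs ics] := wcs; have [mct ict] := wct; have [mc0 ic0] := wc0.
pose g x := ct x - heat (t - s) x * cs x.
have mg : measurable_fun setT g.
  apply: measurable_funB => //; apply: measurable_funM => //; exact: heat_measurable.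
pose psi x := if 0 <= g x then w x else - w x.
have mpsi : measurable_fun setT psi by exact: measurable_sign.
have psiw x : `|psi x| <= 1 * w x.
  by rewrite mul1r /psi; case: ifPn => _; rewrite ?normrN ger0_norm ?(ltW (w0 _)).
have [mFt et] := weak_duhamel_extend t0 wc0 wct nN Ht mpsi ler01 psiw.
have ts : 0 <= t - s by rewrite subr_ge0.
have mhpsi : measurable_fun setT (fun x => heat (t - s) x * psi x).
  by apply: measurable_funM => //; exact: heat_measurable.
have hpsiw x : `|heat (t - s) x * psi x| <= 1 * w x by exact: heat_bound.
have [mFs es] := weak_duhamel_extend s0 wc0 wcs nN' Hs mhpsi ler01 hpsiw.
(* By the semigroup law, the formula at time [s] tested against [heat (t - s) * psi] has the
   integrand of the formula at time [t]; in the difference only the integral over []s, t]]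
   remains. *)
have FE : (fun z => forcing n s z (fun x => heat (t - s) x * psi x)) =
    (fun z => forcing n t z psi).
  apply/funext => z; apply: eq_Rintegral => x _; congr (_ * _).
  by rewrite mulrA -heatD; congr (heat _ x * _); ring.
have [j1 _] := weighted_pairing mct mpsi ict psiw.
have [j2 _] := weighted_pairing mcs mhpsi ics hpsiw.
have [_ iN] := nN.
have iF : rintegrable mu1 `[0, t] (fun z => forcing n t z psi).
  apply: (@rintegrable_dominated _ _ _ mu1 `[0, t] _ (fun z => 1 * N z)) => //.
    by move=> z zt; exact: norm_forcing_le psiw zt.
  exact: rintegrableZl.
have split_itv : `[0, t]%classic = `[0, s]%classic `|` `]s, t]%classic.
  by rewrite -itv_bndbnd_setU// bnd_simp.
have sub' : `]s, t]%classic `<=` `[0, t]%classic.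
  by rewrite split_itv; exact: subsetUr.
have iF' : rintegrable mu1 `]s, t] (fun z => forcing n t z psi).
  exact: (@integrableS _ _ _ mu1 `[0, t] `]s, t] _ _ _ sub' iF).
have -> : Rintegral mu2 setT (fun x => w x * `|ct x - heat (t - s) x * cs x|) =
    - Rintegral mu1 `]s, t] (fun z => forcing n t z psi).
  transitivity (Rintegral mu2 setT (fun x => ct x * psi x) -
                Rintegral mu2 setT (fun x => cs x * (heat (t - s) x * psi x))).
    rewrite -(plane_integralB j1 j2); apply: eq_Rintegral => x _.
    rewrite -/(g x) [RHS](_ : _ = g x * psi x); last by rewrite /g; ring.
    rewrite /psi; case: ifPn => gx; first by rewrite ger0_norm// mulrC.
    by rewrite ltr0_norm ?ltNge// !mulrN mulrC.
  rewrite et es FE split_itv Rintegral_setU//=; last 2 first.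
    - by rewrite -split_itv.
    - rewrite disj_set2E; apply/eqP; rewrite -subset0 => z/=.
      by rewrite !in_itv/= => -[/andP[_ zs] /andP[]]; rewrite ltNge zs.
  have -> : Rintegral mu2 setT (fun x => c0 x * (heat s x * (heat (t - s) x * psi x))) =
      Rintegral mu2 setT (fun x => c0 x * (heat t x * psi x)).
    apply: eq_Rintegral => x _; congr (_ * _).
    by rewrite mulrA -heatD; congr (heat _ x * _); ring.
  move: (Rintegral _ _ _) (Rintegral _ _ _) (Rintegral _ _ _) => *; ring.
apply: le_trans (ler_norm _) _; rewrite normrN.
apply: (@le_norm_Rintegral _ _ _ mu1) => //.
- exact: rintegrable_measurable iF'.
- exact: (@integrableS _ _ _ mu1 `[0, t] `]s, t] _ _ _ sub' iN).
- by move=> z /sub' zt; rewrite -[leRHS]mul1r; exact: norm_forcing_le psiw zt.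
Qed.

End weak_duhamel.

(** * Weighted L^1 spaces of transforms *)

Section weighted_space.
Context {R : realType}.
Local Notation mu2 := (plane_measure R).
Variable sg : R.
Hypothesis sg_range : -1 <= sg < 0.
Implicit Types (f g h : R * R -> R[i]) (T : dist R).
Local Notation w := (weight sg).

Definition part (b : bool) (z : R[i]) : R :=
  if b then complex.Im z else complex.Re z.

Lemma partB b (y z : R[i]) : part b (y - z) = part b y - part b z.
Proof. by case: b; rewrite /part; case: y z => [? ?] [? ?]. Qed.

Lemma partZ b (r : R) (z : R[i]) : part b (r%:C * z) = r * part b z.
Proof. by case: b; rewrite /part ?ReM ?ImM/=; ring. Qed.

Lemma part_le b (z : R[i]) : `|part b z| <= cmod z.
Proof. by case: b; [exact: le_Im_cmod|exact: le_Re_cmod]. Qed.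

Lemma part_measurable b g : cmeasurable_on setT g ->
  measurable_fun setT (fun x => part b (g x)).
Proof. by case: b => -[]. Qed.

Lemma part_cint b d (S : measurableType d) (mu : {measure set S -> \bar R})
  (D : set S) (g : S -> R[i]) :
  part b (cint mu D g) = Rintegral mu D (fun x => part b (g x)).
Proof. by case: b. Qed.

(** The bound [-1 <= sg] acts at high frequencies, where the weight decays no faster than
    [1 / enorm x], and [sg < 0] acts near the origin, where the weight is at least 1. Hence Schwartz
    functions are dominated by the weight. *)
Lemma weight_enorm_ge1 x : 1 <= (1 + enorm x) * w x.
Proof.
have /andP[s1 s0] := sg_range.
rewrite /weight; case: ifPn => x0; first by rewrite mulr1 lerDl enorm_ge0.
have e0 := enorm_gt0 x0; have p0 := powR_gt0 sg e0.
have [e1|e1] := leP 1 (enorm x).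
  have : enorm x * enorm x `^ (- 1) <= enorm x * enorm x `^ sg.
    by rewrite ler_pM2l// ler_powR.
  rewrite powR_inv1 ?enorm_ge0// divff ?gt_eqF// => h.
  by rewrite mulrDl; apply: (le_trans h); rewrite lerDr mul1r ltW.
have : 1 <= enorm x `^ sg.
  by rewrite -[leLHS](powRr0 (enorm x)) ger_powR ?e0 ?ltW.
by move=> h; rewrite mulrDl mul1r; apply: (le_trans h); rewrite lerDl mulr_ge0// ltW.
Qed.

Lemma le_weight (r K : R) x : 0 <= r -> (1 + enorm x) * r <= K -> r <= K * w x.
Proof.
move=> r0 /(ler_wpM2r (weight_ge0 sg x)); apply: le_trans.
by rewrite mulrAC ler_peMl// weight_enorm_ge1.
Qed.

Lemma schwartz_le_weight phi : schwartz phi ->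
  exists K : R, 0 <= K /\ forall x, cmod (phi x) <= K * w x.
Proof.
move=> /schwartz_decay/(_ 1%N)[K HK]; exists K; split.
  apply: le_trans (HK 0); rewrite mulr_ge0 ?cmod_ge0// expr1 addr_ge0//.
  exact: enorm_ge0.
by move=> x; apply: le_weight; [exact: cmod_ge0|have := HK x; rewrite expr1].
Qed.

Lemma gaussian_le_weight : exists K : R, forall x, gaussian 1 x <= K * w x.
Proof.
have [K [_ HK]] := schwartz_le_weight (schwartz_gaussian (@ltr01 R)).
exists K => x; apply: le_trans (HK x).
by rewrite cmod_real ler_norm.
Qed.

Definition wspace g := cmeasurable_on setT g /\
  rintegrable mu2 setT (fun x => w x * cmod (g x)).

Definition wnorm g : R := Rintegral mu2 setT (fun x => w x * cmod (g x)).

Lemma wnorm_ge0 g : 0 <= wnorm g.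
Proof. by apply: Rintegral_ge0 => x _; rewrite mulr_ge0 ?weight_ge0 ?cmod_ge0. Qed.

Lemma wspace_le g h : cmeasurable_on setT h -> wspace g ->
  (forall x, cmod (h x) <= cmod (g x)) -> wspace h /\ wnorm h <= wnorm g.
Proof.
move=> mh [mg ig] hg.
have m : measurable_fun setT (fun x => w x * cmod (h x)).
  by apply: measurable_funM; [exact: weight_measurable|exact: cmeasurable_cmod].
have b x : `|w x * cmod (h x)| <= w x * cmod (g x).
  by rewrite ger0_norm ?mulr_ge0 ?weight_ge0 ?cmod_ge0// ler_wpM2l// weight_ge0.
have ih : rintegrable mu2 setT (fun x => w x * cmod (h x)).
  exact: plane_dominated m b ig.
split=> //; apply: le_trans (ler_norm _) _.
exact: (@le_norm_Rintegral _ _ _ mu2 setT _ _ measurableT m ig (fun x _ => b x)).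
Qed.

Lemma cmeasurable_onN g : cmeasurable_on setT g -> cmeasurable_on setT (fun x => - g x).
Proof.
move=> mg; under eq_fun do rewrite -mulN1r.
by apply: cmeasurable_onM => //; exact: cmeasurable_on_cst.
Qed.

Lemma cmeasurable_onB g h : cmeasurable_on setT g -> cmeasurable_on setT h ->
  cmeasurable_on setT (fun x => g x - h x).
Proof. by move=> mg mh; apply: cmeasurable_onD => //; exact: cmeasurable_onN. Qed.

Lemma wspaceB g h : wspace g -> wspace h -> wspace (fun x => g x - h x).
Proof.
move=> [mg ig] [mh ih]; have m := cmeasurable_onB mg mh; split=> //.
apply: (plane_dominated _ _ (rintegrableD measurableT ig ih)).
  by apply: measurable_funM; [exact: weight_measurable|exact: cmeasurable_cmod].
move=> x; rewrite ger0_norm ?mulr_ge0 ?weight_ge0 ?cmod_ge0//.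
rewrite -mulrDr ler_wpM2l ?weight_ge0//; apply: le_trans (cmodD _ _) _.
by rewrite cmodN.
Qed.

Lemma wnorm_triangle f g h : wspace f -> wspace g -> wspace h ->
  wnorm (fun x => f x - h x) <=
  wnorm (fun x => f x - g x) + wnorm (fun x => g x - h x).
Proof.
move=> wf wg wh; have [_ i1] := wspaceB wf wg; have [_ i2] := wspaceB wg wh.
have [_ i3] := wspaceB wf wh.
rewrite /wnorm -(plane_integralD i1 i2).
apply: (@le_Rintegral _ _ _ mu2) => //; first exact: rintegrableD.
move=> x _; rewrite -mulrDr ler_wpM2l ?weight_ge0//; apply: le_trans (cmodD _ _).
by rewrite addrA subrK.
Qed.

Lemma wnormC f g : wnorm (fun x => f x - g x) = wnorm (fun x => g x - f x).
Proof. by apply: eq_Rintegral => x _; rewrite -cmodN opprB. Qed.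

Lemma wnorm_le_distD f g : wspace f -> wspace g ->
  wnorm f <= wnorm g + wnorm (fun x => f x - g x).
Proof.
move=> wf wg; have [_ i1] := wspaceB wf wg; have [_ i2] := wf; have [_ i3] := wg.
rewrite /wnorm -(plane_integralD i3 i1).
apply: (@le_Rintegral _ _ _ mu2) => //; first exact: rintegrableD.
move=> x _; rewrite -mulrDr ler_wpM2l ?weight_ge0//; apply: le_trans (cmodD _ _).
by rewrite subrKC.
Qed.

Lemma wspace_ae f g : cmeasurable_on setT g ->
  {ae mu2, forall x, f x = g x} -> wspace f -> wspace g /\ wnorm f = wnorm g.
Proof.
move=> mg fg [mf i].
have m h : cmeasurable_on setT h -> measurable_fun setT (fun x => w x * cmod (h x)).
  by move=> mh; apply: measurable_funM; [exact: weight_measurable|exact: cmeasurable_cmod].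
have ae : {ae mu2, forall x, setT x -> w x * cmod (f x) = w x * cmod (g x)}.
  by apply: plane_ae_impl fg => x ->.
split; last first.
  exact: (@Rintegral_ae_eq _ _ _ mu2 setT _ _ measurableT (m _ mf) (m _ mg) ae).
split=> //; exact: (@rintegrable_ae_eq _ _ _ mu2 setT _ _ measurableT (m _ mg) ae i).
Qed.

Lemma Xspace_wspace T : (Xnorm sg T < +oo)%E ->
  wspace (fhat T) /\ Xnorm sg T = (wnorm (fhat T))%:E.
Proof.
move=> h; have i := weight_fhat_integrable h; split.
  by split=> //; exact: fhat_measurable.
by rewrite Xnorm_fhat /wnorm Rintegral_EFin.
Qed.

Lemma Xnorm_dsub S T : Xspace sg S -> Xspace sg T ->
  Xnorm sg (dsub S T) = (wnorm (fun x => fhat S x - fhat T x))%:E.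
Proof.
move=> [_ fS hS] [_ fT hT].
have [wS _] := Xspace_wspace hS; have [wT _] := Xspace_wspace hT.
have [m i] := wspaceB wS wT.
by rewrite (Xnorm_weight sg m (fhat_dsub fS fT)) /wnorm Rintegral_EFin.
Qed.

Lemma wspace_weighted b g : wspace g ->
  weighted w (fun x => part b (g x)) /\
  Rintegral mu2 setT (fun x => w x * `|part b (g x)|) <= wnorm g.
Proof.
move=> [mg ig]; have mp := part_measurable b mg.
have m : measurable_fun setT (fun x => w x * `|part b (g x)|).
  by apply: measurable_funM; [exact: weight_measurable|exact: measurableT_comp].
have bd x : `|w x * `|part b (g x)| | <= w x * cmod (g x).
  by rewrite normrM normr_id ger0_norm ?weight_ge0// ler_wpM2l ?weight_ge0// part_le.
split; first by split=> //; exact: plane_dominated m bd ig.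
apply: le_trans (ler_norm _) _.
exact: (@le_norm_Rintegral _ _ _ mu2 setT _ _ measurableT m ig (fun x _ => bd x)).
Qed.

Lemma wnorm_le_part g : wspace g -> wnorm g <=
  Rintegral mu2 setT (fun x => w x * `|part false (g x)|) +
  Rintegral mu2 setT (fun x => w x * `|part true (g x)|).
Proof.
move=> wg; have [[_ i1] _] := wspace_weighted false wg.
have [[_ i2] _] := wspace_weighted true wg; have [_ i3] := wg.
rewrite -(plane_integralD i1 i2).
apply: (@le_Rintegral _ _ _ mu2) => //; first exact: rintegrableD.
move=> x _; rewrite -mulrDr ler_wpM2l ?weight_ge0//; exact: cmod_le_ReIm.
Qed.

Section heat_multiplier.
Variable lam : R * R -> R.
Hypothesis mlam : measurable_fun setT lam.
Hypothesis lam0 : forall x, 0 <= lam x.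

Lemma wspace_heat t g : 0 <= t -> wspace g ->
  wspace (fun x => (heat lam t x)%:C * g x) /\
  wnorm (fun x => (heat lam t x)%:C * g x) <= wnorm g.
Proof.
move=> t0 wg; apply: wspace_le => //.
  apply: cmeasurable_onM; last by case: wg.
  by apply: cmeasurable_on_real; exact: (heat_measurable mlam).
move=> x; rewrite cmodM cmod_real ger0_norm ?(ltW (heat_gt0 _ _ _))//.
by rewrite ler_piMl ?cmod_ge0// heat_le1.
Qed.

End heat_multiplier.

End weighted_space.

(** * Completeness of L^1 and continuity of the heat flow *)

Section L1_completeness.
Context d (T : measurableType d) (R : realType).
Variable mu : {measure set T -> \bar R}.

Lemma rintegrable_fine (D : set T) (f : T -> \bar R) : measurable D ->
  mu.-integrable D f -> rintegrable mu D (fun x => fine (f x)).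
Proof.
move=> mD fi; apply: (le_integrable mD _ _ fi).
  by apply/measurable_EFinP; apply: measurableT_comp (measurable_int mu fi).
by move=> x _; case: (f x) => [r| |] //=; rewrite ?normr0 leey.
Qed.

Lemma fine_nneseries_bound (u : nat -> R) : (forall k, 0 <= u k) ->
  (\sum_(k <oo) (u k)%:E)%E \is a fin_num ->
  forall n, \sum_(0 <= k < n) u k <= fine (\sum_(k <oo) (u k)%:E)%E.
Proof.
move=> u0 Sfin n; rewrite -lee_fin fineK// -sumEFin.
by apply: nneseries_lim_ge => k _ _; rewrite lee_fin.
Qed.

(** The Riesz-Fischer argument: the sum [S] of the absolute increments has integral at most 1, so it
    is finite almost everywhere; there the sequence converges, and [|q 0| + S] dominates it. *)
Lemma L1_complete (q : nat -> T -> R) :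
  (forall k, rintegrable mu setT (q k)) ->
  (forall k, Rintegral mu setT (fun x => `|q k.+1 x - q k x|) <= 1 / (2 ^ k.+1)%:R) ->
  exists g, rintegrable mu setT g /\
    Rintegral mu setT (fun x => `|q k x - g x|) @[k --> \oo] --> (0 : R).
Proof.
move=> iq qd; pose D k x := `|q k.+1 x - q k x|.
have iD k : rintegrable mu setT (D k).
  by apply: rintegrable_norm => //; exact: rintegrableB.
pose S x := (\sum_(k <oo) (D k x)%:E)%E.
have mD k : measurable_fun setT (fun x => (D k x)%:E) by exact: measurable_int (iD k).
have D0 k x : (0 <= (D k x)%:E)%E by rewrite lee_fin normr_ge0.
have mS : measurable_fun setT S by exact: ge0_emeasurable_sum.
have S0 x : (0 <= S x)%E by exact: nneseries_ge0.
have iS : mu.-integrable setT S.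
  apply/integrableP; split=> //; under eq_integral do rewrite gee0_abs//.
  rewrite integral_nneseries//.
  apply: (@le_lt_trans _ _ (1%:E)); last exact: ltry.
  apply: le_trans (epsilon_trick0 xpredT (@ler01 R)).
  apply: lee_nneseries => [k _ _|k _]; first exact: integral_ge0.
  by rewrite -Rintegral_EFin// lee_fin qd.
have Sfin : {ae mu, forall x, S x \is a fin_num}.
  by have := integrable_ae measurableT iS; apply: filterS => x; apply.
pose E := S @^-1` [set y | y \is a fin_num].
have mE : measurable E.
  rewrite -[E]setTI; apply: mS => //.
  rewrite (_ : [set y | _] = range EFin); first by apply: measurable_image_EFin; exact: measurableT.
  apply/seteqP; split=> [y /fineK yE|_ [r _ <-]//]; by exists (fine y).
have cq x : E x -> cvgn (fun n => q n x).
  move=> Ex; have b := @fine_nneseries_bound (D ^~ x) (fun k => normr_ge0 _) Ex.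
  have cs : cvgn (series (telescope (q ^~ x))).
    apply: (@normed_cvg R R); apply: nondecreasing_is_cvgn.
      by apply: nondecreasing_series => k _ _; exact: normr_ge0.
    by exists (fine (S x)) => _ [n _ <-]; exact: b.
  rewrite (_ : (fun n => q n x) = (fun n => q 0%N x + series (telescope (q ^~ x)) n)); last first.
    by apply/funext => n; exact: (eq_sum_telescope (q ^~ x) n).
  by apply: is_cvgD => //; exact: is_cvg_cst.
(* The indicator of [E] makes the sequence converge at every point, so the limit is measurable
   without discarding a null set. *)
pose g x := limn (fun n => \1_E x * q n x).
have mq k : measurable_fun setT (q k) by exact: rintegrable_measurable (iq k).
have cg x : (\1_E x * q n x) @[n --> \oo] --> g x.
  rewrite /g indicE; have [Ex|Ex] := pselect (E x).
    by rewrite mem_set//=; under eq_fun do rewrite mul1r; exact: cq.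
  by rewrite memNset//=; under eq_fun do rewrite mul0r; exact: is_cvg_cst.
have mg : measurable_fun setT g.
  apply: (measurable_fun_cvg (h := fun n x => \1_E x * q n x)) => [n|x _]; last exact: cg.
  by apply: measurable_funM => //; exact: measurable_indic.
have lim : {ae mu, forall x, setT x -> q ^~ x @ \oo --> g x}.
  apply: filterS Sfin => x Ex _; have := cg x.
  by rewrite indicE mem_set//; under eq_fun do rewrite mul1r.
have dom : {ae mu, forall x, setT x -> forall n, `|q n x| <= `|q 0%N x| + fine (S x)}.
  apply: filterS Sfin => x Ex _ n.
  rewrite (eq_sum_telescope (q ^~ x) n); apply: le_trans (ler_normD _ _) _.
  rewrite lerD2l; apply: le_trans (ler_norm_sum _ _ _) _.
  exact: (@fine_nneseries_bound (D ^~ x) (fun k => normr_ge0 _) Ex).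
have ih : rintegrable mu setT (fun x => `|q 0%N x| + fine (S x)).
  by apply: rintegrableD => //; [exact: rintegrable_norm|exact: rintegrable_fine].
by have [ig c _] := Rintegral_dominated measurableT mq mg lim ih dom; exists g.
Qed.

End L1_completeness.

Section weighted_completeness.
Context {R : realType}.
Local Notation mu2 := (plane_measure R).
Variable sg : R.
Implicit Types (f g h : R * R -> R[i]).
Local Notation w := (weight sg).

(** Multiplication by the weight reduces this to [L1_complete] for the real and imaginary parts.
    Going back divides by the weight, which is positive everywhere, the origin included. *)
Lemma wspace_complete (q : nat -> R * R -> R[i]) : (forall k, wspace sg (q k)) ->
  (forall k, wnorm sg (fun x => q k.+1 x - q k x) <= 1 / (2 ^ k.+1)%:R) ->
  exists g, wspace sg g /\
    forall e : R, 0 < e -> \forall k \near \oo, wnorm sg (fun x => q k x - g x) <= e.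
Proof.
move=> wq qd.
have mw : measurable_fun setT w by exact: weight_measurable.
have H b : exists g : R * R -> R, rintegrable mu2 setT g /\
    Rintegral mu2 setT (fun x => `|w x * part b (q k x) - g x|) @[k --> \oo] --> (0 : R).
  apply: (@L1_complete _ _ _ mu2 (fun k x => w x * part b (q k x))) => k.
    have [[mq iq] _] := wspace_weighted b (wq k).
    apply: plane_dominated iq => [|x]; first exact: measurable_funM.
    by rewrite normrM ger0_norm// weight_ge0.
  apply: le_trans (qd k); apply: le_trans (wspace_weighted b (wspaceB (wq k.+1) (wq k))).2.
  rewrite le_eqVlt; apply/orP; left; apply/eqP.
  apply: eq_Rintegral => x _; rewrite partB -mulrBr normrM ger0_norm//.
  exact: weight_ge0.
have [g1 [i1 c1]] := H false; have [g2 [i2 c2]] := H true.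
pose g x : R[i] := (g1 x / w x) +i* (g2 x / w x).
have wN x : w x != 0 by rewrite gt_eqF// weight_gt0.
have mV : measurable_fun setT (fun x => (w x)^-1).
  rewrite (_ : (fun x => _) = weight (- sg)); first exact: weight_measurable.
  by apply/funext => x; rewrite /weight; case: ifPn => _; rewrite ?invr1 ?powRN.
have mg : cmeasurable_on setT g.
  split; apply: measurable_funM => //; [exact: rintegrable_measurable i1|].
  exact: rintegrable_measurable i2.
have wg x : w x * cmod (g x) <= `|g1 x| + `|g2 x|.
  apply: (le_trans (ler_wpM2l (weight_ge0 _ _) (cmod_le_ReIm _))) => /=.
  by rewrite mulrDr !normrM !normfV !(ger0_norm (weight_ge0 _ _)) !(mulrC (w x)) !divfK.
have wsg : wspace sg g.
  split=> //; apply: (plane_dominated _ _ (rintegrableD measurableT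
    (rintegrable_norm measurableT i1) (rintegrable_norm measurableT i2))).
    by apply: measurable_funM => //; exact: cmeasurable_cmod.
  by move=> x; rewrite ger0_norm ?mulr_ge0 ?weight_ge0 ?cmod_ge0.
exists g; split=> // e e0.
have e2 : 0 < e / 2 by rewrite divr_gt0.
have n1 : \forall k \near \oo, Rintegral mu2 setT (fun x => `|w x * part false (q k x) - g1 x|) < e / 2.
  exact: (cvgr_lt _ c1).
have n2 : \forall k \near \oo, Rintegral mu2 setT (fun x => `|w x * part true (q k x) - g2 x|) < e / 2.
  exact: (cvgr_lt _ c2).
near=> k.
apply: (le_trans (wnorm_le_part (wspaceB (wq k) wsg))).
have E b (g3 : R * R -> R) : (forall x, part b (g x) = g3 x / w x) ->
    Rintegral mu2 setT (fun x => w x * `|part b (q k x - g x)|) =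
    Rintegral mu2 setT (fun x => `|w x * part b (q k x) - g3 x|).
  move=> gE; apply: eq_Rintegral => x _.
  rewrite -[X in X * _](ger0_norm (weight_ge0 sg x)) -normrM partB gE mulrBr.
  by rewrite [w x * (_ / _)]mulrC divfK.
rewrite (E false g1)// (E true g2)//.
have h1 : Rintegral mu2 setT (fun x => `|w x * part false (q k x) - g1 x|) < e / 2.
  by near: k.
have h2 : Rintegral mu2 setT (fun x => `|w x * part true (q k x) - g2 x|) < e / 2.
  by near: k.
lra.
Unshelve. all: by end_near. Qed.

Section heat_continuity.
Variable lam : R * R -> R.
Hypothesis mlam : measurable_fun setT lam.
Hypothesis lam0 : forall x, 0 <= lam x.

(** Dominated convergence gives smallness along the times [rho k]; since [1 - heat lam r x]
    increases with [r], the bound at one of them holds for every smaller time. *)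
Lemma wnorm_heat_near0 g (e : R) : wspace sg g -> 0 < e ->
  exists2 r0 : R, 0 < r0 & forall r, 0 <= r <= r0 ->
    wnorm sg (fun x => (1 - heat lam r x)%:C * g x) <= e.
Proof.
move=> [mg ig] e0; pose rho (k : nat) : R := k.+1%:R^-1.
have rho0 k : 0 < rho k by rewrite invr_gt0.
pose f k x := (1 - heat lam (rho k) x) * (w x * cmod (g x)).
have h0 r x : 0 <= r -> 0 <= 1 - heat lam r x by move=> r0; rewrite subr_ge0 heat_le1.
have h1 r x : 1 - heat lam r x <= 1 by rewrite gerBl ltW// heat_gt0.
have G0 x : 0 <= w x * cmod (g x) by rewrite mulr_ge0 ?weight_ge0 ?cmod_ge0.
have mG := rintegrable_measurable ig.
have m1 r : measurable_fun setT (fun x => 1 - heat lam r x).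
  by apply: measurable_funB => //; exact: (heat_measurable mlam).
have mf k : measurable_fun setT (f k) by exact: measurable_funM.
have fb k x : `|f k x| <= w x * cmod (g x).
  rewrite ger0_norm; first by rewrite ler_piMl.
  by apply: mulr_ge0 => //; apply: h0; exact: ltW.
have lim : {ae mu2, forall x, setT x -> f k x @[k --> \oo] --> (0 : R)}.
  apply: nearW => x _; rewrite -[X in _ --> X](mul0r (w x * cmod (g x))).
  apply: cvgM; last exact: cvg_cst.
  rewrite -[X in _ --> X](subrr 1); apply: cvgB; first exact: cvg_cst.
  have rho_cvg : - rho n * lam x @[n --> \oo] --> (0 : R).
    rewrite -[X in _ --> X](mul0r (lam x)); apply: cvgM; last exact: cvg_cst.
    by rewrite -oppr0; apply: cvgN; exact: cvg_harmonic.
  by rewrite -expR0; apply: cvg_comp rho_cvg _; exact: continuous_expR.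
have dom : {ae mu2, forall x, setT x -> forall k, `|f k x| <= w x * cmod (g x)}.
  by apply: nearW => x _ k; exact: fb.
have [_ _] := @Rintegral_dominated _ _ _ mu2 setT f (fun=> 0)
  (fun x => w x * cmod (g x)) measurableT mf (measurable_cst _) lim ig dom.
rewrite [X in _ --> X](_ : _ = 0); last by rewrite /Rintegral integral0.
move=> /cvgr_lt/(_ e e0)[k _ /(_ k (leqnn k)) ke].
exists (rho k) => // r /andP[r0 rk]; apply: le_trans (ltW ke).
have ifk : rintegrable mu2 setT (f k).
  exact: plane_dominated (mf k) (fb k) ig.
have mr : cmeasurable_on setT (fun x => (1 - heat lam r x)%:C * g x).
  by apply: cmeasurable_onM => //; exact: cmeasurable_on_real.
have b x : w x * cmod ((1 - heat lam r x)%:C * g x) <= f k x.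
  rewrite cmodM cmod_real ger0_norm ?h0// mulrCA ler_wpM2r//.
  by rewrite lerD2l lerN2 ler_expR ler_wpM2r// lerN2.
apply: le_trans (ler_norm _) _.
apply: (@le_norm_Rintegral _ _ _ mu2 setT _ _ measurableT _ ifk) => [|x _].
  by apply: measurable_funM; [exact: weight_measurable|exact: cmeasurable_cmod].
by rewrite ger0_norm ?mulr_ge0 ?weight_ge0 ?cmod_ge0.
Qed.

End heat_continuity.

End weighted_completeness.

(** * Distributions with a transform in a weighted L^1 space *)

Section weighted_distribution.
Context {R : realType}.
Local Notation mu2 := (plane_measure R).
Variable sg : R.
Hypothesis sg_range : -1 <= sg < 0.
Implicit Types (f g h phi psi : R * R -> R[i]).
Local Notation w := (weight sg).

Lemma integral_cmod_cpartials phi (v : seq bool) : schwartz phi -> (size v <= 5)%N ->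
  cintegrable mu2 setT (cpartials v phi) ->
  Rintegral mu2 setT (fun x => cmod (cpartials v phi x)) <=
  seminorm 5 phi * Rintegral mu2 setT plane_weight.
Proof.
move=> sphi v5 ii; rewrite -(plane_integralZl _ integrable_plane_weight).
apply: (@le_Rintegral _ _ _ mu2) => //.
- exact: cintegrable_cmod.
- exact: plane_integrableZ integrable_plane_weight.
- move=> x _; apply: le_plane_weight; last exact: cmod_ge0.
  apply: le_trans (le_seminorm x sphi v5); rewrite ler_wpM2r ?cmod_ge0//.
  by rewrite ler_weXn2l// enorm1_ge1.
Qed.

(** Four powers of [1 + enorm x] make a function integrable and one derivative pays for a
    coordinate; the seminorm of order 5 covers both. The 3 counts the terms of
    [1 + |x.1| + |x.2|]. *)
Lemma ifourier_seminorm : exists C : R, 0 <= C /\ forall phi x, schwartz phi ->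
  (1 + enorm x) * cmod (ifourier phi x) <= C * seminorm 5 phi.
Proof.
pose P := Rintegral mu2 setT (@plane_weight R).
have P0 : 0 <= P by apply: Rintegral_ge0 => x _; exact/ltW/plane_weight_gt0.
have c0 := ltW (@fourier_constant_gt0 R).
exists (fourier_constant * (2 * P) * 3); split; first by rewrite !mulr_ge0.
move=> phi x sphi.
have b0 : cmod (fs 1 phi x) <= 2 * P * seminorm 5 phi.
  apply: (le_trans (fs_bound 1 x (schwartz_integrable sphi))).
  rewrite -mulrA ler_wpM2l// mulrC.
  exact: (integral_cmod_cpartials (v := [::]) sphi _ (schwartz_integrable sphi)).
have b1 j : `|coord j x| * cmod (fs 1 phi x) <= 2 * P * seminorm 5 phi.
  have sd := schwartz_cpartial j sphi.
  have -> : `|coord j x| * cmod (fs 1 phi x) = cmod (fs 1 (cpartial j phi) x).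
    rewrite fs_cpartial// cmodM cmodN cmodE/= expr0n/= add0r sqrtr_sqr mul1r.
    by [].
  apply: (le_trans (fs_bound 1 x (schwartz_integrable sd))).
  rewrite -mulrA ler_wpM2l// mulrC.
  exact: (integral_cmod_cpartials (v := [:: j]) sphi _ (schwartz_integrable sd)).
have -> : (1 + enorm x) * cmod (ifourier phi x) =
    fourier_constant * ((1 + enorm x) * cmod (fs 1 phi x)).
  by rewrite ifourierE cmodM cmod_real -/fourier_constant (ger0_norm c0) mulrCA.
have sum3 (u a b S : R) : u <= S -> a * u <= S -> b * u <= S ->
    (1 + (a + b)) * u <= S * 3.
  move=> h1 h2 h3; rewrite (_ : S * 3 = S + (S + S)); last by ring.
  by rewrite mulrDl mul1r mulrDl lerD// lerD.
rewrite -!(mulrA fourier_constant) ler_wpM2l// mulrAC.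
have m := cmod_ge0 (fs 1 phi x).
apply: (le_trans (ler_wpM2r m (lerD (lexx 1) (enorm_le x)))).
exact: sum3 b0 (b1 false) (b1 true).
Qed.

Lemma wspace_pairing g psi (K : R) : wspace sg g -> cmeasurable_on setT psi ->
  (forall x, cmod (psi x) <= K * w x) ->
  cintegrable mu2 setT (fun x => g x * psi x) /\
  cmod (cint mu2 setT (fun x => g x * psi x)) <= 2 * (K * wnorm sg g).
Proof.
move=> [mg ig] mpsi psiK.
have m : cmeasurable_on setT (fun x => g x * psi x) by exact: cmeasurable_onM.
have b x : cmod (g x * psi x) <= K * (w x * cmod (g x)).
  by rewrite cmodM mulrC mulrA ler_wpM2r// cmod_ge0.
have i := plane_integrableZ K ig; split; first exact: cplane_dominated m b i.
rewrite /wnorm -(plane_integralZl K ig).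
exact: (@cmod_cint_le _ _ _ mu2 setT _ _ measurableT m (fun x _ => b x) i).
Qed.

Lemma wspace_schwartz_integrable g phi : wspace sg g -> schwartz phi ->
  cintegrable mu2 setT (fun x => g x * phi x).
Proof.
move=> wg sphi; have [K [_ HK]] := schwartz_le_weight sg_range sphi.
by have [] := wspace_pairing wg (schwartz_measurable sphi) HK.
Qed.

Lemma fs_linear s (c : R[i]) phi psi x : schwartz phi -> schwartz psi ->
  fs s (fun y => c * phi y + psi y) x = c * fs s phi x + fs s psi x.
Proof.
move=> sphi spsi.
have i1 := fs_integrand_integrable s x (schwartz_integrable sphi).
have i2 := fs_integrand_integrable s x (schwartz_integrable spsi).
rewrite /fs -(cintZ c measurableT i1) -(cintD measurableT (cintegrableZ c measurableT i1) i2).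
by apply: eq_cint => y _; ring.
Qed.

Lemma wspace_tempered g : wspace sg g -> tempered (difourier (dist_of g)).
Proof.
move=> wg; split.
  move=> c phi psi sphi spsi; rewrite /difourier /dist_of.
  have i1 := wspace_schwartz_integrable wg (schwartz_ifourier sphi).
  have i2 := wspace_schwartz_integrable wg (schwartz_ifourier spsi).
  rewrite -(cintZ c measurableT i1) -(cintD measurableT (cintegrableZ c measurableT i1) i2).
  by apply: eq_cint => x _; rewrite !ifourierE fs_linear//; ring.
have [C [C0 HC]] := ifourier_seminorm.
exists 5%N, (2 * (C * wnorm sg g)) => phi sphi; rewrite /difourier /dist_of.
have b x : cmod (ifourier phi x) <= C * seminorm 5 phi * w x.
  by apply: (le_weight sg_range); [exact: cmod_ge0|exact: HC].
have [_ h] := wspace_pairing wg (schwartz_measurable (schwartz_ifourier sphi)) b.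
apply: (le_trans h); move: (wnorm _ _) (seminorm _ _) => u v.
by rewrite le_eqVlt; apply/orP; left; apply/eqP; ring.
Qed.

Lemma represents_wspace g : wspace sg g ->
  represents (dfourier (difourier (dist_of g))) g.
Proof.
move=> wg; apply: fhat_difourier; first by case: wg.
by move=> phi; exact: wspace_schwartz_integrable.
Qed.

Lemma fhat_wspace_ae g : wspace sg g ->
  {ae mu2, forall x, fhat (difourier (dist_of g)) x = g x}.
Proof. by move=> wg; apply: fun_of_ae; exact: represents_wspace. Qed.

(** Makes the limit of the profiles an admissible value for the solution at the final time. *)
Lemma wspace_Xspace g : wspace sg g -> Xspace sg (difourier (dist_of g)).
Proof.
move=> wg; split; first exact: wspace_tempered.
  by exists g; exact: represents_wspace.
have [mg ig] := wg.
by rewrite (Xnorm_weight sg mg (fhat_wspace_ae wg)) -Rintegral_EFin// ltry.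
Qed.

End weighted_distribution.

Lemma ae_impl d (T : measurableType d) (R : realType)
    (mu : {measure set T -> \bar R}) (P Q : T -> Prop) : (forall x, P x -> Q x) ->
  {ae mu, forall x, P x} -> {ae mu, forall x, Q x}.
Proof. by move=> PQ; apply: filterS. Qed.

Lemma line_ae_impl (R : realType) (P Q : R -> Prop) : (forall x, P x -> Q x) ->
  {ae @lebesgue_measure R, forall x, P x} -> {ae @lebesgue_measure R, forall x, Q x}.
Proof. by move=> PQ; exact: (@ae_impl _ _ R (@lebesgue_measure R) P Q PQ). Qed.

Lemma cvge_0 (R : realType) (S : Type) (F : set_system S) (u : S -> \bar R) :
  Filter F -> (forall x, (0 <= u x)%E) ->
  (forall e : R, 0 < e -> \forall x \near F, (u x <= e%:E)%E) ->
  u x @[x --> F] --> 0%E.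
Proof.
move=> FF u0 uF A [d /= d0 dA].
have d2 : 0 < d / 2 by rewrite divr_gt0.
apply: filterS (uF _ d2) => x; rewrite /preimage/=; move: (u0 x) (dA (fine (u x))).
case: (u x) => [r| |] //=; rewrite !lee_fin => r0 H rd.
by apply: H; rewrite /= sub0r normrN ger0_norm// (le_lt_trans rd)// gtr_pMr// invf_lt1// ltr1n.
Qed.

(** * Extension of a solution beyond a finite time *)

Section evolution.
Context {R : realType}.
Local Notation mu1 := (@lebesgue_measure R).
Local Notation mu2 := (plane_measure R).
Variables (alpha T0 : R) (theta0 : dist R) (theta : R -> dist R).
Hypothesis alpha_range : 2^-1 < alpha <= 1.
Hypothesis T0_gt0 : 0 < T0.
Local Notation sg := (1 - 2 * alpha).
Local Notation w := (weight sg).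
Local Notation lam := (laplacian_symbol alpha).
Hypothesis initial : Xspace sg theta0.
Hypothesis sol : solution alpha theta0 (half_open T0%:E) theta.
Hypothesis finite_integral :
  (\int[mu1]_(t in `[0%R, T0[) Xnorm 1 (theta t) < +oo)%E.

Lemma sg_range : -1 <= sg < 0.
Proof. by have /andP[h1 h2] := alpha_range; apply/andP; split; lra. Qed.

Lemma half_openE : half_open T0%:E = `[0, T0[%classic.
Proof.
apply/seteqP; split=> t; rewrite /half_open/= in_itv/= lte_fin.
  by move=> [-> ->].
by move=> /andP[].
Qed.

Lemma lam_measurable : measurable_fun setT lam.
Proof. exact: (measurableT_comp (@measurable_powR R _) (@enorm_measurable R)). Qed.

Lemma lam_ge0 x : 0 <= lam x.
Proof. exact: powR_ge0. Qed.

(** What a solution on [[0, T0[] provides concerns the closed intervals [[0, t]] with [t < T0];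
    these times, starting at 0, exhaust the half-open interval by countably many of them. *)
Definition left_approx (k : nat) : R := T0 - T0 / k.+1%:R.
Local Notation ts := left_approx.

Lemma left_approx_itv k : 0 <= ts k < T0.
Proof.
rewrite subr_ge0 ler_pdivrMr// ler_peMr ?ler1n ?(ltW T0_gt0)//=.
by rewrite gtrBl divr_gt0.
Qed.

Lemma cvg_left_approx : ts k @[k --> \oo] --> T0.
Proof.
rewrite -[X in _ --> X](subr0 T0); apply: cvgB; first exact: cvg_cst.
rewrite -(mulr0 T0); apply: cvgM; first exact: cvg_cst.
exact: cvg_harmonic.
Qed.

Lemma itv_bigcup : `[0, T0[%classic = \bigcup_k `[0, ts k]%classic.
Proof.
apply/seteqP; split=> t /=.
  rewrite in_itv/= => /andP[t0 tT].
  have : \forall k \near \oo, t < ts k.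
    exact: (cvgr_gt T0 cvg_left_approx).
  by move=> [k _ /(_ k (leqnn k)) tk]; exists k => //=; rewrite in_itv/= t0 ltW.
move=> [k _ /=]; rewrite !in_itv/= => /andP[-> /le_lt_trans->//].
by have /andP[] := left_approx_itv k.
Qed.

Lemma theta_Xspace t : 0 <= t < T0 -> Xspace sg (theta t).
Proof.
by move=> tT; have [[h _] _ _] := sol; apply: h; rewrite half_openE/= in_itv.
Qed.

(** [fine] turns an infinite norm into 0; within [[0, T0[] this can happen only at the null set of
    times where [theta z] is not in X^1. *)
Definition kappa (z : R) : R := fine (Xnorm 1 (theta z)).

Lemma kappa_ge0 z : 0 <= kappa z.
Proof. by rewrite fine_ge0// Xnorm_ge0. Qed.

Lemma Xnorm_integrable : mu1.-integrable `[0, T0[ (fun t => Xnorm 1 (theta t)).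
Proof.
apply/integrableP; split.
  rewrite itv_bigcup; apply/measurable_fun_bigcup => // k.
  have [_ h _] := sol; have tk := left_approx_itv k.
  have [|_ i] := h (ts k); first by rewrite half_openE/= in_itv.
  exact: measurable_int i.
by under eq_integral do rewrite gee0_abs ?Xnorm_ge0//.
Qed.

Lemma kappa_integrable : rintegrable mu1 `[0, T0[ kappa.
Proof. by apply: rintegrable_fine => //; exact: Xnorm_integrable. Qed.

(** A solution has a null set of bad times for each [t < T0], and the times [ts k] reduce these to
    countably many. A measurable set is extracted because the indicator of its complement [good]
    enters integrands. *)
Lemma exceptional_times : exists A : set R, [/\ measurable A, mu1 A = 0 &
  forall z, 0 <= z < T0 -> ~ A z -> Xspace 1 (theta z)].
Proof.
have : {ae mu1, forall s, forall k, `[0, ts k]%classic s -> Xspace 1 (theta s)}.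
  apply: ae_foralln => k; have [_ h _] := sol; have tk := left_approx_itv k.
  by have [|a _] := h (ts k); first by rewrite half_openE/= in_itv.
move=> [A [mA A0 sA]]; exists A; split=> // z zT nAz.
have : `[0, T0[%classic z by rewrite /= in_itv.
rewrite itv_bigcup => -[k _ zk].
by apply: contrapT => nX; apply/nAz/sA => /= /(_ k zk).
Qed.

Definition good : set R := ~` (sval (cid exceptional_times)).

Lemma good_measurable : measurable good.
Proof. by apply: measurableC; case: (svalP (cid exceptional_times)). Qed.

Lemma good_ae : {ae mu1, forall z, good z}.
Proof.
have [mA A0 _] := svalP (cid exceptional_times).
by exists (sval (cid exceptional_times)); split=> // z /= /contrapT.
Qed.

Lemma good_Xspace z : 0 <= z < T0 -> good z -> Xspace 1 (theta z).
Proof. by have [_ _ h] := svalP (cid exceptional_times); exact: h. Qed.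

Definition profile (t : R) : R * R -> R[i] := fhat (theta t).

Definition source (z : R) : R * R -> R[i] := fhat (nonlinearity (theta z)).

Definition ynorm (t : R) : R := wnorm sg (profile t).

Lemma profile_wspace t : 0 <= t < T0 -> wspace sg (profile t).
Proof. by move=> /theta_Xspace[_ _ /Xspace_wspace[]]. Qed.

Definition source_cst : R := 16 * @fourier_constant R.

Lemma source_cst_ge0 : 0 <= source_cst.
Proof. by rewrite mulr_ge0// ltW// fourier_constant_gt0. Qed.

Lemma source_wspace z : 0 <= z < T0 -> good z ->
  wspace sg (source z) /\ wnorm sg (source z) <= source_cst * (ynorm z * kappa z).
Proof.
move=> zT gz; have X1 := theta_Xspace zT; have X2 := good_Xspace zT gz.
have b := nonlinearity_bound sg_range X1 X2.
have [ws e] := Xspace_wspace (le_lt_trans b (ltry _)); split=> //.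
rewrite -lee_fin -e; apply: le_trans b _.
have [_ _ /Xspace_wspace[_ ey]] := X1.
by rewrite /ynorm /profile /kappa ey.
Qed.

Lemma multiplier_fourier m T psi : schwartz psi ->
  multiplier m T (fourier psi) = cint mu2 setT (fun x => m x * fhat T x * psi x).
Proof. by move=> spsi; rewrite /multiplier /difourier fourierK. Qed.

(** Testing against [fourier psi] moves the whole equation to the frequency side, where every term
    is an integral against [psi]. *)
Lemma duhamel_fourier t psi : 0 <= t < T0 -> schwartz psi ->
  let F z := cint mu2 setT (fun x => heat_symbol alpha (t - z) x * source z x * psi x) in
  cintegrable mu1 `[0, t] F /\
  cint mu2 setT (fun x => profile t x * psi x) =
  cint mu2 setT (fun x => heat_symbol alpha t x * fhat theta0 x * psi x) -
  cint mu1 `[0, t] F.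
Proof.
move=> tT spsi F.
have [_ _ /(_ t _ _ (schwartz_fourier spsi))] := sol.
rewrite half_openE/= in_itv/= => /(_ tT)[iF e].
have FE : (fun z => multiplier (heat_symbol alpha (t - z)) (nonlinearity (theta z)) (fourier psi)) = F.
  by apply/funext => z; rewrite multiplier_fourier.
rewrite -FE; split=> //; rewrite -multiplier_fourier// -e.
have [_ fT _] := theta_Xspace tT.
by have [_ [_ h]] := fhat_spec fT; rewrite -[LHS]/(dist_of (fhat (theta t)) psi) -h.
Qed.

(* At an exceptional time the source need not be integrable against the weight;
   it is replaced by 0, so that limits can be taken at every time. *)
Definition good_source (b : bool) (z : R) (x : R * R) : R :=
  \1_good z * part b (source z x).

Lemma heat_symbolE t x : heat_symbol alpha t x = (heat lam t x)%:C.
Proof. by []. Qed.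

Lemma weak_duhamel_test b t p q p' q' : 0 <= t < T0 ->
  weak_duhamel lam (fun x => part b (fhat theta0 x)) (fun x => part b (profile t x))
    (good_source b) t (test_function p q p' q').
Proof.
move=> tT; set tf := test_function p q p' q'.
have [iF e] := duhamel_fourier tT (schwartz_test_function p q p' q').
have partr (z : R[i]) (r : R) : part b (z * r%:C) = part b z * r.
  by rewrite mulrC partZ mulrC.
have partF (s : R) (f : R * R -> R[i]) :
    part b (cint mu2 setT (fun x => heat_symbol alpha s x * f x * (tf x)%:C)) =
    Rintegral mu2 setT (fun x => part b (f x) * (heat lam s x * tf x)).
  rewrite part_cint; apply: eq_Rintegral => x _; rewrite partr heat_symbolE partZ.
  by ring.
pose F z := cint mu2 setT (fun x => heat_symbol alpha (t - z) x * source z x * (tf x)%:C).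
have FE z : forcing lam (good_source b) t z tf = \1_good z * part b (F z).
  rewrite /F partF /forcing /good_source indicE; case: (z \in good) => /=.
    by rewrite mul1r; apply: eq_Rintegral => x _; rewrite mul1r.
  transitivity (Rintegral mu2 setT (fun=> 0)).
    by apply: eq_Rintegral => x _; rewrite !mul0r.
  by rewrite /Rintegral integral0 mul0r.
have iF' : rintegrable mu1 `[0, t] (fun z => part b (F z)).
  by case: iF => i1 i2; case: (b); [exact: i2|exact: i1].
have mg : measurable_fun (`[0, t] : set R) (\1_good : R -> R).
  by apply: measurable_funTS; exact: (measurable_indic good_measurable).
have mF := rintegrable_measurable iF'.
have FE' : (fun z => forcing lam (good_source b) t z tf) = (fun z => \1_good z * part b (F z)).
  by apply/funext.
have mgF : measurable_fun `[0, t] (fun z => \1_good z * part b (F z)).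
  exact: measurable_funM.
split; rewrite FE'; first exact: mgF.
move: e => /(congr1 (part b)).
rewrite [X in _ = X]partB.
rewrite [X in _ = X - _](partF t (fhat theta0)).
rewrite [X in X = _](_ : _ = Rintegral mu2 setT (fun x => part b (profile t x) * tf x)); last first.
  by rewrite part_cint; apply: eq_Rintegral => x _; rewrite partr.
move=> ->; congr (_ - _); rewrite part_cint.
apply: (@Rintegral_ae_eq _ _ _ mu1 `[0, t]) => //.
apply: line_ae_impl good_ae => z gz _.
by rewrite indicE mem_set// mul1r.
Qed.

Lemma source_forcing b t M : t < T0 -> (forall z, 0 <= z <= t -> ynorm z <= M) ->
  forcing_bounded w (good_source b) (fun z => source_cst * M * kappa z) t.
Proof.
move=> tT yM.
have sub : `[0, t]%classic `<=` `[0, T0[%classic.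
  by move=> z /=; rewrite !in_itv/= => /andP[-> /le_lt_trans->].
split; last first.
  apply: rintegrableZl => //.
  exact: (@integrableS _ _ _ mu1 `[0, T0[ `[0, t] _ _ _ sub kappa_integrable).
move=> z; rewrite /= in_itv/= => zt.
have zT : 0 <= z < T0 by have := sub z; rewrite /= !in_itv/= => /(_ zt).
have M0 : 0 <= M by apply: le_trans (yM z zt); exact: wnorm_ge0.
have N0 : 0 <= source_cst * M * kappa z.
  by rewrite mulr_ge0 ?kappa_ge0// mulr_ge0 ?source_cst_ge0.
have [gz|gz] := pselect (good z); last first.
  rewrite (_ : good_source b z = fun=> 0); last first.
    by apply/funext => x; rewrite /good_source indicE memNset// mul0r.
  split; last by under eq_Rintegral do rewrite normr0 mulr0; rewrite /Rintegral integral0.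
  split; first exact: measurable_cst.
  by under eq_fun do rewrite normr0 mulr0; exact: integrable0.
rewrite (_ : good_source b z = fun x => part b (source z x)); last first.
  by apply/funext => x; rewrite /good_source indicE mem_set// mul1r.
have [ws yn] := source_wspace zT gz.
have [wb ib] := wspace_weighted b ws; split; first exact: wb.
apply: le_trans ib _; apply: le_trans yn _.
by rewrite -mulrA ler_wpM2l ?source_cst_ge0// ler_wpM2r ?kappa_ge0// yM.
Qed.

(** The factor 2 adds the bounds of the real and imaginary parts. The bound [M] is asked from time 0
    on, because Duhamel's formula starts there, while the integral of [kappa] runs over []s, t]]
    only. *)
Lemma evolution_bound s t M : 0 <= s <= t -> t < T0 ->
  (forall z, 0 <= z <= t -> ynorm z <= M) ->
  wnorm sg (fun x => profile t x - (heat lam (t - s) x)%:C * profile s x) <=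
  2 * (source_cst * M) * Rintegral mu1 `]s, t] kappa.
Proof.
move=> st tT yM; have /andP[s0 st'] := st.
have sT : 0 <= s < T0 by rewrite s0 (le_lt_trans st').
have t0T : 0 <= t < T0 by rewrite tT (le_trans s0).
have wp := profile_wspace t0T; have wps := profile_wspace sT.
have [wh _] := wspace_heat lam_measurable lam_ge0 (t := t - s)
  ltac:(by rewrite subr_ge0) wps.
have wd := wspaceB wp wh.
have w0 : wspace sg (fhat theta0) by have [_ _ /Xspace_wspace[]] := initial.
have [K0 gK] := gaussian_le_weight sg_range.
have b j : Rintegral mu2 setT (fun x => w x * `|part j
      (profile t x - (heat lam (t - s) x)%:C * profile s x)|) <=
    source_cst * M * Rintegral mu1 `]s, t] kappa.
  have ik : rintegrable mu1 `]s, t] kappa.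
    apply: (@integrableS _ _ _ mu1 `[0, T0[ `]s, t] _ _ _ _ kappa_integrable) => //.
    move=> z /=; rewrite !in_itv/= => /andP[sz /le_lt_trans->//].
    by rewrite (le_trans s0 (ltW sz)).
  have -> : source_cst * M * Rintegral mu1 `]s, t] kappa =
      Rintegral mu1 `]s, t] (fun z => source_cst * M * kappa z).
    by rewrite (@RintegralZl _ _ _ mu1).
  have := @restart_bound R w lam K0 (@weight_measurable R sg) (weight_gt0 sg) gK
    lam_measurable lam_ge0 _ _ _ (good_source j) _ s t st
    (wspace_weighted j w0).1 (wspace_weighted j wps).1 (wspace_weighted j wp).1
    (source_forcing j tT yM)
    (fun p q p' q' => weak_duhamel_test j p q p' q' sT)
    (fun p q p' q' => weak_duhamel_test j p q p' q' t0T).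
  apply: le_trans; rewrite le_eqVlt; apply/orP; left; apply/eqP.
  by apply: eq_Rintegral => x _; rewrite partB partZ.
apply: le_trans (wnorm_le_part wd) _.
apply: (le_trans (lerD (b false) (b true))).
move: (source_cst * M) (Rintegral _ _ _) => u v.
by rewrite le_eqVlt; apply/orP; left; apply/eqP; ring.
Qed.

Lemma kappa_tail (e : R) : 0 < e -> exists k, forall s t, ts k <= s -> t < T0 ->
  Rintegral mu1 `]s, t] kappa <= e.
Proof.
move=> e0; pose f k z := kappa z * \1_(`]ts k, +oo[%classic : set R) z.
have mI k : measurable_fun (`[0, T0[ : set R) (\1_(`]ts k, +oo[%classic : set R) : R -> R).
  by apply: measurable_funTS; apply: measurable_indic; exact: measurable_itv.
have mf k : measurable_fun `[0, T0[ (f k).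
  by apply: measurable_funM => //; exact: rintegrable_measurable kappa_integrable.
have fb k z : `|f k z| <= kappa z.
  rewrite normrM ger0_norm ?kappa_ge0// ler_piMr ?kappa_ge0//.
  by rewrite indicE; case: (_ \in _); rewrite ?normr1 ?normr0.
have ifk k : rintegrable mu1 `[0, T0[ (f k).
  exact: (@rintegrable_dominated _ _ _ mu1 `[0, T0[ (f k) kappa (measurable_itv _)
    (mf k) (fun z _ => fb k z) kappa_integrable).
have lim : {ae mu1, forall z, `[0, T0[%classic z -> f k z @[k --> \oo] --> (0 : R)}.
  apply: nearW => z; rewrite /= in_itv/= => /andP[_ zT].
  apply: cvg_near_cst; near=> k; rewrite /f indicE memNset ?mulr0//= in_itv/= andbT.
  apply/negP; rewrite -leNgt ltW//; near: k.
  exact: (cvgr_gt T0 cvg_left_approx).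
have dom : {ae mu1, forall z, `[0, T0[%classic z -> forall k, `|f k z| <= kappa z}.
  by apply: nearW => z _ k; exact: fb.
have [_ _] := @Rintegral_dominated _ _ _ mu1 `[0, T0[ f (fun=> 0) kappa
  (measurable_itv _) mf (measurable_cst _) lim kappa_integrable dom.
rewrite [X in _ --> X](_ : _ = 0); last by rewrite /Rintegral integral0.
move=> /cvgr_lt/(_ e e0)[k _ /(_ k (leqnn k)) ke].
exists k => s t ks tT; apply: le_trans (ltW ke).
have /andP[k0 _] := left_approx_itv k.
have sub : `]s, t]%classic `<=` `[0, T0[%classic.
  move=> z /=; rewrite !in_itv/= => /andP[sz /le_lt_trans->//].
  by rewrite (le_trans k0 (le_trans ks (ltW sz))).
have -> : Rintegral mu1 `]s, t] kappa = Rintegral mu1 `]s, t] (f k).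
  apply: eq_Rintegral => z; rewrite inE/= in_itv/= => /andP[sz _].
  by rewrite /f indicE mem_set ?mulr1//= in_itv/= andbT (le_lt_trans ks).
have ifs : rintegrable mu1 `]s, t] (f k).
  exact: (@integrableS _ _ _ mu1 `[0, T0[ `]s, t] _ _ _ sub (ifk k)).
rewrite -lee_fin !Rintegral_EFin//; apply: ge0_subset_integral => //.
  by apply/measurable_EFinP; exact: mf.
by move=> z _; rewrite lee_fin mulr_ge0 ?kappa_ge0// indicE.
Unshelve. all: by end_near. Qed.

(** The maximum is attained, hence finite; this is what allows a fraction of it to be absorbed in
    [ynorm_bounded]. *)
Lemma ynorm_max t : 0 <= t < T0 ->
  exists c, 0 <= c <= t /\ forall z, 0 <= z <= t -> ynorm z <= ynorm c.
Proof.
move=> /andP[t0 tT].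
have cont : {within `[0, t], continuous ynorm}.
  apply/subspace_continuousP => u; rewrite /= in_itv/= => /andP[u0 ut].
  have uT : 0 <= u < T0 by rewrite u0 (le_lt_trans ut).
  apply/cvgrPdist_lt => e e0.
  have [[_ /(_ u)]] := sol; rewrite half_openE/= in_itv/= => /(_ uT) h _ _.
  have := h [set x | (x < e%:E)%E]; rewrite /= => /(_ _)-[].
    by apply: open_nbhs_nbhs; split; [exact: open_ereal_lt_ereal|rewrite /= lte_fin].
  move=> d d0 H; exists d => //= v uv; rewrite in_itv/= => /andP[v0 vt].
  have vT : 0 <= v < T0 by rewrite v0 (le_lt_trans vt).
  have := H v uv; rewrite /= in_itv/= => /(_ vT).
  rewrite Xnorm_dsub; [|exact: theta_Xspace..]; rewrite lte_fin; apply: le_lt_trans.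
  have wu := profile_wspace uT; have wv := profile_wspace vT.
  have h1 := wnorm_le_distD wu wv; have h2 := wnorm_le_distD wv wu.
  rewrite (wnormC _ (profile u)) in h1.
  have dist (a b c : R) : a <= b + c -> b <= a + c -> `|a - b| <= c.
    by move=> ? ?; rewrite ler_norml; apply/andP; split; lra.
  exact: dist h1 h2.
have [c] := EVT_max t0 cont; rewrite in_itv/= => ct H.
by exists c; split=> // z zt; apply: H; rewrite in_itv.
Qed.

(* Past a time after which the integral of [kappa] is small, the maximum of
   [ynorm] over [0, t], if attained late, is at most its value at that time plus
   half of itself. *)
Lemma ynorm_bounded : exists M, 0 <= M /\ forall t, 0 <= t < T0 -> ynorm t <= M.
Proof.
(* With tails below [e], the nonlinear term [2 * source_cst * ynorm c' * e] is at most half of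
   [ynorm c']; the [+ 1] keeps the denominator positive. Absorbing this half leaves twice the
   earlier maximum [ynorm c]. *)
pose e := (4 * (source_cst + 1))^-1.
have C0 := source_cst_ge0.
have e0 : 0 < e by rewrite invr_gt0 mulr_gt0// ltr_wpDl.
have [k Hk] := kappa_tail e0.
have sT := left_approx_itv k; have [c [cs Hc]] := ynorm_max sT.
have y0 t : 0 <= ynorm t by exact: wnorm_ge0.
exists (2 * ynorm c); split; first by rewrite mulr_ge0.
move=> t tT; have [c' [ct Hc']] := ynorm_max tT.
have /andP[t0 tT'] := tT; have /andP[c'0 c't] := ct.
apply: le_trans (Hc' t _) _; first by rewrite t0 lexx.
have [c's|sc'] := leP c' (ts k).
  have := Hc c'; rewrite c'0 c's => /(_ isT) h; have := y0 c; lra.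
have /andP[s0 sT'] := sT.
have c'T := le_lt_trans c't tT'.
have st : 0 <= ts k <= c' by rewrite s0 ltW.
have ev := evolution_bound st c'T
  (fun z zc => Hc' z ltac:(by have /andP[-> /le_trans->] := zc)).
have wp : wspace sg (profile c') by apply: profile_wspace; rewrite c'0.
have wps := profile_wspace sT.
have [wh hle] := wspace_heat lam_measurable lam_ge0 (t := c' - ts k)
  ltac:(by rewrite subr_ge0 ltW) wps.
have h := wnorm_le_distD wp wh.
have ys : ynorm (ts k) <= ynorm c by apply: Hc; rewrite s0 lexx.
have tail := Hk _ _ (lexx (ts k)) c'T.
have half : 2 * (source_cst * ynorm c') * Rintegral mu1 `]ts k, c'] kappa <= 2^-1 * ynorm c'.
  apply: (le_trans (ler_wpM2l _ tail)); first by rewrite mulr_ge0// mulr_ge0.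
  rewrite -[X in _ <= X]mulr1 (_ : 2 * (source_cst * ynorm c') * e =
    2^-1 * ynorm c' * (source_cst / (source_cst + 1))); last first.
    move: C0; rewrite /e; move: source_cst (ynorm c') => u v u0.
    by field; apply/negP => /eqP; lra.
  by rewrite ler_wpM2l ?mulr_ge0// ler_pdivrMr ?ltr_wpDl// mul1r lerDl.
rewrite /ynorm in ys half *; rewrite -/(ynorm c') in half *.
move: ev h hle; rewrite -/(ynorm c').
move: half ys; rewrite -/(ynorm c) -/(ynorm (ts k)).
lra.
Qed.

Lemma left_approx_le j k : (j <= k)%N -> ts j <= ts k.
Proof.
by move=> jk; rewrite lerD2l lerN2 ler_wpM2l ?(ltW T0_gt0)// lef_pV2 ?posrE// ler_nat.
Qed.

(* For times [t_k] increasing fast enough, the profiles [q_k] obtained by letting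
   the linear evolution run from [t_k] up to [T0] have summable increments. *)
Lemma limit_profile : exists g, wspace sg g /\ forall e : R, 0 < e ->
  exists s, 0 <= s < T0 /\ forall t, s <= t < T0 ->
    wnorm sg (fun x => profile t x - g x) <= e.
Proof.
have [M [M0 yM]] := ynorm_bounded.
pose B := 2 * (source_cst * M).
have B0 : 0 <= B by rewrite mulr_ge0// mulr_ge0// source_cst_ge0.
pose r (k : nat) : R := 1 / (2 ^ k.+1)%:R.
have r0 k : 0 < r k by rewrite divr_gt0// ltr0n expn_gt0.
have /choice[n nP] k : exists n, forall s t, ts n <= s -> t < T0 ->
    B * Rintegral mu1 `]s, t] kappa <= r k.
  have [|n Hn] := @kappa_tail (r k / (B + 1)); first by rewrite divr_gt0 ?ltr_wpDl.
  exists n => s t ns tT; apply: (le_trans (ler_wpM2l B0 (Hn s t ns tT))).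
  by rewrite mulrCA ler_piMr ?(ltW (r0 k))// ler_pdivrMr ?ltr_wpDl// mul1r lerDl.
(* Running maxima make the times [s k] nondecreasing while keeping the tail after [s k] below
   [r k]. *)
pose N := fix N k := if k is k'.+1 then maxn (N k') (n k) else n 0%N.
have nN k : (n k <= N k)%N by case: k => [|k] /=; rewrite ?leq_maxr.
pose s k := ts (N k).
have sT k : 0 <= s k < T0 := left_approx_itv (N k).
have sS k : s k <= s k.+1 by apply: left_approx_le; rewrite /= leq_maxl.
have tail k t : s k <= t -> t < T0 ->
    wnorm sg (fun x => profile t x - (heat lam (t - s k) x)%:C * profile (s k) x) <= r k.
  move=> kt tT; have /andP[s0 _] := sT k.
  have st : 0 <= s k <= t by rewrite s0.
  apply: le_trans (evolution_bound st tT (M := M) _) _.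
    by move=> z /andP[z0 zt]; apply: yM; rewrite z0 (le_lt_trans zt).
  by apply: nP => //; exact: left_approx_le.
pose q k x := (heat lam (T0 - s k) x)%:C * profile (s k) x.
have sle k : 0 <= T0 - s k by rewrite subr_ge0 ltW//; have /andP[] := sT k.
have wq k : wspace sg (q k).
  by have [] := wspace_heat lam_measurable lam_ge0 (sle k) (profile_wspace (sT k)).
have qd k : wnorm sg (fun x => q k.+1 x - q k x) <= r k.
  (* The increment is the heat flow over [T0 - s k.+1] of the difference bounded by [tail] at the
     time [s k.+1], and the heat flow is a contraction. *)
  have /andP[_ sT'] := sT k.+1; apply: le_trans (tail k _ (sS k) sT').
  have ss : 0 <= s k.+1 - s k by rewrite subr_ge0.
  have [wh _] := wspace_heat lam_measurable lam_ge0 ss (profile_wspace (sT k)).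
  have wd := wspaceB (profile_wspace (sT k.+1)) wh.
  have [_] := wspace_heat lam_measurable lam_ge0 (sle k.+1) wd.
  apply: le_trans; rewrite le_eqVlt; apply/orP; left; apply/eqP; congr wnorm.
  apply/funext => x; rewrite /q mulrBr mulrA -rmorphM -heatD.
  by congr (_ - (heat lam _ x)%:C * _); ring.
have [g [wg gP]] := wspace_complete wq qd.
(* The three thirds compare [profile t] with the flow of [profile (s k)] up to [t], that flow with
   the flow up to [T0], which is [q k], and [q k] with [g]. *)
exists g; split=> // e e0; have e3 : 0 < e / 3 by rewrite divr_gt0.
have rsmall : \forall k \near \oo, r k < e / 3.
  apply: (cvgr_lt 0) e3.
  rewrite (_ : r = geometric 2^-1 2^-1); last first.
    by apply/funext => k; rewrite /r /geometric/= natrX exprS invfM exprVn mul1r.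
  by apply: cvg_geometric; rewrite ger0_norm// invf_lt1// ltr1n.
have [k [rk qk]] : exists k, r k < e / 3 /\ wnorm sg (fun x => q k x - g x) <= e / 3.
  have [k _ /(_ k (leqnn k)) H] := filterI rsmall (gP _ e3).
  by exists k.
have [d d0 Hd] := wnorm_heat_near0 lam_measurable lam_ge0 (profile_wspace (sT k)) e3.
pose s' := Num.max (s k) (T0 - d).
have /andP[sk0 skT] := sT k.
exists s'; split.
  by rewrite le_max sk0/= gt_max skT ltrBlDr ltrDl.
move=> t /andP[]; rewrite ge_max => /andP[skt dt] tT.
have tk : 0 <= t - s k by rewrite subr_ge0.
have wp := profile_wspace (sT k).
have [wh _] := wspace_heat lam_measurable lam_ge0 tk wp.
have wt : wspace sg (profile t) by apply: profile_wspace; rewrite tT (le_trans sk0).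
have h1 := wnorm_triangle wt wh wg.
have h2 := wnorm_triangle wh (wq k) wg.
have h3 := tail k t skt tT.
(* Both functions are flows of [profile (s k)]; their difference is the contraction [heat (t - s k)]
   applied to [(1 - heat (T0 - t)) * profile (s k)], which is small by the choice of [d]. *)
have h4 : wnorm sg (fun x => (heat lam (t - s k) x)%:C * profile (s k) x - q k x) <= e / 3.
  have rd : 0 <= T0 - t <= d by rewrite subr_ge0 (ltW tT) lerBlDl -lerBlDr.
  apply: le_trans (Hd _ rd).
  have mm : cmeasurable_on setT
      (fun x => (1 - heat lam (T0 - t) x)%:C * profile (s k) x).
    apply: cmeasurable_onM; last by case: wp.
    apply: cmeasurable_on_real; apply: measurable_funB => //.
    exact: (heat_measurable lam_measurable).
  have le x : cmod ((1 - heat lam (T0 - t) x)%:C * profile (s k) x) <=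
      cmod (profile (s k) x).
    rewrite cmodM cmod_real ler_piMl ?cmod_ge0// ger0_norm.
      by rewrite gerBl ltW// heat_gt0.
    by rewrite subr_ge0 heat_le1//; [exact: lam_ge0|have /andP[] := rd].
  have [md _] := wspace_le mm wp le.
  have [_] := wspace_heat lam_measurable lam_ge0 tk md.
  apply: le_trans; rewrite le_eqVlt; apply/orP; left; apply/eqP; congr wnorm.
  apply/funext => x; rewrite /q mulrA -rmorphM mulrBr mulr1 -heatD rmorphB mulrBl.
  by congr (_ - (heat lam _ x)%:C * _); ring.
apply: (le_trans h1); move: h2 h3 h4 qk rk.
move: (wnorm _ _) (wnorm _ _) (wnorm _ _) (wnorm _ _) (r k) => a b c f u.
lra.
Qed.

Lemma cvg_heat_pairing b f (r : nat -> R) (l : R) : cintegrable mu2 setT f ->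
  (forall n, 0 <= r n) -> r n @[n --> \oo] --> l ->
  part b (cint mu2 setT (fun x => (heat lam (r n) x)%:C * f x)) @[n --> \oo] -->
  part b (cint mu2 setT (fun x => (heat lam l x)%:C * f x)).
Proof.
move=> fi r0 rl; have mp := part_measurable b (cintegrable_cmeasurable fi).
have E s : part b (cint mu2 setT (fun x => (heat lam s x)%:C * f x)) =
    Rintegral mu2 setT (fun x => heat lam s x * part b (f x)).
  by rewrite part_cint; apply: eq_Rintegral => x _; rewrite partZ.
rewrite [X in _ --> X](E l) (_ : (fun n => _) = fun n =>
    Rintegral mu2 setT (fun x => heat lam (r n) x * part b (f x))); last first.
  by apply/funext => n; exact: E.
have m s : measurable_fun setT (fun x => heat lam s x * part b (f x)).
  by apply: measurable_funM => //; exact: (heat_measurable lam_measurable).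
have lim : {ae mu2, forall x, setT x ->
    heat lam (r n) x * part b (f x) @[n --> \oo] --> heat lam l x * part b (f x)}.
  apply: nearW => x _; apply: cvgM; last exact: cvg_cst.
  have c : - r n * lam x @[n --> \oo] --> - l * lam x.
    by apply: cvgM; [exact: cvgN|exact: cvg_cst].
  by apply: cvg_comp c _; exact: continuous_expR.
have dom : {ae mu2, forall x, setT x -> forall n,
    `|heat lam (r n) x * part b (f x)| <= cmod (f x)}.
  apply: nearW => x _ n; rewrite normrM ger0_norm ?(ltW (heat_gt0 _ _ _))//.
  apply: le_trans (part_le b _); rewrite ler_piMl// heat_le1//; exact: lam_ge0.
by have [_ _] := @Rintegral_dominated _ _ _ mu2 setT _ _ _ measurableT
  (fun n => m (r n)) (m l) lim (cintegrable_cmod measurableT fi) dom.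
Qed.

(** * The extended solution and its equation at the final time *)

Section limit_equation.
Variable g : R * R -> R[i].
Hypothesis wg : wspace sg g.
Hypothesis glim : forall e : R, 0 < e -> exists s, 0 <= s < T0 /\
  forall t, s <= t < T0 -> wnorm sg (fun x => profile t x - g x) <= e.

Let source_pairing (psi : R * R -> R[i]) (r z : R) := cint mu2 setT
  (fun x => heat_symbol alpha (r - z) x * source z x * psi x).

Let cvg_profile b psi : schwartz psi ->
  part b (cint mu2 setT (fun x => profile (ts n) x * psi x)) @[n --> \oo] -->
  part b (cint mu2 setT (fun x => g x * psi x)).
Proof.
move=> spsi; have [K [K0 HK]] := schwartz_le_weight sg_range spsi.
apply/cvgrPdist_le => e e0.
have e1 : 0 < e / (2 * K + 1) by rewrite divr_gt0// ltr_wpDl// mulr_ge0.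
have [s [/andP[_ sT] Hs]] := glim e1.
near=> n; rewrite distrC.
have tT := left_approx_itv n; have wp := profile_wspace tT; have /andP[_ tT'] := tT.
have i1 := wspace_schwartz_integrable sg_range wp spsi.
have i2 := wspace_schwartz_integrable sg_range wg spsi.
have i2' := cintegrableZ (- 1) measurableT i2.
rewrite -partB.
have -> : cint mu2 setT (fun x => profile (ts n) x * psi x) -
    cint mu2 setT (fun x => g x * psi x) =
    cint mu2 setT (fun x => (profile (ts n) x - g x) * psi x).
  rewrite -mulN1r -(cintZ (- 1) measurableT i2) -(cintD measurableT i1 i2').
  by apply: eq_cint => x _; ring.
apply: le_trans (part_le b _) _.
have [_ h] := wspace_pairing (wspaceB wp wg) (schwartz_measurable spsi) HK.
have sn : s <= ts n < T0.
  rewrite tT' andbT ltW//; near: n; exact: (cvgr_gt T0 cvg_left_approx).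
apply: le_trans h _; rewrite mulrA.
apply: (le_trans (ler_wpM2l _ (Hs _ sn))); first by rewrite mulr_ge0.
have K1 : 0 < 2 * K + 1 by rewrite ltr_wpDl// mulr_ge0.
by rewrite mulrCA ler_piMr ?(ltW e0)// ler_pdivrMr// mul1r lerDl.
Unshelve. all: by end_near. Qed.

Let source_integrable psi z : schwartz psi ->
  cintegrable mu2 setT (fun x => source z x * psi x).
Proof. exact: fhat_schwartz_integrable. Qed.

Let source_pairingE psi r z : source_pairing psi r z =
  cint mu2 setT (fun x => (heat lam (r - z) x)%:C * (source z x * psi x)).
Proof. by apply: eq_cint => x _; rewrite mulrA. Qed.

Let cvg_source_pairing b psi z : schwartz psi -> z < T0 ->
  part b (source_pairing psi (ts n) z) @[n --> \oo] -->
  part b (source_pairing psi T0 z).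
Proof.
move=> spsi zT; rewrite source_pairingE.
(* [cvg_heat_pairing] asks for nonnegative times at every index, whereas [ts n - z] is negative
   until [ts n] passes [z]; the maximum alters finitely many terms. *)
have m0 n : 0 <= Num.max (ts n - z) 0 by rewrite le_max lexx orbT.
have lim : Num.max (ts n - z) 0 @[n --> \oo] --> T0 - z.
  have c : ts n - z @[n --> \oo] --> T0 - z.
    by apply: cvgB; [exact: cvg_left_approx|exact: cvg_cst].
  apply: cvg_trans c; apply: near_eq_cvg; near=> n.
  apply/esym/max_idPl; rewrite subr_ge0 ltW//; near: n.
  exact: (cvgr_gt T0 cvg_left_approx).
have c := cvg_heat_pairing (b := b) (source_integrable z spsi) m0 lim.
apply: cvg_trans c.
apply: near_eq_cvg; near=> n; rewrite source_pairingE.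
congr (part b (cint _ _ _)); apply/funext => x; congr ((heat lam _ x)%:C * _).
apply/max_idPl; rewrite subr_ge0 ltW//; near: n.
exact: (cvgr_gt T0 cvg_left_approx).
Unshelve. all: by end_near. Qed.

(** The formula at the times [ts n] passes to the limit. The integrals over [[0, ts n]], extended by
    0, live on the fixed interval [[0, T0[]; the bound of [ynorm] up to [T0] gives them a common
    majorant, a multiple of [kappa], at good times. Measurability of the limit integrand is
    inherited from the approximations. *)
Lemma limit_duhamel psi : schwartz psi ->
  cintegrable mu1 `[0, T0[ (source_pairing psi T0) /\
  cint mu2 setT (fun x => g x * psi x) =
  cint mu2 setT (fun x => heat_symbol alpha T0 x * fhat theta0 x * psi x) -
  cint mu1 `[0, T0[ (source_pairing psi T0).
Proof.
move=> spsi; have [K [K0 HK]] := schwartz_le_weight sg_range spsi.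
have [M [M0 yM]] := ynorm_bounded.
pose L := 2 * K * (source_cst * M).
pose F b n := (fun z => part b (source_pairing psi (ts n) z)) \_ `[0, ts n].
have sub n : `[0, ts n]%classic `<=` `[0, T0[%classic.
  by rewrite itv_bigcup => z zn; exists n.
have iF b n : rintegrable mu1 `[0, ts n] (fun z => part b (source_pairing psi (ts n) z)).
  have [[i1 i2] _] := duhamel_fourier (left_approx_itv n) spsi.
  by case: b; [exact: i2|exact: i1].
have mF b n : measurable_fun `[0, T0[ (F b n).
  apply/(measurable_restrict _ _ _).
    exact: measurable_itv.
    exact: measurable_itv.
  rewrite setIidr//; exact: rintegrable_measurable (iF b n).
have main b : rintegrable mu1 `[0, T0[ (fun z => part b (source_pairing psi T0 z)) /\
    part b (cint mu2 setT (fun x => g x * psi x)) =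
    part b (cint mu2 setT (fun x => heat_symbol alpha T0 x * fhat theta0 x * psi x)) -
    Rintegral mu1 `[0, T0[ (fun z => part b (source_pairing psi T0 z)).
  have lim z : `[0, T0[%classic z -> F b n z @[n --> \oo] --> part b (source_pairing psi T0 z).
    rewrite /= in_itv/= => /andP[z0 zT].
    have c := cvg_source_pairing (b := b) spsi zT.
    apply: cvg_trans c.
    apply: near_eq_cvg; near=> n; rewrite /F patchE mem_set//= in_itv/= z0 ltW//.
    by near: n; exact: (cvgr_gt T0 cvg_left_approx).
  have mlim : measurable_fun `[0, T0[ (fun z => part b (source_pairing psi T0 z)).
    apply: (measurable_fun_cvg (h := F b)); [exact: mF|exact: lim].
  have dom : {ae mu1, forall z, `[0, T0[%classic z -> forall n, `|F b n z| <= L * kappa z}.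
    apply: line_ae_impl good_ae => z gz; rewrite /= in_itv/= => zT n.
    have L0 : 0 <= L * kappa z.
      apply: mulr_ge0; last exact: kappa_ge0.
      apply: mulr_ge0; first exact: mulr_ge0.
      by apply: mulr_ge0 => //; exact: source_cst_ge0.
    rewrite /F patchE; case: ifPn => [|_]; last by rewrite normr0.
    rewrite inE/= in_itv/= => /andP[_ zn].
    apply: le_trans (part_le b _) _.
    have tz : 0 <= ts n - z by rewrite subr_ge0.
    have [ws wsy] := source_wspace zT gz.
    have [wh whle] := wspace_heat lam_measurable lam_ge0 tz ws.
    have [_ h] := wspace_pairing wh (schwartz_measurable spsi) HK.
    apply: le_trans h _.
    have -> : L * kappa z = 2 * (K * (source_cst * (M * kappa z))).
      by rewrite /L; move: source_cst (kappa z) => u v; ring.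
    rewrite ler_wpM2l// ler_wpM2l//.
    apply: le_trans whle _; apply: le_trans wsy _.
    rewrite ler_wpM2l ?source_cst_ge0// ler_wpM2r ?kappa_ge0//.
    exact: yM.
  have iL : rintegrable mu1 `[0, T0[ (fun z => L * kappa z).
    by apply: rintegrableZl => //; exact: kappa_integrable.
  have alim : {ae mu1, forall z, `[0, T0[%classic z ->
      F b n z @[n --> \oo] --> part b (source_pairing psi T0 z)}.
    by apply: nearW; exact: lim.
  have [ilim _ c] := @Rintegral_dominated _ _ _ mu1 `[0, T0[ (F b)
    (fun z => part b (source_pairing psi T0 z)) (fun z => L * kappa z)
    (measurable_itv _) (mF b) mlim alim iL dom.
  split=> //.
  have initial_pairing : cintegrable mu2 setT (fun x => fhat theta0 x * psi x).
    exact: fhat_schwartz_integrable.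
  have h0 r : part b (cint mu2 setT (fun x => heat_symbol alpha r x * fhat theta0 x * psi x)) =
      part b (cint mu2 setT (fun x => (heat lam r x)%:C * (fhat theta0 x * psi x))).
    by congr part; apply: eq_cint => x _; rewrite mulrA.
  have ts0 n : 0 <= ts n by have /andP[] := left_approx_itv n.
  have c0 := cvg_heat_pairing (b := b) initial_pairing ts0 cvg_left_approx.
  rewrite [X in _ = X - _](h0 T0); apply: (cvg_unique (@Rhausdorff R) (cvg_profile (b := b) spsi)).
  rewrite (_ : (fun n => _) = (fun n =>
    part b (cint mu2 setT (fun x => (heat lam (ts n) x)%:C * (fhat theta0 x * psi x))) -
    Rintegral mu1 `[0, T0[ (F b n))); first exact: cvgB c0 c.
  apply/funext => n.
  have [_ ->] := duhamel_fourier (left_approx_itv n) spsi.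
  rewrite partB (h0 (ts n)); congr (_ - _); rewrite part_cint.
  have := @Rintegral_mkcondr _ _ _ mu1 `[0, T0[ `[0, ts n]
    (fun z => part b (source_pairing psi (ts n) z)).
  by rewrite (setIidr (@sub n)).
have [i1 e1] := main false; have [i2 e2] := main true.
split; first by split.
by apply: complex_ext; rewrite ?ReD ?ImD; [exact: e1|exact: e2].
Unshelve. all: by end_near. Qed.

Definition extension (t : R) : dist R :=
  if t < T0 then theta t else difourier (dist_of g).

Lemma extension_lt t : t < T0 -> extension t = theta t.
Proof. by rewrite /extension => ->. Qed.

Lemma extension_end : extension T0 = difourier (dist_of g).
Proof. by rewrite /extension ltxx. Qed.

Lemma extension_Xspace t : 0 <= t <= T0 -> Xspace sg (extension t).
Proof.
move=> /andP[t0]; rewrite le_eqVlt => /predU1P[->|tT].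
  by rewrite extension_end; exact: wspace_Xspace sg_range _ wg.
by rewrite extension_lt//; apply: theta_Xspace; rewrite t0.
Qed.

Lemma Xnorm_dsub_end t : 0 <= t < T0 ->
  Xnorm sg (dsub (theta t) (extension T0)) = (wnorm sg (fun x => profile t x - g x))%:E.
Proof.
move=> tT; have wt := profile_wspace tT.
have wX := wspace_Xspace sg_range wg.
rewrite extension_end Xnorm_dsub//; last exact: theta_Xspace.
congr _%:E; have [_ _ /Xspace_wspace[wh _]] := wX.
apply: (wspace_ae _ _ (wspaceB wt wh)).2; first by have [] := wspaceB wt wg.
by apply: plane_ae_impl (fhat_wspace_ae sg_range wg) => x ->.
Qed.

Lemma Xnorm_dsub_refl (T : dist R) : Xspace sg T -> Xnorm sg (dsub T T) = 0%E.
Proof.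
move=> XT; rewrite Xnorm_dsub//; congr _%:E; rewrite /wnorm.
by under eq_Rintegral do rewrite subrr cmod0 mulr0; rewrite /Rintegral integral0.
Qed.

Lemma extension_continuous : continuous_in_X `[0, T0] sg extension.
Proof.
split=> t; rewrite /= in_itv/=; first exact: extension_Xspace.
move=> /andP[t0]; rewrite le_eqVlt => /predU1P[->|tT].
  apply: cvge_0 => [x|e e0]; first exact: Xnorm_ge0.
  have [s [/andP[_ sT] Hs]] := glim e0.
  have near_s : \forall u \near T0, s < u by exact: lt_nbhsr.
  apply: filterS near_s => u su; rewrite /= in_itv/= => /andP[u0].
  rewrite le_eqVlt => /predU1P[->|uT].
    rewrite Xnorm_dsub_refl ?lee_fin ?ltW//.
    by apply: extension_Xspace; rewrite lexx ltW.
  by rewrite extension_lt// Xnorm_dsub_end ?u0// lee_fin Hs// uT ltW.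
have t0T : 0 <= t < T0 by rewrite t0.
have [[_ /(_ t)]] := sol; rewrite half_openE/= in_itv/= => /(_ t0T) h _ _.
rewrite (extension_lt tT).
apply: cvge_0 => [x|e e0]; first exact: Xnorm_ge0.
have near1 : \forall u \near t, u < T0 by exact: lt_nbhsl.
have near2 : \forall u \near t, `[0, T0[%classic u ->
    (Xnorm sg (dsub (theta u) (theta t)) < e%:E)%E.
  have := h [set x | (x < e%:E)%E]; apply.
  by apply: open_nbhs_nbhs; split; [exact: open_ereal_lt_ereal|rewrite /= lte_fin].
apply: filterS2 near1 near2 => u uT H; rewrite /= in_itv/= => /andP[u0 _].
by rewrite extension_lt// ltW// H//= in_itv/= u0.
Qed.

Lemma integrable_closed_itv (f : R -> \bar R) :
  mu1.-integrable `[0, T0[ f -> mu1.-integrable `[0, T0] f.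
Proof.
move=> /integrableP[mf fi].
have itvE : `[0, T0]%classic = `[0, T0[%classic `|` [set T0].
  by rewrite (@setUitv1 _ _ (BLeft 0) T0 true) ?bnd_simp ?ltW.
apply/integrableP; split.
  rewrite itvE; apply/measurable_funU => //; split=> //.
  exact: measurable_fun_set1.
move: fi; rewrite integral_itv_bndo_bndc//; exact: measurableT_comp.
Qed.

Lemma extension_integrable t : `[0, T0]%classic t -> integrable_in_X t 1 extension.
Proof.
rewrite /= in_itv/= => /andP[t0 tT]; split.
  have neT : {ae mu1, forall s, s != T0}.
    exists [set T0]; split=> //; first exact: lebesgue_measure_set1.
    by move=> s /= /negP; rewrite negbK => /eqP.
  have ae2 : {ae mu1, forall s, good s /\ s != T0}.
    exact: (@filterI _ _ (ae_filter_ringOfSetsType mu1) _ _ good_ae neT).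
  apply: line_ae_impl ae2 => s [gs sT]; rewrite /= in_itv/= => /andP[s0 st].
  have sT' : s < T0 by rewrite lt_neqAle sT (le_trans st).
  by rewrite extension_lt//; apply: good_Xspace => //; rewrite s0.
have ii : mu1.-integrable `[0, T0[ (fun s => Xnorm 1 (extension s)).
  apply: (eq_integrable _ _ _ _ Xnorm_integrable) => //.
  by move=> s; rewrite inE/= in_itv/= => /andP[_ sT]; rewrite extension_lt.
have iT := integrable_closed_itv ii.
apply: (@integrableS _ _ _ mu1 `[0, T0] `[0, t] _ _ _ _ iT) => //.
by apply: subset_itv; rewrite bnd_simp.
Qed.

Lemma extension_duhamel t : `[0, T0]%classic t -> duhamel alpha theta0 extension t.
Proof.
rewrite /= in_itv/= => /andP[t0]; rewrite le_eqVlt => /predU1P[->|tT].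
  move=> phi sphi F; pose psi := ifourier phi.
  have spsi : schwartz psi by exact: schwartz_ifourier.
  have phiE : phi = fourier psi by rewrite /psi ifourierK.
  have FE z : `[0, T0[%classic z -> F z = source_pairing psi T0 z.
    rewrite /= in_itv/= => /andP[_ zT].
    by rewrite /F extension_lt// phiE multiplier_fourier.
  have [[i1 i2] e] := limit_duhamel spsi.
  (* At [z = T0] the integrand involves the nonlinearity of the newly chosen value, which the limit
     says nothing about; a single time has measure zero. *)
  have ext (f h : R -> R) : (forall z, `[0, T0[%classic z -> f z = h z) ->
      rintegrable mu1 `[0, T0[ h -> rintegrable mu1 `[0, T0] f /\
      Rintegral mu1 `[0, T0] f = Rintegral mu1 `[0, T0[ h.
    move=> fh ih.
    have ifo : rintegrable mu1 `[0, T0[ f.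
      apply: (eq_integrable _ _ _ _ ih) => //.
      by move=> z; rewrite inE => zT; rewrite fh.
    have ic : rintegrable mu1 `[0, T0] f by exact: integrable_closed_itv.
    split=> //; rewrite -(@Rintegral_itv_bndo_bndc _ (BLeft 0) T0)//.
    by apply: eq_Rintegral => z; rewrite inE => zT; rewrite fh.
  have [j1 e1] := ext _ _ (fun z zT => congr1 (@complex.Re R) (FE z zT)) i1.
  have [j2 e2] := ext _ _ (fun z zT => congr1 (@complex.Im R) (FE z zT)) i2.
  split; first by split.
  have -> : cint mu1 `[0, T0] F = cint mu1 `[0, T0[ (source_pairing psi T0).
    by rewrite /cint e1 e2.
  by rewrite extension_end [in multiplier _ _ _]phiE multiplier_fourier// -e.
move=> phi sphi F; have t0T : 0 <= t < T0 by rewrite t0.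
have [_ _ /(_ t)] := sol; rewrite half_openE/= in_itv/= => /(_ t0T phi sphi)[].
set G := (fun z => multiplier _ _ _) => iG eG.
have FG z : `[0, t]%classic z -> F z = G z.
  rewrite /= in_itv/= => /andP[_ zt].
  by rewrite /F /G extension_lt// (le_lt_trans zt).
clearbody F G; split; last first.
  have e1 : extension t phi = theta t phi by rewrite extension_lt.
  have e2 := @eq_cint _ _ _ mu1 `[0, t] F G FG.
  by rewrite e1 e2; exact: eG.
case: iG => i1 i2; split.
  apply: (@eq_integrable _ _ _ mu1 `[0, t] _ (fun z => (complex.Re (G z))%:E) _ _ i1) => //.
  by move=> z; rewrite inE => /FG ->.
apply: (@eq_integrable _ _ _ mu1 `[0, t] _ (fun z => (complex.Im (G z))%:E) _ _ i2) => //.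
by move=> z; rewrite inE => /FG ->.
Qed.

Lemma extension_solution : solution alpha theta0 `[0, T0] extension.
Proof.
split; [exact: extension_continuous|exact: extension_integrable|].
exact: extension_duhamel.
Qed.

End limit_equation.

End evolution.

Theorem theorem1p2 (R : realType) (alpha : R) (halpha : 2^-1 < alpha <= 1)
    (theta0 : dist R) (htheta0 : Xspace (1 - 2 * alpha) theta0)
    (Tstar : \bar R) (theta : R -> dist R)
    (hmax : maximal_solution alpha theta0 Tstar theta) :
  (Tstar < +oo)%E ->
  (\int[@lebesgue_measure R]_(t in half_open Tstar) Xnorm 1 (theta t))%E
    = +oo%E.
Proof.
case: Tstar hmax => [T0| |] // [Tgt0 sol maximal] _; last by [].
have T0_gt0 : 0 < T0 by rewrite -lte_fin.
apply: contrapT => /eqP; rewrite -ltey half_openE => finite_integral.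
have [g [wg glim]] := limit_profile halpha T0_gt0 htheta0 sol finite_integral.
have extended := extension_solution halpha T0_gt0 htheta0 sol finite_integral wg glim.
(* The contradiction comes from the closed interval [[0, T0]]: it contains the half-open one
   strictly, since [T0] itself is a new time. *)
apply: maximal extended _; first by left; exists T0.
  rewrite half_openE; split.
    by move=> t /=; rewrite !in_itv/= => /andP[-> /ltW].
  by move=> /(_ T0); rewrite /= !in_itv/= lexx ltxx (ltW T0_gt0) => /(_ isT).
move=> t [_]; rewrite lte_fin => tT phi _.
by rewrite extension_lt.
Qed.
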